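(* Let $1<q\le p<\infty$, $K\in\mathbb{N}_0$, and let $f\in\mathrm{W}\mathcal{M}^p_q(\mathbb{R}^n)$. Then there exists a triplet $\{\lambda_j\}_{j=1}^\infty\subset[0,\infty)$, $\{Q_j\}_{j=1}^\infty\subset\mathcal{Q}(\mathbb{R}^n)$ and $\{a_j\}_{j=1}^\infty\subset L^\infty(\mathbb{R}^n)\cap\mathcal{P}_K(\mathbb{R}^n)^\perp$ such that $f=\sum_{j=1}^\infty\lambda_ja_j$ in $\mathcal{S}'(\mathbb{R}^n)$ and that $|a_j|\le\chi_{Q_j}$ for all $j$ and, for all $v>0$, $$\left\|\left(\sum_{j=1}^\infty(\lambda_j\chi_{Q_j})^v\right)^{\frac1v}\right\|_{\mathrm{W}\mathcal{M}^p_q}\le C_v\|f\|_{\mathrm{W}\mathcal{M}^p_q},$$ where the constant $C_v>0$ depends on $v$ (and on the fixed parameters $n,p,q,K$) but not on $f$.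
   Context: $\mathbb{N}_0=\mathbb{N}\cup\{0\}$. $L^0(\mathbb{R}^n)$ is the set of all measurable functions on $\mathbb{R}^n$, $\mathcal{Q}(\mathbb{R}^n)$ is the family of all cubes in $\mathbb{R}^n$ with sides parallel to the coordinate axes, $|E|$ is Lebesgue measure, $\chi_E$ is the indicator function of $E$, and $\mathcal{S}'(\mathbb{R}^n)$ is the space of tempered distributions. For $0<q\le p<\infty$, the Morrey quasi-norm is $\|f\|_{\mathcal{M}^p_q}=\sup_{Q\in\mathcal{Q}(\mathbb{R}^n)}|Q|^{\frac1p-\frac1q}\|f\chi_Q\|_{L^q}$, and the weak Morrey space $\mathrm{W}\mathcal{M}^p_q(\mathbb{R}^n)$ is the set of $f\in L^0(\mathbb{R}^n)$ with $\|f\|_{\mathrm{W}\mathcal{M}^p_q}=\sup_{\lambda>0}\lambda\|\chi_{\{x\in\mathbb{R}^n:|f(x)|>\lambda\}}\|_{\mathcal{M}^p_q}<\infty$. $\mathcal{P}_K(\mathbb{R}^n)^\perp$ denotes the set of all $f\in L^0(\mathbb{R}^n)$ for which $\langle\cdot\rangle^Kf\in L^1(\mathbb{R}^n)$ and $\int_{\mathbb{R}^n}x^\alpha f(x)\,dx=0$ for every $\alpha\in\mathbb{N}_0^n$ with $|\alpha|\le K$, where $\langle x\rangle=(1+|x|^2)^{1/2}$. *)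

(* Defs.v *)
From HB Require Import structures.
From mathcomp Require Import all_boot all_order all_algebra.
From mathcomp Require Import complex.
From mathcomp Require Import all_classical all_reals all_analysis.

Set Implicit Arguments.
Unset Strict Implicit.
Unset Printing Implicit Defensive.
Import Order.TTheory GRing.Theory Num.Theory.
Import numFieldNormedType.Exports.

Local Open Scope classical_set_scope.
Local Open Scope ring_scope.

Section measurable_rV.
Context (R : realType) (n : nat).

Definition rVcoord (i : 'I_n) (x : 'rV[R]_n) : measurableTypeR R := x ord0 i.

Let rV_set0 : g_sigma_preimage rVcoord set0.
Proof. exact: sigma_algebra0. Qed.

Let rV_setC A : g_sigma_preimage rVcoord A -> g_sigma_preimage rVcoord (~` A).
Proof. exact: sigma_algebraC. Qed.

Let rV_bigcup (F : (set 'rV[R]_n)^nat) :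
  (forall i, g_sigma_preimage rVcoord (F i)) ->
  g_sigma_preimage rVcoord (\bigcup_i (F i)).
Proof. exact: sigma_algebra_bigcup. Qed.

(* The Borel sigma-algebra of R^n, generated by the coordinates. *)
HB.instance Definition _ := @isMeasurable.Build default_measure_display
  'rV[R]_n (g_sigma_preimage rVcoord) rV_set0 rV_setC rV_bigcup.

Lemma measurable_rVcoord i : measurable_fun setT (rVcoord i).
Proof.
move=> _ Y mY; rewrite setTI; apply: sub_sigma_algebra => /=.
rewrite -bigcup_seq/=; exists i => /=; first by rewrite mem_index_enum.
by exists Y => //; rewrite setTI.
Qed.

Lemma measurable_fun_rV d (T : measurableType d) (f : T -> 'rV[R]_n) :
  (forall i, measurable_fun setT (rVcoord i \o f)) -> measurable_fun setT f.
Proof.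
move=> mf.
suff : g_sigma_preimage (fun i => rVcoord i \o f) `<=` measurable.
  by rewrite g_sigma_preimage_comp => prefS _ A mA; apply: prefS; exists A.
apply: smallest_sub; first exact: sigma_algebra_measurable.
apply: (big_ind (fun S => S `<=` measurable)) => //=.
- by move=> A B mA mB C [/mA|/mB].
- by move=> i _ A [B mB <-]; exact: mf.
Qed.

End measurable_rV.

Section rVcons.
Context (R : realType) (n : nat).

Definition rVcons (p : measurableTypeR R * 'rV[R]_n) : 'rV[R]_n.+1 :=
  \row_i (if unlift ord0 i is Some j then p.2 ord0 j else p.1).

Definition rVuncons (x : 'rV[R]_n.+1) : measurableTypeR R * 'rV[R]_n :=
  (x ord0 ord0, \row_j x ord0 (lift ord0 j)).

Lemma rVunconsK : cancel rVuncons rVcons.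
Proof.
by move=> x; apply/rowP => i; rewrite mxE; case: unliftP => [j|] ->; rewrite ?mxE.
Qed.

Lemma rVconsK : cancel rVcons rVuncons.
Proof.
move=> [a y]; rewrite /rVuncons mxE unlift_none; congr pair.
by apply/rowP => j; rewrite !mxE liftK.
Qed.

Lemma measurable_rVcons : measurable_fun setT rVcons.
Proof.
apply: measurable_fun_rV => i; case: (unliftP ord0 i) => [j|] ->.
  rewrite (_ : _ \o _ = rVcoord j \o snd); last first.
    by apply/funext => -[a y] /=; rewrite /rVcoord mxE liftK.
  by apply: measurableT_comp => //; exact: measurable_rVcoord.
rewrite (_ : _ \o _ = fst)//.
by apply/funext => -[a y] /=; rewrite /rVcoord mxE unlift_none.
Qed.

Lemma measurable_rVuncons : measurable_fun setT rVuncons.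
Proof.
apply/measurable_fun_pairP; split; first exact: (@measurable_rVcoord R n.+1 ord0).
apply: measurable_fun_rV => j.
rewrite (_ : _ \o _ = rVcoord (lift ord0 j)); first exact: measurable_rVcoord.
by apply/funext => x /=; rewrite /rVcoord mxE.
Qed.

End rVcons.

Section rVcons_measure.
Local Open Scope ereal_scope.
Context (R : realType) (n : nat).
Variable mu : {sigma_finite_measure set 'rV[R]_n -> \bar R}.

Definition rVcons_measure : set 'rV[R]_n.+1 -> \bar R :=
  pushforward (@lebesgue_measure R \x mu) (@rVcons R n).

Let measurable_rVcons := @measurable_rVcons R n.

Let rVcons_measure0 : rVcons_measure set0 = 0.
Proof. exact: measure0. Qed.

Let rVcons_measure_ge0 A : 0 <= rVcons_measure A.
Proof. exact: measure_ge0. Qed.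

Let rVcons_measure_sigma_additive : semi_sigma_additive rVcons_measure.
Proof. exact: measure_semi_sigma_additive. Qed.

HB.instance Definition _ := isMeasure.Build _ _ _ rVcons_measure
  rVcons_measure0 rVcons_measure_ge0 rVcons_measure_sigma_additive.

Let rVcons_measure_sigma_finite : sigma_finite setT rVcons_measure.
Proof.
have /sigma_finiteP[F [TF ndF Foo]] := sigma_finiteT (@lebesgue_measure R).
have /sigma_finiteP[G [TG ndG Goo]] := sigma_finiteT mu.
exists (fun k => @rVuncons R n @^-1` (F k `*` G k)).
  rewrite -preimage_bigcup -(preimage_setT (@rVuncons R n)); congr preimage.
  rewrite -setXTT TF TG predeqE => -[x y]; split.
    move=> [/= [k _ Fkx] [l _ Gly]]; exists (maxn k l) => //; split.
    - by move: x Fkx; exact/subsetPset/ndF/leq_maxl.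
    - by move: y Gly; exact/subsetPset/ndG/leq_maxr.
  by move=> [k _ []/= ? ?]; split; exists k.
move=> k; have [mF Fk] := Foo k; have [mG Gk] := Goo k; split.
  rewrite -[X in measurable X]setTI.
  by apply: measurable_rVuncons => //; exact: measurableX.
rewrite /rVcons_measure /pushforward (_ : _ @^-1` _ = F k `*` G k); last first.
  rewrite -comp_preimage (_ : _ \o _ = id)//.
  by apply/funext => p /=; rewrite rVconsK.
by rewrite product_measure1E// lte_mul_pinfty// ge0_fin_numE.
Qed.

HB.instance Definition _ := Measure_isSigmaFinite.Build _ _ _ rVcons_measure
  rVcons_measure_sigma_finite.

End rVcons_measure.

Section lebesgue_rV.
Local Open Scope ereal_scope.
Context (R : realType).

(* The product measure of n copies of the Lebesgue measure of R. *)
Fixpoint borel_lebesgue (n : nat) :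
    {sigma_finite_measure set 'rV[R]_n -> \bar R} :=
  match n with
  | 0 => @dirac _ 'rV[R]_0 0%R R
  | m.+1 => rVcons_measure (borel_lebesgue m)
  end.

Lemma borel_lebesgue_box (n : nat) (A : 'I_n -> set (measurableTypeR R)) :
  (forall i, measurable (A i)) ->
  borel_lebesgue n [set x | forall i, A i (x ord0 i)] =
  \prod_(i < n) lebesgue_measure (A i).
Proof.
elim: n A => [|n IHn] A mA.
  by rewrite big_ord0 /= diracE mem_set// => -[].
rewrite big_ord_recl -(IHn (A \o lift ord0))//; last by move=> i; exact: mA.
have mA' : measurable
    [set x : 'rV[R]_n | forall i, (A \o lift ord0) i (x ord0 i)].
  rewrite [X in measurable X](_ : _ = \bigcap_(i in [set: 'I_n])
      (@rVcoord R n i @^-1` A (lift ord0 i))).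
    apply: fin_bigcap_measurable => // i _; rewrite -[X in measurable X]setTI.
    exact: measurable_rVcoord.
  by apply/seteqP; split => x /= Ax i; [move=> _|]; exact: Ax.
rewrite -product_measure1E//.
rewrite /= /rVcons_measure /pushforward; congr (product_measure1 _ _ _).
apply/seteqP; split => -[a y] /= Aay.
  split=> [|i]; first by have := Aay ord0; rewrite mxE unlift_none.
  by have := Aay (lift ord0 i); rewrite mxE liftK.
by move=> i; rewrite mxE; case: unliftP => [j|] ->; [exact: Aay.2|exact: Aay.1].
Qed.

Definition lebesgue_space (n : nat) : measurableType _ :=
  caratheodory_type ((borel_lebesgue n)^*)%mu.

(* The Lebesgue measure of R^n, on the Lebesgue measurable sets, i.e. the
   completion of the Borel one. *)
Definition lebesgue (n : nat) : {measure set (lebesgue_space n) -> \bar R} :=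
  @completed_measure_extension _ _ _ (borel_lebesgue n).

Lemma lebesgue_borelE (n : nat) (A : set 'rV[R]_n) :
  measurable A -> lebesgue n A = borel_lebesgue n A.
Proof. by move=> mA; exact: measurable_mu_extE. Qed.

End lebesgue_rV.

Section complex_valued.
Context (R : realType) (n : nat).
Implicit Types f g : 'rV[R]_n -> R[i].

Definition cmod (z : R[i]) : R := ComplexField.Normc.normc z.

Definition cabs f (x : 'rV[R]_n) : \bar R := (cmod (f x))%:E.

Definition L0 f : Prop :=
  measurable_fun [set: lebesgue_space R n] (fun x => complex.Re (f x)) /\
  measurable_fun [set: lebesgue_space R n] (fun x => complex.Im (f x)).

Definition L1 f : Prop :=
  (lebesgue R n).-integrable setT (fun x => (complex.Re (f x))%:E) /\
  (lebesgue R n).-integrable setT (fun x => (complex.Im (f x))%:E).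

Definition cintegral f : R[i] :=
  Complex (\int[lebesgue R n]_x complex.Re (f x))
          (\int[lebesgue R n]_x complex.Im (f x)).

Definition Linfty f : Prop :=
  L0 f /\ (Lnorm (lebesgue R n) +oo (cabs f) < +oo)%E.

End complex_valued.

Section morrey.
Local Open Scope ereal_scope.
Context (R : realType) (n : nat).

(* Cubes are closed and non-degenerate; c is the center and r half the side. *)
Definition cube : set (set 'rV[R]_n) :=
  [set Q | exists c : 'rV[R]_n, exists2 r : R, (0 < r)%R &
    Q = [set x : 'rV[R]_n | forall i, (`|x ord0 i - c ord0 i| <= r)%R]].

(* The norms are defined on [-oo, +oo]-valued functions; a complex-valued f is
   measured through cabs f. *)
Definition morrey_norm (p q : R) (g : 'rV[R]_n -> \bar R) : \bar R :=
  ereal_sup [set lebesgue R n Q `^ (p^-1 - q^-1) *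
    Lnorm (lebesgue R n) q%:E (fun x => g x * (\1_Q x)%:E) | Q in cube].

Definition weak_morrey_norm (p q : R) (g : 'rV[R]_n -> \bar R) : \bar R :=
  ereal_sup [set l%:E *
    morrey_norm p q (fun x => (\1_[set y : 'rV[R]_n | (l%:E < `|g y|)%E] x)%:E)
    | l in [set l : R | (0 < l)%R]].

Definition weak_morrey (p q : R) (f : 'rV[R]_n -> R[i]) : Prop :=
  L0 f /\ weak_morrey_norm p q (cabs f) < +oo.

End morrey.

Section vanishing_moments.
Context (R : realType) (n : nat).

(* <x> = (1 + |x|^2)^(1/2) for the Euclidean norm (the library norm on row
   vectors is the sup norm). *)
Definition jbracket (x : 'rV[R]_n) : R :=
  Num.sqrt (1 + \sum_(i < n) x ord0 i ^+ 2).

Definition monomial (al : {ffun 'I_n -> nat}) (x : 'rV[R]_n) : R :=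
  \prod_(i < n) x ord0 i ^+ al i.

Definition Pperp (K : nat) (f : 'rV[R]_n -> R[i]) : Prop :=
  [/\ L0 f,
      L1 (fun x => (jbracket x ^+ K)%:C%C * f x) &
      forall al : {ffun 'I_n -> nat}, (\sum_(i < n) al i <= K)%N ->
        cintegral (fun x => (monomial al x)%:C%C * f x) = 0].

End vanishing_moments.

Section tempered_distributions.
Context (R : realType) (n : nat).
Implicit Types (phi : 'rV[R]_n -> R[i]) (T : ('rV[R]_n -> R[i]) -> R[i]).

(* d_(i1) ... d_(ik) g for s = [:: i1; ...; ik]. *)
Definition partials (s : seq 'I_n) (g : 'rV[R]_n -> R) : 'rV[R]_n -> R :=
  foldr (fun i h => 'D_(delta_mx ord0 i) h) g s.

Definition smooth (g : 'rV[R]_n -> R) : Prop :=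
  forall s, continuous (partials s g) /\
    forall i x, derivable (partials s g) x (delta_mx ord0 i).

Definition cpartials (s : seq 'I_n) phi (x : 'rV[R]_n) : R[i] :=
  Complex (partials s (fun y => complex.Re (phi y)) x)
          (partials s (fun y => complex.Im (phi y)) x).

Definition schwartz_seminorm (N : nat) phi : \bar R :=
  ereal_sup [set y | exists x, exists2 s, (size s <= N)%N &
    y = (jbracket x ^+ N * cmod (cpartials s phi x))%:E].

Definition schwartz phi : Prop :=
  [/\ smooth (fun x => complex.Re (phi x)),
      smooth (fun x => complex.Im (phi x)) &
      forall N, (schwartz_seminorm N phi < +oo)%E].

(* T, restricted to the Schwartz functions, is an element of S'(R^n). *)
Definition tempered T : Prop :=
  (forall (c : R[i]) phi psi, schwartz phi -> schwartz psi ->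
     T (fun x => c * phi x + psi x) = c * T phi + T psi) /\
  exists (N : nat) (C : R), forall phi, schwartz phi ->
    ((cmod (T phi))%:E <= C%:E * schwartz_seminorm N phi)%E.

Definition pairing (f phi : 'rV[R]_n -> R[i]) : R[i] :=
  cintegral (fun x => f x * phi x).

Definition tempered_fun (f : 'rV[R]_n -> R[i]) : Prop :=
  (forall phi, schwartz phi -> L1 (fun x => f x * phi x)) /\
  tempered (pairing f).

(* f = \sum_j u_j in S'(R^n), with its weak-* topology. *)
Definition tempered_sum (u : nat -> 'rV[R]_n -> R[i]) (f : 'rV[R]_n -> R[i]) :
    Prop :=
  [/\ tempered_fun f, forall j, tempered_fun (u j) &
      forall phi, schwartz phi ->
        cmod (pairing f phi - \sum_(j < N) pairing (u j) phi)
          @[N --> \oo] --> (0 : R)].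

End tempered_distributions.

(* Main.v *)
(* Let F = |f|, and call a dyadic cube hot at height t when F has average greater
   than t on it. The weak Morrey bound makes all large cubes cold, so that the set
   O_t covered by the hot cubes is the disjoint union of the maximal ones, the
   selected cubes; off O_t one has F <= t almost everywhere. Let g_k be f off
   O_(2^k) and, on each cube selected at height 2^k, a function with the same
   moments of order <= K as f there, so that |g_k| <= C 2^k. As the cubes selected at
   height 2^(k+1) sit inside those selected at height 2^k, the difference
   g_(k+1) - g_k splits into pieces, one per selected cube at height 2^k, with
   vanishing moments and size at most 3 C 2^k: these are the lambda_j a_j. Their sum
   telescopes to f almost everywhere.
     At a point outside O_(2^k0) only heights 2^k with k < k0 contribute, hence the
   sum of the (lambda_j chi_(Q_j))^v is there at most a geometric series of size
   2^(k0 v). Thus the superlevel sets of the left-hand side are contained in sets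
   O_t, whose measure in a cube is controlled by the weak Morrey norm of f. *)
Require Import Defs.
From HB Require Import structures.
From mathcomp Require Import all_boot all_order all_algebra.
From mathcomp Require Import complex.
From mathcomp Require Import all_classical all_reals all_analysis.
From mathcomp Require Import measurable_realfun ess_sup_inf.
From mathcomp Require Import ring lra zify.
Set Implicit Arguments.
Unset Strict Implicit.
Unset Printing Implicit Defensive.
Import Order.TTheory GRing.Theory Num.Theory.
Import numFieldNormedType.Exports.
Local Open Scope classical_set_scope.
Local Open Scope ring_scope.

(** * Dyadic cubes *)

(* [pickle] and [pickle_inv] are locked because unification otherwise tries to
   evaluate them. *)
Section encoding.
Context (C : countType).

(** Three mismatches shape the proof. The cubes of the norms and of the atoms are closed, while
    selection needs nested half-open cubes; the two kinds are compared off the null set of dyadic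
    faces, and through coverings by [2 ^ n] dyadic cubes. The domination of the atoms by indicators
    must hold at every point, while differentiation of averages is an almost everywhere statement;
    therefore [f] is replaced beforehand by a function that vanishes on a null set, which changes no
    average. Finally, the stopping estimates need a positive constant [A], while the norm of [f] may
    be 0; but coefficients, cubes and atoms do not depend on [A], so that [A] may be taken as close
    to the norm as desired once they are built. They do not depend on [v] either, and the case
    [v = 1] gives more than a norm bound: the sum of the [lambda_j chi_(Q_j)] is then itself a weak
    Morrey function, hence integrable against Schwartz functions, and as it dominates all partial
    sums, convergence in the sense of distributions reduces to dominated convergence. *)

Definition idx_code (c : C) : nat := locked (@pickle C) c.
Definition idx_decode (j : nat) : option C := locked (@pickle_inv C) j.

Lemma idx_codeK : pcancel idx_code idx_decode.
Proof. by move=> c; rewrite /idx_code /idx_decode -!lock pickleK_inv. Qed.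

Lemma idx_decodeK j c : idx_decode j = Some c -> j = idx_code c.
Proof.
rewrite /idx_code /idx_decode -!lock => jc; have := @pickle_invK C j.
by rewrite /oapp jc.
Qed.

Lemma idx_code_inj : injective idx_code.
Proof. exact: pcan_inj idx_codeK. Qed.

End encoding.

Section dyadic_cubes.
Context (R : realType) (n : nat).
Local Notation V := 'rV[R]_n.
Local Notation idx := {ffun 'I_n -> int}.
Implicit Types (m : int) (z : idx) (x y c : V).

(* The generation [m] ranges over all integers: the cubes [dcube m z] are half-open,
   have side [2 ^ (- m)], and grow as [m] decreases. *)
Definition dcell m x : idx := [ffun i => Num.floor (2 ^ m * x ord0 i)].
Definition dcube m z : set V := [set x | dcell m x = z].
Definition dcorner m z : V := \row_i (2 ^ (- m) * (z i)%:~R).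
Definition ccube c (r : R) : set V :=
  [set x | forall i, `|x ord0 i - c ord0 i| <= r].
Definition dcenter m z : V := \row_i (2 ^ (- m) * ((z i)%:~R + 2^-1)).

Lemma exprz2_gt0 m : 0 < 2 ^ m :> R. Proof. by rewrite exprz_gt0. Qed.

Lemma dcubeP m z x : dcube m z x <->
  forall i, (z i)%:~R <= 2 ^ m * x ord0 i < (z i)%:~R + 1.
Proof.
split=> [<- i|h].
  by rewrite ffunE floor_le/=; have := floorD1_gt (2 ^ m * x ord0 i); rewrite intrD.
apply/ffunP => i; rewrite ffunE; apply/floor_def.
by rewrite intrD; exact: h.
Qed.

Lemma dcell_corner m z : dcell m (dcorner m z) = z.
Proof.
apply/dcubeP => i; rewrite mxE mulrA -expfzDr// subrr expr0z mul1r lexx/=.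
by rewrite ltrDl.
Qed.

(** Scaled by [2 ^ m], the faces of a cell of generation [m'] are integers, and whether a real lies
    between two integers depends only on its floor. *)
Lemma dcell_nest m m' x y : m' <= m -> dcell m x = dcell m y ->
  dcell m' x = dcell m' y.
Proof.
move=> mm' xy; apply/esym/dcubeP => i; rewrite ffunE.
set Z := Num.floor _.
have [N mE] : exists N : nat, m = m' + N%:Z.
  by exists `|m - m'|%N; rewrite gez0_abs ?subr_ge0//; lia.
have zN : 0 < 2 ^ N%:Z :> R by exact: exprz2_gt0.
have e2 t : 2 ^ m * t = (2 ^ N%:Z) * (2 ^ m' * t) :> R.
  by rewrite mulrA mE addrC -expfzDr.
have /ffunP/(_ i) := xy; rewrite !ffunE => xyi.
have iE (a : int) : (a * 2 ^+ N)%:~R = 2 ^ N%:Z * a%:~R :> R.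
  by rewrite intrM mulrC rmorphXn.
have /andP[l1 l2] : Z%:~R <= 2 ^ m' * x ord0 i < Z%:~R + 1.
  by rewrite floor_le/=; have := floorD1_gt (2 ^ m' * x ord0 i); rewrite intrD.
have L1 : (Z * 2 ^+ N)%:~R <= 2 ^ m * x ord0 i.
  by rewrite iE e2 ler_pM2l.
have L2 : 2 ^ m * x ord0 i < ((Z + 1) * 2 ^+ N)%:~R.
  by rewrite iE e2 ltr_pM2l// intrD.
move: L1 L2; rewrite -floor_ge_int -floor_lt_int xyi floor_ge_int floor_lt_int.
by rewrite !iE !e2 ler_pM2l// ltr_pM2l// intrD => -> ->.
Qed.


Lemma measurable_box (A : 'I_n -> set (measurableTypeR R)) :
  (forall i, measurable (A i)) ->
  measurable [set x : V | forall i, A i (x ord0 i)].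
Proof.
move=> mA; rewrite [X in measurable X](_ : _ = \bigcap_(i in [set: 'I_n])
    (@rVcoord R n i @^-1` A i)).
  apply: fin_bigcap_measurable => // i _; rewrite -[X in measurable X]setTI.
  exact: measurable_rVcoord.
by apply/seteqP; split => x /= Ax i; [move=> _|]; exact: Ax.
Qed.

Lemma measurable_itv_box (J : 'I_n -> interval R) :
  measurable [set x : V | forall i, x ord0 i \in J i].
Proof. by apply: (measurable_box (A := fun i => [set` J i])) => i; exact: measurable_itv. Qed.

Lemma measurable_lebesgue_space (A : set V) :
  measurable A -> measurable (A : set (lebesgue_space R n)).
Proof. exact: caratheodory_measurable_mu_ext. Qed.

Lemma lebesgue_box (A : 'I_n -> set (measurableTypeR R)) :
  (forall i, measurable (A i)) ->
  lebesgue R n [set x | forall i, A i (x ord0 i)] =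
  (\prod_(i < n) lebesgue_measure (A i))%E.
Proof.
by move=> mA; rewrite lebesgue_borelE ?borel_lebesgue_box//; exact: measurable_box.
Qed.

Lemma lebesgue_itv_box (J : 'I_n -> interval R) (w : R) : 0 <= w ->
  (forall i, lebesgue_measure ([set` J i] : set R) = w%:E) ->
  lebesgue R n [set x | forall i, x ord0 i \in J i] = (w ^+ n)%:E.
Proof.
move=> w0 Jw; rewrite (lebesgue_box (A := fun i => [set` J i]))//.
rewrite (eq_bigr (fun=> w%:E))// prodEFin; congr EFin.
  by rewrite prodr_const card_ord.
Qed.

Lemma dcubeE m z : dcube m z = [set x | forall i, x ord0 i \in
  `[2 ^ (- m) * (z i)%:~R, 2 ^ (- m) * ((z i)%:~R + 1)[%R].
Proof.
have zm := exprz2_gt0 m.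
apply/seteqP; split=> [x /dcubeP xz i|x xz].
  by rewrite in_itv/= -!invr_expz ler_pdivrMl// ltr_pdivlMl.
apply/dcubeP => i; have := xz i.
by rewrite in_itv/= -!invr_expz ler_pdivrMl// ltr_pdivlMl.
Qed.

Lemma measurable_dcube m z : measurable (dcube m z).
Proof. by rewrite dcubeE; exact: measurable_itv_box. Qed.

Lemma lebesgue_dcube m z : lebesgue R n (dcube m z) = ((2 ^ (- m)) ^+ n)%:E.
Proof.
rewrite dcubeE (lebesgue_itv_box (w := 2 ^ (- m)))//; first exact/ltW/exprz2_gt0.
move=> i; rewrite lebesgue_measure_itv/= lte_fin ltr_pM2l ?exprz2_gt0// ltrDl ltr01.
by rewrite -EFinB mulrDr mulr1 addrAC subrr add0r.
Qed.

Lemma ccubeE c (r : R) : ccube c r = [set x | forall i, x ord0 i \in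
  `[c ord0 i - r, c ord0 i + r]%R].
Proof. by apply/seteqP; split=> x xc i; have := xc i; rewrite in_itv/= ler_distl. Qed.

Lemma measurable_ccube c r : measurable (ccube c r).
Proof. by rewrite ccubeE; exact: measurable_itv_box. Qed.

Lemma lebesgue_ccube c r : 0 < r -> lebesgue R n (ccube c r) = ((2 * r) ^+ n)%:E.
Proof.
move=> r0; rewrite ccubeE (lebesgue_itv_box (w := 2 * r))//; first by rewrite mulr_ge0// ltW.
move=> i; rewrite lebesgue_measure_itv/= lte_fin ltrD2l gtrN// -EFinB.
by congr EFin; ring.
Qed.

Lemma dcube_sub_ccube m z : dcube m z `<=` ccube (dcenter m z) (2 ^ (- m) / 2).
Proof.
move=> x; rewrite dcubeE => xz i; have := xz i; rewrite in_itv/= mxE ler_distl.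
by move=> /andP[]; have := exprz2_gt0 (- m); nra.
Qed.

Lemma lebesgue_hyperplane i (a : R) :
  lebesgue R n [set x | x ord0 i = a] = 0%E.
Proof.
pose A j : set (measurableTypeR R) := if j == i then [set a] else setT.
have mA j : measurable (A j) by rewrite /A; case: ifP.
rewrite (_ : [set x | _] = [set x | forall j, A j (x ord0 j)]); last first.
  apply/seteqP; split=> x /=; first by move=> xa j; rewrite /A; case: eqP => [->|].
  by move/(_ i); rewrite /A eqxx.
rewrite lebesgue_box// (bigD1 i)//= /A eqxx lebesgue_measure_set1.
by rewrite mul0e.
Qed.

Lemma ccube_dcube m z x : ccube (dcenter m z) (2 ^ (- m) / 2) x ->
  (forall i, x ord0 i != 2 ^ (- m) * ((z i)%:~R + 1)) -> dcube m z x.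
Proof.
move=> xz xb; rewrite dcubeE => i; have := xz i; rewrite in_itv/= mxE ler_distl.
rewrite lt_neqAle xb/= => /andP[]; have := exprz2_gt0 (- m) => h.
by move=> h1 h2; apply/andP; split; lra.
Qed.

(** All faces of all dyadic cubes, a countable union of hyperplanes. Off this null set a dyadic cube
    and its closure [ccube (dcenter m z) (2 ^ (- m) / 2)] contain the same points. *)
Definition dyadic_grid : set V :=
  \bigcup_(j : int * int * 'I_n)
    [set x | x ord0 j.2 = 2 ^ (- j.1.1) * (j.1.2)%:~R].

End dyadic_cubes.

(** * Generation of the Borel sets by dyadic cubes *)

Section dyadic_generation.
Context (R : realType) (n : nat).
Local Notation V := 'rV[R]_n.
Local Notation idx := {ffun 'I_n -> int}.
Local Notation dcube := (@dcube R n).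
Implicit Types (m : int) (z : idx) (x y c : V).

Lemma exprz2_lt (e : R) : 0 < e -> exists m : int, 0 <= m /\ 2 ^ (- m) < e.
Proof.
move=> e0; have [k ke] : exists k : nat, e^-1 < k%:R.
  by exists (Num.trunc (e^-1)).+1; exact: truncnS_gt.
exists k; split=> //; rewrite -invr_expz -exprnP -[ltRHS]invrK ltf_pV2 ?posrE ?invr_gt0 ?exprn_gt0//.
apply: (lt_le_trans ke); rewrite -natrX ler_nat.
exact/ltnW/ltn_expl.
Qed.

Lemma dcube_dist m x y i : dcell m x = dcell m y ->
  `|x ord0 i - y ord0 i| < 2 ^ (- m).
Proof.
move=> xy; have xz : dcube m (dcell m y) x by [].
have yz : dcube m (dcell m y) y by [].
move: xz yz; rewrite dcubeE => /(_ i) + /(_ i); rewrite !in_itv/=.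
rewrite mulrDr mulr1 => h1 h2; rewrite ltr_distl; apply/andP; split; lra.
Qed.

(** The open sets of the topology that has the dyadic cubes as a basis. Unlike Euclidean open sets
    they include the cubes and their complements, so that a single cube needs no approximation in
    the regularity argument. *)
Definition dopen (U : set V) :=
  forall x, U x -> exists m, dcube m (dcell m x) `<=` U.

Lemma dopen_bigcup T (P : set T) (U : T -> set V) :
  (forall i, P i -> dopen (U i)) -> dopen (\bigcup_(i in P) U i).
Proof.
move=> oU x [i Pi /(oU i Pi)[m mU]]; exists m => y /mU Uy; by exists i.
Qed.

Lemma dopenT : dopen setT.
Proof. by move=> x _; exists 0. Qed.

Lemma dopen_dcube m z : dopen (dcube m z).
Proof. by move=> x <-; exists m. Qed.

Lemma dopen_dcubeC m z : dopen (~` dcube m z).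
Proof.
by move=> x xz; exists m => y yx yz; apply: xz; exact: (etrans (esym yx) yz).
Qed.

Lemma dcube_sub m m' x : m' <= m -> dcube m (dcell m x) `<=` dcube m' (dcell m' x).
Proof. by move=> mm' y /(dcell_nest mm'). Qed.

Lemma dopenI U W : dopen U -> dopen W -> dopen (U `&` W).
Proof.
move=> oU oW x [/oU[a aU] /oW[b bW]]; exists (Order.max a b) => y xy; split.
  by apply/aU/(dcube_sub _ xy); rewrite le_max lexx.
by apply/bW/(dcube_sub _ xy); rewrite le_max lexx orbT.
Qed.

Lemma dopen_bigcap (U : nat -> set V) N :
  (forall i, dopen (U i)) -> dopen (\bigcap_(i < N) U i).
Proof.
move=> oU; elim: N => [|N IHN]; first by rewrite bigcap_mkord big_ord0; exact: dopenT.
rewrite (_ : \bigcap_(i < N.+1) _ = (\bigcap_(i < N) U i) `&` U N); last first.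
  by rewrite !bigcap_mkord big_ord_recr.
exact: dopenI.
Qed.

(** There are countably many dyadic cubes, and [U] is the union of those that it contains. *)
Lemma dopen_sigma_algebra (C : set (set V)) U : sigma_algebra setT C ->
  (forall m z, C (dcube m z)) -> dopen U -> C U.
Proof.
move=> [C0 CD CU] Cd oU.
pose F j := if idx_decode (int * idx)%type j is Some (m, z) then
  (if `[< dcube m z `<=` U >] then dcube m z else set0) else set0.
rewrite (_ : U = \bigcup_j F j).
  by apply: CU => j; rewrite /F; case: (idx_decode _ j) => [[m z]|//]; case: ifP.
apply/seteqP; split=> [x Ux|x [j _]].
  have [m mU] := oU _ Ux; exists (idx_code (m, dcell m x)) => //.
  by rewrite /F idx_codeK; case: asboolP.
rewrite /F; case: (idx_decode _ j) => [[m z]|//]; case: asboolP => // zU; exact: zU.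
Qed.

Lemma dopen_ray i (r : R) : dopen [set x : V | x ord0 i < r].
Proof.
move=> x /= xr; have xr' : 0 < r - x ord0 i by rewrite subr_gt0.
have [m [_ mr]] := exprz2_lt xr'.
exists m => y /= xy; have := dcube_dist i xy; rewrite ltr_distl; lra.
Qed.

(** An induction principle for Borel sets. Half-lines generate the Borel sets of the line, and their
    preimages under a coordinate are [dopen] because the cells shrink to points. *)
Lemma dyadic_generation (C : set (set V)) B : sigma_algebra setT C ->
  (forall m z, C (dcube m z)) -> measurable B -> C B.
Proof.
move=> sC Cd; apply: smallest_sub => //.
apply: (big_ind (fun S => S `<=` C)) => //=.
  by move=> A D mA mD E [/mA|/mD].
move=> i _ A [Y mY <-].
suff : <<s @RGenInftyO.G R >> `<=` [set Y | C (setT `&` rVcoord i @^-1` Y)].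
  move=> h; apply: (h Y).
  have mY' : (@RGenInftyO.G R).-sigma.-measurable Y by rewrite -RGenInftyO.measurableE.
  exact: mY'.
have [C0 CD CU] := sC.
apply: smallest_sub; last first.
  move=> _ [r ->] /=; rewrite setTI; apply: dopen_sigma_algebra => //.
  rewrite [X in dopen X](_ : _ = [set x : V | x ord0 i < r]); first exact: dopen_ray.
  by apply/seteqP; split => x /=; rewrite in_itv.
split=> [|Z|F CF] /=; first by rewrite preimage_set0 setI0.
  by rewrite !setTI setTD preimage_setC => CZ; rewrite -setTD; exact: CD.
by rewrite preimage_bigcup setI_bigcupr; exact: CU.
Qed.

Lemma measurable_dopen U : dopen U -> measurable U.
Proof.
apply: dopen_sigma_algebra; last exact: measurable_dcube.
split => [|A mA|F]; [exact: measurable0|rewrite setTD; exact: measurableC|exact: bigcupT_measurable].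
Qed.

Lemma open_dopen (U : set V) : open U -> dopen U.
Proof.
move=> oU x Ux; have /nbhs_ballP[e e0 eU] : nbhs x U by exact: open_nbhs_nbhs.
have [m [_ me]] := exprz2_lt e0; exists m => y xy; apply: eU.
split=> // i j; rewrite ord1 /ball/=; exact: lt_trans (dcube_dist j (esym xy)) me.
Qed.

Lemma continuous_measurable_rV (f : V -> R) : continuous f ->
  measurable_fun setT f.
Proof.
move=> /continuousP cf; apply: (measurability _ (RGenOpens.measurableE R)).
move=> _ [_ [a [b ->] <-]]; rewrite setTI.
have /open_dopen/measurable_dopen : open (f @^-1` `]a, b[).
  by apply: cf; exact: (@interval_open _ (BSide false a) (BSide true b)).
exact.
Qed.

End dyadic_generation.

(** * Outer regularity of the Lebesgue measure by unions of dyadic cubes *)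

Section dyadic_regularity.
Context (R : realType) (n : nat).
Local Notation V := 'rV[R]_n.
Local Notation T := (lebesgue_space R n).
Local Notation mu := (lebesgue R n).
Local Notation idx := {ffun 'I_n -> int}.
Local Notation dcube := (@dcube R n).
Implicit Types (m : int) (z : idx) (x y c : V).

Lemma cvg_ereal_lt (u : (\bar R)^nat) l (a : \bar R) :
  u @ \oo --> l -> (l < a)%E -> exists N, (u N < a)%E.
Proof.
move=> ul la; have [N _ /(_ N (leqnn N)) h] := ul _ (open_ereal_lt' la).
by exists N.
Qed.

Lemma measurable_dopen_space (U : set V) : dopen U -> measurable (U : set T).
Proof. by move=> oU; apply: measurable_lebesgue_space; exact: measurable_dopen. Qed.

Lemma measurable_dcube_space m z : measurable (dcube m z : set T).
Proof. by apply: measurable_lebesgue_space; exact: measurable_dcube. Qed.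

(** Inside one cube, [U] covers [B] and [W] covers its complement, with a small overlap. The
    symmetry of this condition makes closure under complements a mere exchange of [U] and [W]. *)
Let reg m z : set (set V) := [set B | forall e : R, 0 < e ->
  exists U W, [/\ dopen U, dopen W, B `&` dcube m z `<=` U,
    dcube m z `\` B `<=` W & (mu (U `&` W `&` dcube m z) <= e%:E)%E]].

Let reg_bigcup m z (F : nat -> set V) : (forall i, reg m z (F i)) ->
  reg m z (\bigcup_i F i).
Proof.
move=> regF e e0; pose D := dcube m z.
(* One half of [e] is shared among the overlaps of the pairs [U i], [W i]. The other half pays for
   keeping only finitely many [W i], since an infinite intersection need not be [dopen]. *)
have e2 i : 0 < e / 2 / (2 ^ i.+1)%:R.
  by rewrite !divr_gt0// ltr0n expn_gt0.
have UW i := regF i _ (e2 i).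
have /choice[U {}UW] := UW; have /choice[W {}UW] := UW.
pose X N := \bigcup_i U i `&` \bigcap_(i < N) W i `&` D.
have oX N : dopen (X N).
  apply: dopenI; last exact: dopen_dcube.
  apply: dopenI; last by apply: dopen_bigcap => i; have [] := UW i.
  by apply: dopen_bigcup => i _; have [] := UW i.
have mX N := measurable_dopen_space (oX N).
have cX : mu \o X @ \oo --> mu (\bigcap_N X N).
  apply: nonincreasing_cvg_mu => //.
  - apply: (@le_lt_trans _ _ (mu D)); last by rewrite lebesgue_dcube ltry.
    rewrite le_measure ?inE//; first exact: measurable_dcube_space.
    by move=> x [].
  - exact: bigcapT_measurable.
  - move=> N M NM; apply/subsetPset => x [[Ux Wx] Dx]; split => //; split => //.
    by move=> i /= iN; apply: Wx => /=; exact: leq_trans iN NM.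
have Xe : (mu (\bigcap_N X N) <= (e / 2)%:E)%E.
  have mI i : measurable (U i `&` W i `&` D : set T).
    apply: measurable_dopen_space; have [oU oW _ _ _] := UW i.
    by apply: dopenI; [exact: dopenI|exact: dopen_dcube].
  apply: (@le_trans _ _ (\sum_(i <oo) mu (U i `&` W i `&` D))%E).
    apply: measure_sigma_subadditive => //; first exact: bigcapT_measurable.
    move=> x Xx; have [[[i _ Ux] _] Dx] := Xx 0%N I.
    exists i => //; split => //; split => //.
    by have [[_ h] _] := Xx i.+1 I; exact: (h i (ltnSn i)).
  apply: (le_trans _ (epsilon_trick0 xpredT _)); last by rewrite divr_ge0 ?ltW.
  by apply: lee_nneseries => // i _; have [] := UW i.
have [N XN] : exists N, (mu (X N) <= e%:E)%E.
  have : (mu (\bigcap_N X N) < e%:E)%E.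
    by apply: le_lt_trans Xe _; rewrite lte_fin; lra.
  by move=> /(cvg_ereal_lt cX) [N XN]; exists N; exact: ltW.
exists (\bigcup_i U i), (\bigcap_(i < N) W i); split => //.
- by apply: dopen_bigcup => i _; have [] := UW i.
- by apply: dopen_bigcap => i; have [] := UW i.
- by move=> x [[i _ Fx] Dx]; exists i => //; have [_ _ + _ _] := UW i; apply.
- move=> x [Dx Fx] i _; have [_ _ _ + _] := UW i; apply; split => //.
  by move=> Fi; apply: Fx; exists i.
Qed.

Let reg_measurable m z (B : set V) : measurable B -> reg m z B.
Proof.
apply: dyadic_generation; first split.
- move=> e e0; exists set0, setT; split => //.
  + exact: dopenT.
  + by rewrite !set0I measure0 lee_fin ltW.
- move=> B' + e e0 => /(_ e e0) [U [W [oU oW BU BW UWe]]].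
  exists W, U; split=> //.
  + by rewrite setTD => x [nB Dx]; exact: BW.
  + by rewrite setTD => x [Dx /contrapT Bx]; exact: BU.
  + by rewrite (setIC W).
- exact: reg_bigcup.
move=> m' z' e e0; exists (dcube m' z'), (~` dcube m' z'); split.
- exact: dopen_dcube.
- exact: dopen_dcubeC.
- by move=> x [].
- by move=> x [].
- by rewrite setICr set0I measure0 lee_fin ltW.
Qed.

(** The measure of a Lebesgue measurable set is an infimum over countable Borel covers, and the
    choice of a cover spends half of [e]; the regularity of its union, a Borel set, spends the other
    half. *)
Lemma dyadic_outer_regular m z (E : set T) (e : R) :
  measurable E -> E `<=` dcube m z -> 0 < e ->
  exists U : set V, [/\ dopen U, E `<=` U & (mu U <= mu E + e%:E)%E].
Proof.
move=> mE ED e0; have e2 : 0 < e / 2 by rewrite divr_gt0.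
have Efin : mu E \is a fin_num.
  rewrite ge0_fin_numE//; apply: (@le_lt_trans _ _ (mu (dcube m z))).
    by rewrite le_measure ?inE//; exact: measurable_dcube_space.
  by rewrite lebesgue_dcube ltry.
have [_ [A [mA EA] <-] Ae] := lb_ereal_inf_adherent e2 Efin.
have mB : measurable (\bigcup_i A i) by exact: bigcupT_measurable.
have [U [W [oU oW BU BW UWe]]] := reg_measurable m z mB e2.
exists (U `&` dcube m z); split.
- by apply: dopenI => //; exact: dopen_dcube.
- by move=> x Ex; split; [apply: BU; split; [exact: EA|exact: ED]|exact: ED].
have mU : measurable (U `&` dcube m z : set T).
  by apply/measurable_dopen_space/dopenI => //; exact: dopen_dcube.
have mUW : measurable (U `&` W `&` dcube m z : set T).
  by apply/measurable_dopen_space/dopenI; [exact: dopenI|exact: dopen_dcube].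
have mBT : measurable (\bigcup_i A i : set T) by exact: measurable_lebesgue_space.
apply: (@le_trans _ _ (mu (\bigcup_i A i) + mu (U `&` W `&` dcube m z))%E).
  rewrite -[leLHS]/(mu _); apply: (@le_trans _ _ (mu (\bigcup_i A i `|` (U `&` W `&` dcube m z)))).
    rewrite le_measure ?inE//; first exact: measurableU.
    move=> x [Ux Dx]; have [Ax|nAx] := pselect ((\bigcup_i A i) x); [by left|right].
    by split=> //; split=> //; apply: BW.
  exact: measureU2.
rewrite [in leRHS](splitr e) EFinD addeA leeD//.
apply: le_trans (ltW Ae).
apply: (@le_trans _ _ (\sum_(i <oo) mu (A i))%E).
  by apply: measure_sigma_subadditive => // i; exact: measurable_lebesgue_space.
by apply: lee_nneseries => // i _; rewrite lebesgue_borelE.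
Qed.

End dyadic_regularity.

(** * Disjoint families of dyadic cubes and differentiation of averages *)

Section dyadic_families.
Context (R : realType) (n : nat).
Local Notation V := 'rV[R]_n.
Local Notation T := (lebesgue_space R n).
Local Notation mu := (lebesgue R n).
Local Notation idx := {ffun 'I_n -> int}.
Local Notation dcube := (@dcube R n).
Implicit Types (m : int) (z : idx) (x y c : V) (P : int -> idx -> Prop).

Definition dunion P : set V := [set x | exists m, P m (dcell m x)].

(** Two dyadic cubes that share the point [x] coincide as soon as their generations do, so that
    comparing generations suffices. *)
Definition disjoint_family P := forall x m m',
  P m (dcell m x) -> P m' (dcell m' x) -> m = m'.

Definition family_seq P (j : nat) : set V :=
  if idx_decode (int * idx)%type j is Some (m, z) then (if `[< P m z >] then dcube m z else set0)
  else set0.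

Lemma family_seqP P j x : family_seq P j x <-> exists m,
  j = idx_code (m, dcell m x) /\ P m (dcell m x).
Proof.
rewrite /family_seq; split=> [|[m [-> Pm]]]; last by rewrite idx_codeK; case: asboolP.
case E : (idx_decode _ j) => [[m z]|//]; case: asboolP => // Pm xz.
by exists m; rewrite (_ : dcell m x = z)//; split=> //; exact: idx_decodeK E.
Qed.

Lemma dunion_bigcup P : dunion P = \bigcup_j family_seq P j.
Proof.
apply/seteqP; split=> [x [m Pm]|x [j _ /family_seqP[m [_ Pm]]]]; last by exists m.
exists (idx_code (m, dcell m x)); first exact: I.
by apply/family_seqP; exists m.
Qed.

Lemma measurable_family_seq P j : measurable (family_seq P j : set T).
Proof.
rewrite /family_seq; case: (idx_decode _ j) => [[m z]|]; last exact: measurable0.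
by case: ifP => _; [exact: measurable_dcube_space|exact: measurable0].
Qed.

Lemma measurable_dunion P : measurable (dunion P : set T).
Proof. by rewrite dunion_bigcup; apply: bigcupT_measurable; exact: measurable_family_seq. Qed.

Lemma trivIset_family_seq P : disjoint_family P -> trivIset setT (family_seq P).
Proof.
move=> dP i j _ _ [x [/family_seqP[m [-> Pm]] /family_seqP[m' [-> Pm']]]].
by rewrite (dP _ _ _ Pm Pm').
Qed.

Lemma le_integral_dunion P (f g : T -> \bar R) : disjoint_family P ->
  measurable_fun setT f -> measurable_fun setT g ->
  (forall x, 0 <= f x)%E -> (forall x, 0 <= g x)%E ->
  (forall m z, P m z ->
    \int[mu]_(x in dcube m z) f x <= \int[mu]_(x in dcube m z) g x)%E ->
  (\int[mu]_(x in dunion P) f x <= \int[mu]_(x in dunion P) g x)%E.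
Proof.
move=> dP mf mg f0 g0 fg; rewrite dunion_bigcup.
rewrite !ge0_integral_bigcup//; try exact: trivIset_family_seq;
  try exact: measurable_funTS; try exact: measurable_family_seq.
apply: lee_nneseries => [j _ _|j _]; first by apply: integral_ge0.
rewrite /family_seq; case: (idx_decode _ j) => [[m z]|]; last by rewrite !integral_set0.
by case: asboolP => [/fg//|_]; rewrite !integral_set0.
Qed.

Lemma integral_dunion_eq0 P (f : T -> \bar R) : disjoint_family P ->
  mu.-integrable (dunion P) f ->
  (forall m z, P m z -> \int[mu]_(x in dcube m z) f x = 0)%E ->
  (\int[mu]_(x in dunion P) f x = 0)%E.
Proof.
move=> dP; rewrite dunion_bigcup => fi f0.
rewrite integral_bigcup//; [|exact: trivIset_family_seq|exact: measurable_family_seq].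
apply: eseries0 => j _ _.
rewrite /family_seq; case: (idx_decode _ j) => [[m z]|]; last by rewrite integral_set0.
by case: asboolP => [/f0//|_]; rewrite integral_set0.
Qed.

(* The part of Lebesgue's differentiation theorem that is needed here. If the set E of
   points where [F] exceeds [t + 1/(k+1)] had positive measure, the cubes meeting E in a
   dyadic open set barely larger than E would still have averages at most [t]. *)
Lemma ae_le_of_dyadic_averages (F : T -> R) (t : R) : 0 < t ->
  measurable_fun setT F -> (forall x, 0 <= F x) ->
  mu [set x | t < F x /\ forall m,
    (\int[mu]_(y in dcube m (dcell m x)) (F y)%:E <=
      t%:E * mu (dcube m (dcell m x)))%E] = 0%E.
Proof.
move=> t0 mF F0.
pose good m z := (\int[mu]_(y in dcube m z) (F y)%:E <= t%:E * mu (dcube m z))%E.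
have mEF : measurable_fun setT (EFin \o F : T -> \bar R).
  by apply/measurable_EFinP.
have mG : measurable ([set x | forall m, good m (dcell m x)] : set T).
  rewrite [X in measurable X](_ : _ = ~` dunion (fun m z => ~ good m z)).
    by apply: measurableC; exact: measurable_dunion.
  apply/seteqP; split=> [x gx [m]|x ngx m]; first exact.
  by apply: contrapT => ng; apply: ngx; exists m.
have mlt (a : R) : measurable [set x : T | a < F x].
  rewrite -[X in measurable X]setTI.
  rewrite (_ : [set x : T | a < F x] = F @^-1` `]a, +oo[); first exact: mF.
  by apply/seteqP; split => x /=; rewrite in_itv/= andbT.
(* Cutting to a unit cube makes the measure finite, as outer regularity requires. *)
pose E z0 (k : nat) : set T := [set x | t + k.+1%:R^-1 < F x] `&`
  [set x | forall m, good m (dcell m x)] `&` dcube 0 z0.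
have mE z k : measurable (E z k).
  apply: measurableI; last exact: measurable_dcube_space.
  exact: measurableI.
suff E0 z k : mu (E z k) = 0%E.
  apply: measure_negligible.
    rewrite [X in measurable X](_ : _ = [set x : T | t < F x] `&`
       [set x | forall m, good m (dcell m x)]); first exact: measurableI.
    by apply/seteqP; split.
  pose N j := if idx_decode (idx * nat)%type j is Some (z, k) then E z k else set0.
  apply: (@negligibleS _ _ _ _ (\bigcup_j N j)); last first.
    apply: negligible_bigcup => j; rewrite /N; case: (idx_decode _ j) => [[z k]|].
      by apply/negligibleP; [exact: mE|exact: E0].
    exact: negligible_set0.
  move=> x [tF gx].
  have tF' : 0 < F x - t by rewrite subr_gt0.
  exists (idx_code (dcell 0 x, Num.trunc ((F x - t)^-1))) => //.
  rewrite /N idx_codeK; split => //; split => //=.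
  rewrite -ltrBrDl -[ltRHS]invrK ltf_pV2 ?posrE ?invr_gt0//.
  exact: truncnS_gt.
set d : R := k.+1%:R^-1; have d0 : 0 < d by rewrite invr_gt0.
have Efin : mu (E z k) \is a fin_num.
  rewrite ge0_fin_numE//; apply: (@le_lt_trans _ _ (mu (dcube 0 z))).
    by rewrite le_measure ?inE//; [exact: measurable_dcube_space|move=> x []].
  by rewrite lebesgue_dcube ltry.
suff h (e : R) : 0 < e -> ((t + d)%:E * mu (E z k) <= t%:E * (mu (E z k) + e%:E))%E.
  have : (d%:E * mu (E z k) <= 0)%E.
    apply/lee_addgt0Pr => e e0; rewrite add0e.
    have := h (e / t) (divr_gt0 e0 t0); move: Efin.
    case: (mu _) => // r _; rewrite -EFinD -!EFinM !lee_fin.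
    by rewrite mulrDr mulrCA divff ?gt_eqF// mulr1 mulrDl lerD2l.
  rewrite pmule_rle0 ?lte_fin// => h0.
  by apply/eqP; rewrite eq_le h0/=.
move=> e0; have [||U [oU EU Ue]] := @dyadic_outer_regular R n 0 z (E z k) e _ _ e0 => //.
  by move=> x [].
(* Fixing the generation makes the cubes used below disjoint; nothing is lost in the limit, as [W m]
   increases to [E z k] because [U] is [dopen]. *)
pose W (m : nat) : set T := E z k `&` [set x | dcube m (dcell m x) `<=` U].
have mW (m : nat) : measurable (W m).
  apply: measurableI => //.
  rewrite [X in measurable X](_ : _ =
    dunion (fun m' z => m' = m /\ dcube m' z `<=` U)); first exact: measurable_dunion.
  by apply/seteqP; split=> [x Ux|x [_ [->]]//]; exists m.
have WE : \bigcup_m W m = E z k.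
  apply/seteqP; split=> [x [m _ []]//|x Ex].
  have [m mU] := oU _ (EU _ Ex); exists `|m|%N => //; split => //= y xy; apply: mU.
  by apply: dcell_nest xy; lia.
have cW : mu \o W @ \oo --> mu (E z k).
  rewrite -WE; apply: nondecreasing_cvg_mu => //; first by rewrite WE.
  move=> a b ab; apply/subsetPset => x [Ex xU]; split => //= y xy; apply: xU.
  by apply: dcell_nest xy; lia.
have mU := measurable_dopen_space oU.
suff h (m : nat) : ((t + d)%:E * mu (W m) <= t%:E * mu U)%E.
  apply: (@le_trans _ _ (t%:E * mu U)%E); last by rewrite lee_pmul2l// lte_fin.
  have c : ((t + d)%:E * mu (W m))%E @[m --> \oo] --> ((t + d)%:E * mu (E z k))%E.
    by apply: cvgeZl.
  rewrite -(cvg_lim _ c)//; apply: lime_le; first by apply/cvg_ex; eexists; exact: c.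
  exact: nearW.
pose P m' z' := [/\ m' = m%:Z, dcube m' z' `<=` U & dcube m' z' `&` E z k !=set0].
have dP : disjoint_family P by move=> x a b [-> _ _] [-> _ _].
have WP : W m `<=` dunion P.
  by move=> x [Ex xU]; exists m; split=> //; exists x; split.
have mP := measurable_dunion P.
apply: (@le_trans _ _ (\int[mu]_(x in W m) (F x)%:E)%E).
  rewrite -(integral_cst mu (mW m)); apply: (ge0_le_integral mu (mW m)).
  - by move=> x _ /=; rewrite lee_fin addr_ge0 ?ltW.
  - exact: measurable_cst.
  - exact: measurable_funTS.
  - by move=> x [[[/ltW +] _] _] _; rewrite lee_fin.
apply: (@le_trans _ _ (\int[mu]_(x in dunion P) (F x)%:E)%E).
  apply: (ge0_subset_integral mu (mW m) mP _ _ WP); first exact: measurable_funTS.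
  by move=> x _; rewrite lee_fin.
apply: (@le_trans _ _ (\int[mu]_(x in dunion P) (cst t%:E) x)%E).
  apply: le_integral_dunion => //=; try by move=> x; rewrite lee_fin// ltW.
  move=> m' z' [_ _ [y [<- [[_ gy] _]]]]; rewrite integral_cst//; first exact: gy.
  exact: measurable_dcube_space.
rewrite integral_cst// lee_pmul2l ?lte_fin// le_measure ?inE//.
by move=> x [m' [_ + _]]; apply.
Qed.

Lemma negligible_dyadic_grid : mu.-negligible (@dyadic_grid R n : set T).
Proof.
rewrite /dyadic_grid.
pose N (j : nat) : set T := if idx_decode (int * int * 'I_n)%type j is Some j then
  [set x | x ord0 j.2 = 2 ^ (- j.1.1) * (j.1.2)%:~R] else set0.
apply: (@negligibleS _ _ _ _ (\bigcup_j N j)).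
  by move=> x [j _ /= xj]; exists (idx_code j) => //; rewrite /N idx_codeK.
apply: negligible_bigcup => j; rewrite /N; case: (idx_decode _ j) => [[a i]|]; last exact: negligible_set0.
apply/negligibleP; last exact: lebesgue_hyperplane.
apply: measurable_lebesgue_space; rewrite -[X in measurable X]setTI.
exact: (@measurable_rVcoord R n i measurableT [set _] (measurable_set1 _)).
Qed.

End dyadic_families.

(** * Weak Morrey bounds *)

Section weak_integral.
Context (R : realType).
Local Open Scope ereal_scope.

Lemma lee_real_approx (a b : \bar R) : 0 <= a ->
  (forall y : R, y%:E <= a -> y%:E <= b) -> a <= b.
Proof.
case: a => [r _ h|_ h|//]; first exact: h.
by rewrite leye_eq; apply/eqP/eqyP => y _; apply: h; rewrite leey.
Qed.

Lemma geometric_nneseries_le (a r : R) : (0 <= a)%R -> (0 <= r < 1)%R ->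
  \sum_(k <oo) (a * r ^+ k)%:E <= (a / (1 - r))%:E.
Proof.
move=> a0 /andP[r0 r1]; apply: lime_le.
  by apply: is_cvg_nneseries => k _ _; rewrite lee_fin mulr_ge0// exprn_ge0.
apply: nearW => N; rewrite sumEFin lee_fin -mulr_sumr.
apply: ler_wpM2l => //.
have r1' : (0 < 1 - r)%R by rewrite subr_gt0.
rewrite -div1r ler_pdivlMr// mulrC.
have -> : ((1 - r) * \sum_(0 <= i < N) r ^+ i = 1 - r ^+ N)%R.
  rewrite big_mkord; elim: N => [|N IHN]; first by rewrite big_ord0 mulr0 expr0 subrr.
  by rewrite big_ord_recr/= mulrDr IHN exprS; ring.
by rewrite gerBl exprn_ge0.
Qed.

Context d (T : measurableType d) (mu : {measure set T -> \bar R}).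

(** For a real [y <= a] above [t], the term with [2 ^ k * t < y <= 2 ^ (k + 1) * t] is by itself at
    least [y]. Working with such [y] includes the case [a = +oo]. *)
Lemma dyadic_layers (t : R) (a : \bar R) : (0 < t)%R -> 0 <= a ->
  a <= t%:E + \sum_(k <oo) (2 ^+ k.+1 * t * ((2 ^+ k * t)%:E < a)%E%:R)%:E.
Proof.
move=> t0 a0; apply: lee_real_approx => // y ya.
have term0 k : 0 <= (2 ^+ k.+1 * t * ((2 ^+ k * t)%:E < a)%E%:R)%:E.
  by rewrite lee_fin !mulr_ge0// ?exprn_ge0// ltW.
have [yt|ty] := lerP y t.
  apply: (@le_trans _ _ (t%:E + 0)); first by rewrite adde0 lee_fin.
  by rewrite leeD2l// nneseries_ge0.
have ex : exists k, (y <= 2 ^+ k.+1 * t)%R.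
  exists (Num.trunc (y / t)).+1; rewrite -ler_pdivrMr//.
  apply: (le_trans (ltW (truncnS_gt _))); rewrite -natrX ler_nat.
  by apply: (leq_trans (ltnW (ltn_expl _ (ltnSn 1)))); rewrite leq_exp2l.
case: (ex_minnP ex) => k yk kmin.
have ky : (2 ^+ k * t < y)%R.
  case: k yk kmin => [|k] yk kmin; first by rewrite expr0 mul1r.
  by rewrite ltNge; apply/negP => /kmin; rewrite ltnn.
apply: (@le_trans _ _ (2 ^+ k.+1 * t * ((2 ^+ k * t)%:E < a)%E%:R)%:E).
  rewrite (_ : (_ < a) = true) ?mulr1 ?lee_fin//.
  by apply: lt_le_trans ya; rewrite lte_fin.
apply: (@le_trans _ _ (\sum_(k <oo) (2 ^+ k.+1 * t * ((2 ^+ k * t)%:E < a)%E%:R)%:E)).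
  apply: (le_trans _ (nneseries_lim_ge k.+1 _)) => //.
  by rewrite big_mkord big_ord_recr/= leeDr// sume_ge0.
by rewrite leeDr// lee_fin ltW.
Qed.

(* On [E], [g <= t + \sum_k 2^(k+1) t 1_(g > 2^k t)]. *)
Lemma weak_integral_le (g : T -> \bar R) (E : set T) (q B : R) :
  (1 < q)%R -> (0 <= B)%R -> measurable E -> measurable_fun setT g ->
  (forall x, 0 <= g x) ->
  (forall l : R, (0 < l)%R -> mu (E `&` [set x | l%:E < g x]) <= (B * l `^ (- q))%:E) ->
  forall t : R, (0 < t)%R -> \int[mu]_(x in E) g x <=
    t%:E * mu E + (2 / (1 - 2 `^ (1 - q)) * (B * t `^ (1 - q)))%:E.
Proof.
move=> q1 B0 mE mg g0 gB t t0.
pose G k := [set x | (2 ^+ k * t)%:E < g x].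
have mG k : measurable (G k).
  by rewrite -[G k]setTI; exact: emeasurable_fun_o_infty.
pose h k x : \bar R := (2 ^+ k.+1 * t)%:E * (\1_(G k) x)%:E.
have hE k x : h k x = (2 ^+ k.+1 * t * ((2 ^+ k * t)%:E < g x)%E%:R)%:E.
  by rewrite /h indicE -EFinM; congr (_ * (nat_of_bool _)%:R)%:E; apply/idP/idP; rewrite inE.
have tk k : (0 < 2 ^+ k * t)%R by rewrite mulr_gt0// exprn_gt0.
have h0 k x : 0 <= h k x by rewrite /h mule_ge0// lee_fin ?ltW//.
have mh k : measurable_fun setT (h k).
  apply: emeasurable_funM => //; apply/measurable_EFinP; exact: measurable_indic.
apply: (@le_trans _ _ (\int[mu]_(x in E) (t%:E + \sum_(k <oo) h k x))).
  apply: ge0_le_integral => //; [exact: measurable_funTS| |].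
    apply: emeasurable_funD => //; apply: ge0_emeasurable_sum => // k _.
    exact: measurable_funTS.
  move=> x _; apply: (le_trans (dyadic_layers t0 (g0 x))).
  by rewrite leeD2l//; under eq_eseriesr do rewrite -hE.
rewrite ge0_integralD//; last 3 first.
- by move=> x _; rewrite lee_fin ltW.
- by move=> x _; apply: nneseries_ge0.
- by apply: ge0_emeasurable_sum => // k _; exact: measurable_funTS.
rewrite integral_cst// leeD2l// integral_nneseries//; last first.
  by move=> k; exact: measurable_funTS.
(* This is where [1 < q] enters: passing from one layer to the next multiplies the bound by 2 to the
   power [1 - q], and the layers must be summable. *)
have q10 : (0 <= (2 : R) `^ (1 - q) < 1)%R.
  rewrite powR_ge0/= -[ltRHS](powRr0 (2 : R)) /powR pnatr_eq0/= ltr_expR.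
  by rewrite ltr_pM2r ?ln_gt0// ?ltr1n// subr_lt0.
apply: le_trans (_ : _ <= \sum_(k <oo) (2 * (B * t `^ (1 - q)) * (2 `^ (1 - q)) ^+ k)%:E) _.
  apply: lee_nneseries => [k _ _|k _]; first by apply: integral_ge0.
  rewrite ge0_integralZl//; last 2 first.
    - by apply/measurable_funTS/measurable_EFinP; exact: measurable_indic.
    - by rewrite lee_fin ltW.
  rewrite integral_indic// setIC.
  apply: le_trans (_ : _ <= (2 ^+ k.+1 * t)%:E * (B * (2 ^+ k * t) `^ (- q))%:E) _.
    by rewrite lee_wpmul2l ?gB// lee_fin ltW.
  rewrite -EFinM lee_fin exprS.
  have -> : (2 * (B * t `^ (1 - q)) * 2 `^ (1 - q) ^+ k = 2 * B * (2 ^+ k * t) `^ (1 - q))%R.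
    rewrite powRM ?exprn_ge0 ?(ltW t0)//.
    rewrite -(powR_mulrn k (powR_ge0 _ _)) -powRrM mulrC (mulrC (1 - q)%R) powRrM powR_mulrn//.
    by ring.
  have y0 : (2 ^+ k * t != 0)%R by rewrite gt_eqF.
  rewrite [((2 ^+ k * t) `^ (1 - q))%R]powRD ?y0 ?implybT// powRr1 ?(ltW (tk k))//.
  by rewrite le_eqVlt; apply/orP; left; apply/eqP; ring.
apply: le_trans (geometric_nneseries_le _ q10) _.
  by rewrite !mulr_ge0// powR_ge0.
rewrite lee_fin le_eqVlt; apply/orP; left; apply/eqP; ring.
Qed.
End weak_integral.

Section weak_morrey_bound.
Context (R : realType) (n : nat).
Local Notation V := 'rV[R]_n.
Local Notation T := (lebesgue_space R n).
Local Notation mu := (lebesgue R n).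
Local Notation ccube := (@ccube R n).

(* [l * |Q| `^ (1/p - 1/q) * |Q `&` [g > l]| `^ (1/q) <= A], solved for the measure of
   the superlevel set. *)
Definition weak_bound (p q A : R) (g : V -> \bar R) : Prop :=
  forall c (r l : R), 0 < r -> 0 < l ->
    (mu (ccube c r `&` [set x | l%:E < g x]) <=
      ((A / l) `^ q * ((2 * r) ^+ n) `^ (1 - q / p))%:E)%E.

Lemma measurable_ccube_space c r : measurable (ccube c r : set T).
Proof. by apply: measurable_lebesgue_space; exact: measurable_ccube. Qed.

(** Solve for [m] and take [q]-th powers. Here [s] stands for [p^-1], [v] for the volume of a cube
    and [m] for the measure of the superlevel set in it. *)
Lemma weak_term_le (q s v l m A : R) : 1 < q -> 0 < v -> 0 < l -> 0 <= m -> 0 <= A ->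
  (l * (v `^ (s - q^-1) * m `^ q^-1) <= A) = (m <= (A / l) `^ q * v `^ (1 - q * s)).
Proof.
move=> q1 v0 l0 m0 A0; have q0 : 0 < q by rewrite (lt_trans _ q1).
have qq : q^-1 * q = 1 by rewrite mulVf// gt_eqF.
have -> : (l * (v `^ (s - q^-1) * m `^ q^-1) <= A) =
   (m `^ q^-1 <= A / l * v `^ (q^-1 - s)).
  rewrite -(opprB s) powRN ler_pdivlMr ?powR_gt0// ler_pdivlMr//.
  by rewrite mulrC (mulrC (m `^ _)).
have rhs0 : 0 <= A / l * v `^ (q^-1 - s) by rewrite mulr_ge0 ?powR_ge0// divr_ge0// ltW.
have -> : (A / l) `^ q * v `^ (1 - q * s) = (A / l * v `^ (q^-1 - s)) `^ q.
  rewrite [RHS]powRM ?powR_ge0 ?divr_ge0 ?(ltW l0)// -powRrM; congr (_ * _ `^ _).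
  by rewrite mulrBl qq mulrC.
apply/idP/idP => h.
  rewrite -[leLHS]powRr1// -qq powRrM.
  by rewrite ge0_ler_powR ?nnegrE ?powR_ge0// ltW.
have qq' : q * q^-1 = 1 by rewrite mulrC.
rewrite -[leRHS]powRr1// -qq' powRrM.
by rewrite ge0_ler_powR ?nnegrE ?powR_ge0// invr_ge0 ltW.
Qed.

Lemma morrey_termE (q s : R) (l : R) (G : set T) c r : 1 < q -> 0 < r -> measurable G ->
  (l%:E * (lebesgue R n (ccube c r) `^ s *
    Lnorm mu q%:E (fun x => (\1_G x)%:E * (\1_(ccube c r) x)%:E)) =
  (l * (((2 * r) ^+ n) `^ s * (fine (mu (ccube c r `&` G))) `^ q^-1))%:E)%E.
Proof.
move=> q1 r0 mG; have q0 : q != 0 by rewrite gt_eqF// (lt_trans _ q1).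
have mQ := measurable_ccube_space c r.
rewrite lebesgue_ccube// poweR_EFin unlock.
have -> : (\int[mu]_x (`|(\1_G x)%:E * (\1_(ccube c r) x)%:E| `^ q) = mu (ccube c r `&` G))%E.
  rewrite -[in RHS](setIT (_ `&` _)) -integral_indic//; last exact: measurableI.
  apply: eq_integral => x _; rewrite -EFinM abse_EFin poweR_EFin indicI/= mulrC.
  rewrite !indicE; case: (_ \in _); case: (_ \in _);
    by rewrite ?(mul0r, mul1r, mulr0, normr0, normr1, powR1, powR0).
have mfin : mu (ccube c r `&` G) \is a fin_num.
  rewrite ge0_fin_numE//; apply: (@le_lt_trans _ _ (mu (ccube c r))).
    by rewrite le_measure ?inE//; exact: measurableI.
  by rewrite lebesgue_ccube// ltry.
by rewrite -[X in (X `^ _)%E](fineK mfin) poweR_EFin -!EFinM.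
Qed.

Variables (p q : R) (q1 : 1 < q).

Lemma measurable_superlevel (g : T -> \bar R) (l : R) : measurable_fun setT g ->
  measurable ([set x | l%:E < g x]%E : set T).
Proof. by move=> mg; rewrite -[X in measurable X]setTI; exact: emeasurable_fun_o_infty. Qed.

Lemma weak_term_leE (g : T -> \bar R) c r (l A : R) : 0 < r -> 0 < l -> 0 <= A ->
  measurable_fun setT g ->
  let G := [set x | l%:E < `|g x|]%E in
  (l%:E * (mu (ccube c r) `^ (p^-1 - q^-1) *
    Lnorm mu q%:E (fun x => (\1_G x)%:E * (\1_(ccube c r) x)%:E)) <= A%:E)%E =
  (mu (ccube c r `&` G) <= ((A / l) `^ q * ((2 * r) ^+ n) `^ (1 - q / p))%:E)%E.
Proof.
move=> r0 l0 A0 mg G.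
have mG : measurable (G : set T).
  by apply: measurable_superlevel; exact: measurableT_comp.
have mfin : mu (ccube c r `&` G) \is a fin_num.
  rewrite ge0_fin_numE//; apply: (@le_lt_trans _ _ (mu (ccube c r))).
    have mQ := measurable_ccube_space c r.
    by rewrite le_measure ?inE//; exact: measurableI.
  by rewrite lebesgue_ccube// ltry.
rewrite (morrey_termE _ _ _ q1 r0 mG) lee_fin weak_term_le//.
- by rewrite -[in RHS](fineK mfin) lee_fin.
- by rewrite exprn_gt0// mulr_gt0.
Qed.

Lemma weak_bound_of_norm (g : T -> \bar R) (A : R) : 0 <= A ->
  measurable_fun setT g -> (weak_morrey_norm p q g <= A%:E)%E ->
  weak_bound p q A (fun x => `|g x|%E).
Proof.
move=> A0 mg gA c r l r0 l0; rewrite -weak_term_leE//; apply: le_trans gA.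
apply: le_trans (ereal_sup_ubound _); last by exists l.
rewrite lee_pmul2l ?lte_fin// ereal_sup_ubound//.
by exists (ccube c r) => //; exists c, r.
Qed.

Lemma norm_of_weak_bound (g : T -> \bar R) (A : R) : 0 <= A ->
  measurable_fun setT g -> weak_bound p q A (fun x => `|g x|%E) ->
  (weak_morrey_norm p q g <= A%:E)%E.
Proof.
move=> A0 mg gA; apply: ge_ereal_sup => _ [l l0 <-].
rewrite -lee_pdivlMl//; apply: ge_ereal_sup => _ [Q [c [r r0 ->]] <-].
by rewrite lee_pdivlMl// [leLHS](_ : _ = (l%:E * (mu (ccube c r) `^ (p^-1 - q^-1) *
  Lnorm mu q%:E (fun x => (\1_([set x | l%:E < `|g x|]%E) x)%:E * (\1_(ccube c r) x)%:E)))%E)// weak_term_leE// gA.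
Qed.

End weak_morrey_bound.

Lemma dyadic_bracket (R : realType) (y : R) : 0 < y ->
  exists m : int, 2 ^ m <= y < 2 ^ (m + 1).
Proof.
move=> y0; have [N [_ Ny]] := exprz2_lt y0.
have ex : exists k : nat, y < 2 ^ (- N + k%:Z + 1).
  exists (Num.trunc (y * 2 ^ N)); rewrite addrAC -addrA expfzDr// -invr_expz ltr_pdivlMl ?exprz2_gt0//.
  rewrite mulrC; apply: (lt_le_trans (truncnS_gt _)).
  rewrite -intS/= -exprnP -natrX ler_nat; exact/ltnW/ltn_expl.
case: (ex_minnP ex) => k yk kmin; exists (- N + k%:Z); rewrite yk andbT.
case: k yk kmin => [|k] yk kmin; first by rewrite addr0 ltW.
rewrite leNgt; apply/negP => ky.
have /kmin : y < 2 ^ (- N + k%:Z + 1).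
  by rewrite (_ : - N + k%:Z + 1 = - N + k.+1%:Z)//; lia.
by rewrite ltnn.
Qed.

Section stopping.
Context (R : realType) (n : nat).
Local Notation V := 'rV[R]_n.
Local Notation T := (lebesgue_space R n).
Local Notation mu := (lebesgue R n).
Local Notation idx := {ffun 'I_n -> int}.
Local Notation dcube := (@dcube R n).
Local Notation ccube := (@ccube R n).
Variables (p q : R) (q1 : 1 < q) (qp : q <= p).
Implicit Types (m : int) (z : idx) (x y c : V).

Definition cell_volume m : R := (2 ^ (- m)) ^+ n.

Lemma cell_volume_gt0 m : 0 < cell_volume m. Proof. by rewrite exprn_gt0// exprz2_gt0. Qed.

Lemma le_cell_volume m m' : m' <= m -> cell_volume m <= cell_volume m'.
Proof.
move=> mm; rewrite lerXn2r ?nnegrE ?(ltW (exprz2_gt0 _ _))//.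
by rewrite ler_eXz2l ?ltr1n// lerN2.
Qed.

(** The factor in front of the layers in [weak_integral_le]. The 1 in [avg_const] accounts for the
    remaining term there, the height times the volume. *)
Definition weak_const : R := 2 / (1 - 2 `^ (1 - q)).
Definition avg_const : R := 1 + weak_const.

Lemma weak_const_gt0 : 0 < weak_const.
Proof.
rewrite divr_gt0// subr_gt0 -[ltRHS](powRr0 (2 : R)) /powR pnatr_eq0/= ltr_expR.
by rewrite ltr_pM2r ?ln_gt0// ?ltr1n// subr_lt0.
Qed.

Lemma avg_const_gt0 : 0 < avg_const.
Proof. by rewrite addr_gt0// weak_const_gt0. Qed.


Lemma weak_average_ccube (A : R) (g : T -> \bar R) c r : 0 < A -> 0 < r ->
  measurable_fun setT g -> (forall x, 0 <= g x)%E -> weak_bound p q A g ->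
  (\int[mu]_(x in ccube c r) g x <=
    (avg_const * A * ((2 * r) ^+ n) `^ (1 - p^-1))%:E)%E.
Proof.
move=> A0 r0 mg g0 gA; set v := (2 * r) ^+ n.
have v0 : 0 < v by rewrite exprn_gt0// mulr_gt0.
pose B := A `^ q * v `^ (1 - q / p).
have B0 : 0 <= B by rewrite mulr_ge0// powR_ge0.
have mQ := measurable_ccube_space c r.
have gB l : 0 < l -> (mu (ccube c r `&` [set x | l%:E < g x]) <= (B * l `^ (- q))%:E)%E.
  move=> l0; apply: le_trans (gA _ _ _ r0 l0) _; rewrite lee_fin.
  rewrite powRM ?invr_ge0 ?(ltW A0) ?(ltW l0)// -[l^-1]powR_inv1 ?(ltW l0)// -powRrM mulN1r.
  by rewrite le_eqVlt; apply/orP; left; apply/eqP; rewrite /B -/v; ring.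
(* At this height both terms of [weak_integral_le] are multiples of the same quantity, [A] times [v]
   to the power [1 - p^-1]. *)
have t0 : 0 < A * v `^ (- p^-1) by rewrite mulr_gt0// powR_gt0.
apply: (le_trans (weak_integral_le q1 B0 mQ mg g0 gB t0)).
rewrite lebesgue_ccube// -/v -EFinM -EFinD lee_fin.
rewrite le_eqVlt; apply/orP; left; apply/eqP.
have vD a b : v `^ (a + b) = v `^ a * v `^ b by rewrite powRD// (gt_eqF v0) implybT.
have AD a b : A `^ (a + b) = A `^ a * A `^ b by rewrite powRD// (gt_eqF A0) implybT.
rewrite -/weak_const [(A * _) `^ _]powRM ?powR_ge0 ?(ltW A0)// -powRrM.
have E1 : A * v `^ (- p^-1) * v = A * v `^ (1 - p^-1).
  by rewrite vD powRr1 ?(ltW v0)//; ring.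
have E2 : B * (A `^ (1 - q) * v `^ (- p^-1 * (1 - q))) = A * v `^ (1 - p^-1).
  have -> : 1 - p^-1 = 1 - q / p + - p^-1 * (1 - q) by ring.
  have A1 : A `^ q * A `^ (1 - q) = A by rewrite -AD addrC subrK powRr1// ltW.
  by rewrite vD -[in RHS]A1 /B; ring.
by rewrite E1 E2 /avg_const; ring.
Qed.

Lemma weak_average_dcube (A : R) (g : T -> \bar R) m z : 0 < A ->
  measurable_fun setT g -> (forall x, 0 <= g x)%E -> weak_bound p q A g ->
  (\int[mu]_(x in dcube m z) g x <= (avg_const * A * cell_volume m `^ (1 - p^-1))%:E)%E.
Proof.
move=> A0 mg g0 gA; have r0 : 0 < 2 ^ (- m) / 2 :> R by rewrite divr_gt0// exprz2_gt0.
have := weak_average_ccube (dcenter R m z) A0 r0 mg g0 gA.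
have -> : 2 * (2 ^ (- m) / 2) = 2 ^ (- m) :> R by field.
apply: le_trans.
apply: (ge0_subset_integral mu (measurable_dcube_space m z) (measurable_ccube_space _ _)) => //.
- exact: measurable_funTS.
- exact: dcube_sub_ccube.
Qed.

End stopping.

(** * Stopping cubes *)

Section stopping_cubes.
Context (R : realType) (n : nat) (n0 : (0 < n)%N).
Local Notation V := 'rV[R]_n.
Local Notation T := (lebesgue_space R n).
Local Notation mu := (lebesgue R n).
Local Notation idx := {ffun 'I_n -> int}.
Local Notation dcube := (@dcube R n).
Local Notation dcorner := (@dcorner R n).
Local Notation dvol := (@cell_volume R n).
Variables (p q : R) (q1 : 1 < q) (qp : q <= p).
Variables (F : V -> R).
Hypotheses (mF : measurable_fun [set: T] F) (F0 : forall x, 0 <= F x).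
Implicit Types (m : int) (z : idx) (x y c : V).

Definition hot (lam : R) m z : bool :=
  (lam%:E * mu (dcube m z) < \int[mu]_(x in dcube m z) (F x)%:E)%E.

Definition hot_set (lam : R) : set V := [set x | exists m, hot lam m (dcell m x)].

(** Maximality among hot cubes: by nesting, the larger dyadic cubes that contain [dcube m z] are,
    one in each generation, those that contain its corner. *)
Definition selected (lam : R) m z : Prop :=
  hot lam m z /\ forall m', m' < m -> ~~ hot lam m' (dcell m' (dcorner m z)).

Lemma selected_cell lam m x : selected lam m (dcell m x) <->
  hot lam m (dcell m x) /\ forall m', m' < m -> ~~ hot lam m' (dcell m' x).
Proof.
have E m' : m' < m -> dcell m' (dcorner m (dcell m x)) = dcell m' x.
  by move=> /ltW mm; apply: (dcell_nest mm); rewrite dcell_corner.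
by split=> -[hx hm]; split=> // m' mm; have := hm m' mm; rewrite E.
Qed.

Lemma disjoint_selected lam : disjoint_family R (selected lam).
Proof.
move=> x m m' /selected_cell[hm nm] /selected_cell[hm' nm'].
by have [/nm'|/nm|//] := ltgtP m m'; rewrite ?hm ?hm'.
Qed.

Variables (A : R) (A0 : 0 < A) (FA : weak_bound p q A (EFin \o F)).

Let p0 : 0 < p. Proof. by rewrite (lt_le_trans _ qp)// (lt_trans _ q1). Qed.
Let q0 : 0 < q. Proof. by rewrite (lt_trans _ q1). Qed.
Let mEF : measurable_fun [set: T] (EFin \o F). Proof. exact/measurable_EFinP. Qed.
Let EF0 x : (0 <= (EFin \o F) x)%E. Proof. by rewrite lee_fin. Qed.
Local Notation CA := (avg_const q * A).

(** The average over a cube is at most [CA] times its volume to the power [- p^-1], so that only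
    small cubes can be hot. *)
Lemma hot_small lam m z : 0 < lam -> hot lam m z -> dvol m `^ p^-1 < CA / lam.
Proof.
move=> lam0 /lt_le_trans/(_ (weak_average_dcube q1 m z A0 mEF EF0 FA)).
have v0 := cell_volume_gt0 R n m.
rewrite lebesgue_dcube -/(cell_volume R n m) -EFinM lte_fin powRD ?(gt_eqF v0) ?implybT//.
rewrite powRr1 ?(ltW v0)// powRN.
have w0 : 0 < dvol m `^ p^-1 by rewrite powR_gt0.
rewrite mulrA ltr_pdivlMr// mulrAC ltr_pM2r// => h.
by rewrite ltr_pdivlMr// mulrC.
Qed.

Lemma hot_level_bounded lam : 0 < lam -> exists m0 : int, forall m z, hot lam m z -> m0 <= m.
Proof.
move=> lam0; set K := (CA / lam) `^ p.
have K0 : 0 <= K by rewrite powR_ge0.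
have K1 : 0 < (K + 1)^-1 by rewrite invr_gt0 ltr_wpDl.
have [N [N0 NK]] := exprz2_lt K1.
exists (- N) => m z hm; rewrite leNgt; apply/negP => mN.
have := hot_small lam0 hm; apply/negP; rewrite -leNgt.
have v0 := cell_volume_gt0 R n m.
have Kv : K <= dvol m.
  have Nm : 2 ^ N <= 2 ^ (- m) :> R by rewrite ler_eXz2l ?ltr1n// lerNr ltW.
  have KN : K <= 2 ^ N.
    move: NK; rewrite -invr_expz ltf_pV2 ?posrE ?exprz2_gt0//; last by rewrite ltr_wpDl.
    by move=> h; rewrite ltW// (lt_trans _ h)// ltrDl.
  apply: (le_trans KN); apply: (le_trans Nm).
  have h1 : 1 <= 2 ^ (- m) :> R.
    by rewrite -[leLHS](expr0z (2:R)) ler_eXz2l ?ltr1n// oppr_ge0 (le_trans (ltW mN))// oppr_le0.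
  (* Large sides give large volumes because [0 < n]; in dimension 0 every cube has volume 1. *)
  by rewrite /cell_volume -[leLHS]expr1 ler_weXn2l.
have -> : CA / lam = K `^ p^-1.
  by rewrite /K -powRrM mulfV ?(gt_eqF p0)// powRr1// divr_ge0 ?(ltW lam0)// mulr_ge0 ?(ltW A0)// ltW// avg_const_gt0.
by rewrite ge0_ler_powR ?nnegrE ?invr_ge0 ?(ltW p0) ?(ltW v0).
Qed.

Lemma hot_selected lam x : 0 < lam -> hot_set lam x ->
  exists m, selected lam m (dcell m x).
Proof.
move=> lam0 [m hm]; have [m0 hm0] := hot_level_bounded lam0.
have ex : exists k : nat, hot lam (m0 + k%:Z) (dcell (m0 + k%:Z) x).
  exists `|m - m0|%N; have /hm0 mm := hm.
  by rewrite gez0_abs ?subr_ge0// subrKC.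
case: (ex_minnP ex) => k hk kmin; exists (m0 + k%:Z); apply/selected_cell.
split=> // m' mk; apply/negP => hm'.
have mm := hm0 _ _ hm'.
have := kmin `|m' - m0|%N; rewrite gez0_abs ?subr_ge0// subrKC => /(_ hm').
move: mk mm; clear; lia.
Qed.

Lemma hot_setE lam : 0 < lam -> hot_set lam = dunion (selected lam).
Proof.
move=> lam0; apply/seteqP; split=> [x /(hot_selected lam0)//|x [m [hm _]]].
by exists m.
Qed.

Lemma measurable_hot_set lam : measurable (hot_set lam : set T).
Proof.
rewrite (_ : hot_set lam = dunion (hot lam)); first exact: measurable_dunion.
by [].
Qed.

(** The first summand serves a cube contained in a hot cube, the second one all other cubes; there
    the power of 2 comes from cutting at the height [lam / 2]. *)
Definition hot_dcube_const : R := avg_const q `^ q + weak_const q * 2 `^ q.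

Lemma hot_dcube_const_gt0 : 0 < hot_dcube_const.
Proof.
by rewrite addr_gt0// ?powR_gt0 ?avg_const_gt0// mulr_gt0 ?weak_const_gt0// powR_gt0.
Qed.

(* If a cube containing [dcube m z] is hot, then [dcube m z] itself is small compared
   to [lam]. Otherwise [lam |S| <= \int_S F] for [S] the part of the hot set in
   [dcube m z], and [weak_integral_le] with [t = lam / 2] absorbs half of [lam |S|]. *)
Lemma hot_set_dcube lam m z : 0 < lam ->
  (mu (hot_set lam `&` dcube m z) <=
    (hot_dcube_const * ((A / lam) `^ q * dvol m `^ (1 - q / p)))%:E)%E.
Proof.
move=> lam0; have v0 := cell_volume_gt0 R n m.
have mO := measurable_hot_set lam; have mD := measurable_dcube_space m z.
have w0 : 0 <= dvol m `^ (1 - q / p) by rewrite powR_ge0.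
have [[m' [mm hm']]|cold] := pselect (exists m', m' <= m /\
    hot lam m' (dcell m' (dcorner m z))).
  apply: (@le_trans _ _ (mu (dcube m z))).
    by rewrite le_measure ?inE//; exact: measurableI.
  rewrite lebesgue_dcube lee_fin.
  have vs : dvol m `^ p^-1 <= CA / lam.
    apply: le_trans (ltW (hot_small lam0 hm')).
    rewrite ge0_ler_powR ?nnegrE ?invr_ge0 ?(ltW p0) ?(ltW (cell_volume_gt0 _ _ _))//.
    exact: le_cell_volume.
  have -> : (2 ^ (- m)) ^+ n = dvol m `^ (1 - q / p) * (dvol m `^ p^-1) `^ q.
    rewrite -powRrM -powRD ?(gt_eqF v0) ?implybT//.
    by rewrite (_ : 1 - q / p + p^-1 * q = 1) ?powRr1 ?(ltW v0)//; ring.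
  rewrite mulrA [leRHS]mulrC; apply: ler_wpM2l => //.
  apply: (@le_trans _ _ ((CA / lam) `^ q)).
    by rewrite ge0_ler_powR ?nnegrE ?powR_ge0 ?(ltW q0)// (le_trans _ vs)// powR_ge0.
  rewrite -mulrA powRM ?divr_ge0 ?(ltW A0) ?(ltW lam0) ?(ltW (avg_const_gt0 q1))//.
  apply: ler_wpM2r; first exact: powR_ge0.
  by rewrite lerDl mulr_ge0 ?powR_ge0// ltW// weak_const_gt0.
(* As no cube containing [dcube m z] is hot, the selected cubes that meet it lie inside it, and
   their averages can be summed. *)
pose P m' z' := selected lam m' z' /\ dcube m' z' `<=` dcube m z.
have dP : disjoint_family R P.
  by move=> x a b [sa _] [sb _]; exact: (disjoint_selected sa sb).
have SE : hot_set lam `&` dcube m z = dunion P.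
  apply/seteqP; split=> [x [/(hot_selected lam0)[m' sx] xz]|x [m' [[hx _] sx]]].
    exists m'; split=> //; have mm : m <= m'.
      rewrite leNgt; apply/negP => /ltW mm; apply: cold; exists m'; split=> //.
      have [hx _] := sx; rewrite (_ : dcell m' _ = dcell m' x)//.
      by apply: (dcell_nest mm); rewrite dcell_corner.
    by move=> y /(dcell_nest mm); rewrite xz.
  by split; [exists m'|apply: sx].
rewrite SE; set S := dunion P; have mS : measurable (S : set T) by exact: measurable_dunion.
pose B := A `^ q * dvol m `^ (1 - q / p).
have B0 : 0 <= B by rewrite mulr_ge0// powR_ge0.
have SD : S `<=` dcube m z by move=> x; rewrite /S -SE => -[].
have Sfin : mu S \is a fin_num.
  rewrite ge0_fin_numE//; apply: (@le_lt_trans _ _ (mu (dcube m z))).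
    by rewrite le_measure ?inE.
  by rewrite lebesgue_dcube ltry.
have gB l : 0 < l -> (mu (S `&` [set x | l%:E < (EFin \o F) x]%E) <= (B * l `^ (- q))%:E)%E.
  move=> l0; have r0 : 0 < 2 ^ (- m) / 2 :> R by rewrite divr_gt0// exprz2_gt0.
  apply: le_trans (le_trans _ (FA (dcenter R m z) r0 l0)) _.
    have mG : measurable ([set x | l%:E < (EFin \o F) x]%E : set T) by exact: measurable_superlevel.
    rewrite le_measure ?inE//; [exact: measurableI| |].
      by apply: measurableI => //; exact: measurable_ccube_space.
    by apply: setSI; apply: (subset_trans SD); exact: dcube_sub_ccube.
  rewrite (_ : 2 * (2 ^ (- m) / 2) = 2 ^ (- m)); last by field.
  rewrite powRM ?invr_ge0 ?(ltW A0) ?(ltW l0)// -[l^-1]powR_inv1 ?(ltW l0)// -powRrM mulN1r.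
  by rewrite lee_fin le_eqVlt; apply/orP; left; apply/eqP; rewrite /B /cell_volume; ring.
have lam2 : 0 < lam / 2 by rewrite divr_gt0.
have I1 : (lam%:E * mu S <= \int[mu]_(x in S) (F x)%:E)%E.
  rewrite -(integral_cst mu mS).
  apply: (le_integral_dunion dP) => //=; first by move=> x; rewrite lee_fin ltW.
  move=> m' z' [[/ltW hm _] _]; rewrite integral_cst//; exact: measurable_dcube_space.
have := le_trans I1 (weak_integral_le q1 B0 mS mEF EF0 gB lam2).
move: Sfin; case: (mu S) => // s _; rewrite -!EFinM -EFinD !lee_fin -/(weak_const q).
rewrite (powRD (x := lam / 2)) ?(gt_eqF lam2) ?implybT// powRr1 ?(ltW lam2)//.
set X := weak_const q; set Y := (lam / 2) `^ (- q) => h.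
have h2 : s <= X * (B * Y).
  rewrite -(ler_pM2l lam2).
  move: h; rewrite (_ : lam * s = lam / 2 * s + lam / 2 * s); last by field.
  by rewrite lerD2l => /le_trans; apply; rewrite le_eqVlt; apply/orP; left; apply/eqP; ring.
apply: (le_trans h2).
have YE : Y = 2 `^ q * lam^-1 `^ q.
  rewrite /Y -mulN1r powRrM powR_inv1 ?(ltW lam2)// invf_div.
  by rewrite powRM// invr_ge0 ltW.
rewrite YE /B powRM ?invr_ge0 ?(ltW A0) ?(ltW lam0)// /hot_dcube_const -/X.
set a := A `^ q; set b := lam^-1 `^ q; set w := dvol m `^ _.
rewrite [leLHS](_ : _ = X * 2 `^ q * (a * b * w)); last by ring.
apply: ler_wpM2r; first by rewrite !mulr_ge0// powR_ge0.
by rewrite lerDr powR_ge0.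
Qed.

End stopping_cubes.

Lemma le_measure_finite_cover d (T : measurableType d) (R : realType)
    (mu : {measure set T -> \bar R}) (I : finType) (E : set T) (G : I -> set T) :
  measurable E -> (forall i, measurable (G i)) ->
  (forall x, E x -> exists i, G i x) -> (mu E <= \sum_i mu (G i))%E.
Proof.
move=> mE mG EG.
suff h (s : seq I) : measurable (\big[setU/set0]_(i <- s) G i) /\
    (mu (\big[setU/set0]_(i <- s) G i) <= \sum_(i <- s) mu (G i))%E.
  have [mU hU] := h (index_enum I); apply: le_trans hU.
  rewrite le_measure ?inE// => x /EG[i Gi]; rewrite -bigcup_seq/=.
  by exists i => //=; rewrite mem_index_enum.
elim: s => [|i s [mU IHs]]; first by rewrite !big_nil measure0.
rewrite !big_cons; split; first exact: measurableU.
by apply: (le_trans (measureU2 _ _ _)) => //; rewrite leeD2l.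
Qed.

Section stopping_cubes.
Context (R : realType) (n : nat) (n0 : (0 < n)%N).
Local Notation V := 'rV[R]_n.
Local Notation T := (lebesgue_space R n).
Local Notation mu := (lebesgue R n).
Local Notation idx := {ffun 'I_n -> int}.
Local Notation dcube := (@dcube R n).
Local Notation ccube := (@ccube R n).
Implicit Types (m : int) (z : idx) (x y c : V).

Definition shift_index (a : idx) (e : {ffun 'I_n -> bool}) : idx :=
  [ffun i => a i + (e i)%:Z].

(** The side [2 ^ (- m)] is the least power of two above [2 * r]. In each coordinate the interval of
    length [2 * r] therefore meets at most two consecutive dyadic intervals, the first of which
    contains its left end; [e] tells in which of them the point lies. *)
Lemma ccube_dyadic_cover c (r : R) : 0 < r -> exists m a,
  [/\ 2 ^ (- m) <= 4 * r &
    forall x, ccube c r x -> exists e, dcube m (shift_index a e) x].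
Proof.
move=> r0; have r20 : 0 < 2 * r by rewrite mulr_gt0.
have [m' /andP[m1 m2]] := dyadic_bracket r20.
exists (- (m' + 1)), (dcell (- (m' + 1)) (\row_i (c ord0 i - r))).
rewrite opprK; split; first by rewrite expfzDr// expr1z; lra.
set m := - (m' + 1); have mE : 2 ^ m * (2 * r) <= 1 :> R.
  by rewrite /m -invr_expz ler_pdivrMl ?exprz2_gt0// mulr1 ltW.
move=> x xc; exists [ffun i => Num.floor (2 ^ m * (c ord0 i - r)) + 1 <= Num.floor (2 ^ m * x ord0 i)].
apply/ffunP => i; rewrite !ffunE mxE.
have /andP[x1 x2] : c ord0 i - r <= x ord0 i <= c ord0 i + r by rewrite -ler_distl; exact: xc.
have zm := exprz2_gt0 R m.
have y1 : 2 ^ m * (c ord0 i - r) <= 2 ^ m * x ord0 i by rewrite ler_pM2l.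
have y2 : 2 ^ m * x ord0 i <= 2 ^ m * (c ord0 i - r) + 1.
  apply: le_trans (_ : 2 ^ m * (c ord0 i + r) <= _); first by rewrite ler_pM2l.
  by move: mE; lra.
have f1 := le_floor y1.
have f2 : Num.floor (2 ^ m * x ord0 i) <= Num.floor (2 ^ m * (c ord0 i - r)) + 1.
  have -> : Num.floor (2 ^ m * (c ord0 i - r)) + 1 = Num.floor (2 ^ m * (c ord0 i - r) + 1).
    by rewrite floorDrz ?rpred1// floor1.
  exact: le_floor.
move: f1 f2; set a := Num.floor _; set b := Num.floor _; clear.
by case: (leP (a + 1) b) => /=; lia.
Qed.

Variables (p q : R) (q1 : 1 < q) (qp : q <= p).
Variables (F : V -> R).
Hypotheses (mF : measurable_fun [set: T] F) (F0 : forall x, 0 <= F x).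
Variables (A : R) (A0 : 0 < A) (FA : weak_bound p q A (EFin \o F)).

(** One factor [2 ^+ n] counts the covering dyadic cubes. The other compares volumes: the dyadic
    side is at most [2 * (2 * r)], and the exponent [1 - q / p] lies between 0 and 1. *)
Definition hot_ccube_const : R := 2 ^+ n * (2 ^+ n * hot_dcube_const q).

Lemma hot_ccube_const_gt0 : 0 < hot_ccube_const.
Proof. by rewrite !mulr_gt0 ?exprn_gt0 ?hot_dcube_const_gt0. Qed.

Lemma hot_set_ccube lam c r : 0 < lam -> 0 < r ->
  (mu (ccube c r `&` hot_set F lam) <=
    (hot_ccube_const * ((A / lam) `^ q * ((2 * r) ^+ n) `^ (1 - q / p)))%:E)%E.
Proof.
move=> lam0 r0; have [m [a [mr cov]]] := ccube_dyadic_cover c r0.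
have mH := measurable_hot_set F lam.
have mD z : measurable (dcube m z : set T) := measurable_dcube_space m z.
apply: (@le_trans _ _ (\sum_e mu (hot_set F lam `&` dcube m (shift_index a e)))%E).
  apply: le_measure_finite_cover.
  - by apply: measurableI => //; exact: measurable_ccube_space.
  - by move=> e; exact: measurableI.
  - by move=> x [/cov[e xe] Hx]; exists e.
apply: (@le_trans _ _ (\sum_(e : {ffun 'I_n -> bool})
    (hot_dcube_const q * ((A / lam) `^ q * cell_volume R n m `^ (1 - q / p)))%:E)%E).
  by apply: lee_sum => e _; exact: (hot_set_dcube n0 q1 qp mF F0 A0 FA).
rewrite sumEFin lee_fin sumr_const card_ffun card_bool card_ord -[leLHS]mulr_natl natrX.
rewrite [leRHS](_ : _ = 2 ^+ n * (hot_dcube_const q * ((A / lam) `^ q *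
  (2 ^+ n * ((2 * r) ^+ n) `^ (1 - q / p))))); last by rewrite /hot_ccube_const; ring.
rewrite ler_pM2l ?exprn_gt0// ler_pM2l ?hot_dcube_const_gt0//.
apply: ler_wpM2l; first exact: powR_ge0.
have p0 : 0 < p by rewrite (lt_le_trans _ qp)// (lt_trans _ q1).
have s0 : 0 <= 1 - q / p by rewrite subr_ge0 ler_pdivrMr// mul1r.
have s1 : 1 - q / p <= 1 by rewrite gerBl divr_ge0// ltW// (lt_trans _ q1).
apply: (@le_trans _ _ ((2 ^+ n * (2 * r) ^+ n) `^ (1 - q / p))).
  rewrite ge0_ler_powR// ?nnegrE ?(ltW (cell_volume_gt0 _ _ _))//.
    by rewrite mulr_ge0 ?exprn_ge0// mulr_ge0// ltW.
  rewrite -exprMn lerXn2r// ?nnegrE ?(ltW (exprz2_gt0 _ _))//.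
    by rewrite !mulr_ge0// ltW.
  by rewrite mulrA -natrM.
rewrite powRM ?exprn_ge0// ?mulr_ge0 ?(ltW r0)//; apply: ler_wpM2r; first exact: powR_ge0.
by apply: ler1_powR => //; rewrite exprn_ege1// ler1n.
Qed.

(** In a unit cube the hot set at height [2 ^+ k] has measure at most a multiple of the [q]-th power
    of [A / 2 ^+ k]. Off this null set every point is cold at some height, which gives the
    telescoping sum its upper end. *)
Lemma negligible_hot_sets : mu.-negligible (\bigcap_(k : nat) hot_set F (2 ^+ k) : set T).
Proof.
have mB : measurable (\bigcap_(k : nat) hot_set F (2 ^+ k) : set T).
  by apply: bigcapT_measurable => k; exact: measurable_hot_set.
pose N j : set T := if idx_decode idx j is Some z
  then (\bigcap_(k : nat) hot_set F (2 ^+ k)) `&` dcube 0 z else set0.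
apply: (@negligibleS _ _ _ _ (\bigcup_j N j)).
  by move=> x Bx; exists (idx_code (dcell 0 x)) => //; rewrite /N idx_codeK.
apply: negligible_bigcup => j; rewrite /N; case: (idx_decode _ j) => [z|]; last exact: negligible_set0.
have mD : measurable (dcube 0 z : set T) := measurable_dcube_space 0 z.
have mBD : measurable ((\bigcap_(k : nat) hot_set F (2 ^+ k)) `&` dcube 0 z : set T) by exact: measurableI.
apply/negligibleP => //; apply/eqP; rewrite eq_le measure_ge0 andbT.
apply/lee_addgt0Pr => e e0; rewrite add0e.
have q0 : 0 < q by rewrite (lt_trans _ q1).
have H0 := hot_dcube_const_gt0 q1.
set d := (e / hot_dcube_const q) `^ q^-1.
have d0 : 0 < d by rewrite powR_gt0// divr_gt0.
have [k Ak] : exists k : nat, A / 2 ^+ k <= d.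
  exists (Num.trunc (A / d)).+1; rewrite ler_pdivrMr ?exprn_gt0// -ler_pdivrMl//.
  rewrite mulrC; apply: (le_trans (ltW (truncnS_gt _))).
  by rewrite -natrX ler_nat; exact/ltnW/ltn_expl.
apply: (@le_trans _ _ (mu (hot_set F (2 ^+ k) `&` dcube 0 z))).
  have mH := measurable_hot_set F (2 ^+ k).
  rewrite le_measure ?inE//; first exact: measurableI.
  by apply: setSI => x; apply.
apply: (le_trans (hot_set_dcube n0 q1 qp mF F0 A0 FA 0 z _)); first by rewrite exprn_gt0.
rewrite lee_fin /cell_volume oppr0 expr0z expr1n powR1 mulr1.
rewrite -ler_pdivlMl// [leRHS]mulrC.
have -> : e / hot_dcube_const q = d `^ q.
  by rewrite /d -powRrM mulVf ?gt_eqF// powRr1// divr_ge0 ?ltW.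
by rewrite ge0_ler_powR ?nnegrE ?(ltW q0) ?(ltW d0)// divr_ge0 ?exprn_ge0// ltW.
Qed.

End stopping_cubes.

(** * Projections with prescribed moments *)

(* With [Q = P^`()], every polynomial [Q] of degree at most [K] is the combination of
   the [w i] with coefficients its integrals over [[i, i + 1]]. *)
Lemma quadrature_weights (R : realType) (K : nat) : exists w : 'I_K.+1 -> {poly R},
  forall P : {poly R}, (size P <= K.+2)%N ->
    P^`() = \sum_(i < K.+1) (P.[i.+1%:R] - P.[i%:R])%:P * w i.
Proof.
pose x (j : nat) : R := j%:R.
have x_inj : injective x by move=> a b /eqP; rewrite eqr_nat => /eqP.
pose L (j : 'I_K.+2) : {poly R} := tnth (qpoly.lagrange K.+2 x) j.
have LE (P : {poly R}) : (size P <= K.+2)%N -> P = \sum_(j < K.+2) P.[j%:R]%:P * L j.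
  by move=> sP; exact: (qpoly.lagrange_gen (ltn0Sn _) x_inj sP).
have L'E (P : {poly R}) : (size P <= K.+2)%N -> P^`() = \sum_(j < K.+2) P.[j%:R]%:P * (L j)^`().
  move=> sP; rewrite {1}(LE P sP) raddf_sum; apply: eq_bigr => j _.
  by rewrite /= derivM derivC mul0r add0r.
exists (fun i : 'I_K.+1 => \sum_(j < K.+2 | (i < j)%N) (L j)^`()) => P sP.
have L'0 : \sum_j (L j)^`() = 0.
  have := L'E 1; rewrite derivC size_poly1 => /(_ isT) E.
  by rewrite [RHS]E; apply: eq_bigr => j _; rewrite hornerC mul1r.
(* Since the derivatives of the Lagrange polynomials sum to 0, [P.[0]] can be subtracted from each
   nodal value; the difference at [j] is then the sum of the increments of [P] over the unit
   intervals below [j]. *)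
transitivity (\sum_(j < K.+2) (P.[j%:R] - P.[0%:R])%:P * (L j)^`()).
  rewrite L'E//; under [RHS]eq_bigr do rewrite polyCB mulrBl.
  by rewrite sumrB -mulr_sumr L'0 mulr0 subr0.
under [RHS]eq_bigr do rewrite mulr_sumr.
rewrite [RHS](exchange_big_dep xpredT)//=; apply: eq_bigr => j _.
rewrite -mulr_suml -rmorph_sum/=; congr (_%:P * _).
rewrite -(big_ord_widen K.+1 (fun i => P.[i.+1%:R] - P.[i%:R])); last by case: j => j /=.
by rewrite -(big_mkord xpredT (fun i => P.[i.+1%:R] - P.[i%:R])) telescope_sumr.
Qed.

Section polynomial_integral.
Context (R : realType).
Local Notation leb := (@lebesgue_measure R).

Lemma integral_deriv_poly (p : {poly R}) (a b : R) : a < b ->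
  (\int[leb]_(x in `[a, b[) ((deriv p).[x])%:E = (p.[b] - p.[a])%:E)%E.
Proof.
move=> ab; rewrite integral_itv_bndo_bndc; last first.
  apply/measurable_EFinP; apply: measurable_funTS; apply: continuous_measurable_fun.
  exact: continuous_horner.
rewrite (@continuous_FTC2 _ _ (horner p))//.
- exact/continuous_subspaceT/continuous_horner.
- split; first by move=> x _; exact: derivable_horner.
  + exact/cvg_at_right_filter/continuous_horner.
  + exact/cvg_at_left_filter/continuous_horner.
- by move=> x _; rewrite derivE.
Qed.

Definition monomial_cell (b : nat) (c h : R) (i : nat) (s : R) : R :=
  s ^+ b * \1_`[c + h * i%:R, c + h * i.+1%:R[ s.

Lemma monomial_cellE b c h i : EFin \o monomial_cell b c h i =
  (fun s : R => (('X^b).[s])%:E) \_ `[c + h * i%:R, c + h * i.+1%:R[.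
Proof.
apply/funext => s; rewrite /patch /monomial_cell /= indicE hornerXn.
by case: ifP => _; rewrite ?mulr1 ?mulr0.
Qed.

Lemma integrable_monomial_cell b c h i :
  leb.-integrable setT (EFin \o monomial_cell b c h i).
Proof.
rewrite monomial_cellE; apply: (iffLR (integrable_mkcond _ _)) => //.
have : leb.-integrable `[c + h * i%:R, c + h * i.+1%:R] (EFin \o (horner 'X^b : R -> R)).
  apply: continuous_compact_integrable; first exact: segment_compact.
  exact/continuous_subspaceT/continuous_horner.
by apply: integrableS => //; apply: subset_itvl; rewrite bnd_simp.
Qed.

Lemma integral_monomial_cell b c h i : 0 < h ->
  (\int[leb]_s (monomial_cell b c h i s)%:E =
   (((c + h * i.+1%:R) ^+ b.+1 - (c + h * i%:R) ^+ b.+1) / b.+1%:R)%:E)%E.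
Proof.
move=> h0.
rewrite -[LHS]/(\int[leb]_s (EFin \o monomial_cell b c h i) s)%E.
rewrite monomial_cellE -integral_mkcond.
pose p : {poly R} := b.+1%:R^-1 *: 'X^(b.+1).
have p' : deriv p = 'X^b.
  by rewrite /p derivZ derivXn /= -(scaler_nat b.+1 ('X^b : {poly R})) scalerA mulVf ?scale1r// pnatr_eq0.
rewrite -p' integral_deriv_poly; last by rewrite ltrD2l ltr_pM2l// ltr_nat.
by rewrite /p !hornerZ !hornerXn -mulrBr mulrC.
Qed.

(** Apply the weights to [(c + h u) ^ (b + 1) / (b + 1)] as a polynomial in [u]: its increments over
    unit intervals are the integrals of the monomial over intervals of length [h], and its
    derivative at [(t - c) / h] is [h * t ^+ b]. *)
Lemma quadrature_moments K (w : 'I_K.+1 -> {poly R}) b (c h t : R) : (b <= K)%N -> 0 < h ->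
  (forall P : {poly R}, (size P <= K.+2)%N ->
    P^`() = \sum_(i < K.+1) (P.[i.+1%:R] - P.[i%:R])%:P * w i) ->
  \sum_(i < K.+1) (w i).[(t - c) / h] / h *
    (((c + h * i.+1%:R) ^+ b.+1 - (c + h * i%:R) ^+ b.+1) / b.+1%:R) = t ^+ b.
Proof.
move=> bK h0 wE.
pose P : {poly R} := b.+1%:R^-1 *: (c%:P + h *: 'X) ^+ b.+1.
have PE u : P.[u] = (c + h * u) ^+ b.+1 / b.+1%:R.
  by rewrite /P hornerZ horner_exp hornerD hornerC hornerZ hornerX mulrC.
have sP : (size P <= K.+2)%N.
  apply: (leq_trans (size_scale_leq _ _)); apply: (leq_trans (size_poly_exp_leq _ _)).
  have : (size (c%:P + h *: 'X)%R <= 2)%N.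
    apply: (leq_trans (size_polyD _ _)); rewrite geq_max (leq_trans (size_polyC_leq1 _))//.
    by rewrite (leq_trans (size_scale_leq _ _))// size_polyX.
  by case: (size _) => [|[|[|]]]//= _; rewrite ?mul0n ?mul1n ?ltnS.
have := congr1 (fun Q : {poly R} => Q.[(t - c) / h]) (wE P sP).
rewrite /= horner_sum => E; have hN : h != 0 by rewrite gt_eqF.
apply: (mulfI hN); transitivity (deriv P).[(t - c) / h]; last first.
  have bN : b.+1%:R != 0 :> R by rewrite pnatr_eq0.
  rewrite /P derivZ deriv_exp /= derivD derivC derivZ derivX add0r.
  rewrite hornerZ hornerMn hornerM horner_exp !(hornerZ, hornerD, hornerC, hornerX).
  rewrite -mulr_natr (_ : c + h * ((t - c) / h) = t); last by field.
  by field.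
rewrite E mulr_sumr; apply: eq_bigr => i _; rewrite hornerM hornerC !PE.
have : b.+1%:R != 0 :> R by rewrite pnatr_eq0.
by move: (b.+1%:R : R) => B BN; field; rewrite BN hN.
Qed.

End polynomial_integral.

Section product_integral.
Context (R : realType).
Local Notation leb := (@lebesgue_measure R).

Definition tensor n (h : 'I_n -> R -> R) (x : 'rV[R]_n) : R :=
  \prod_(i < n) h i (x ord0 i).

Lemma measurable_tensor n (h : 'I_n -> R -> R) :
  (forall i, measurable_fun setT (h i : measurableTypeR R -> R)) ->
  measurable_fun setT (tensor h).
Proof.
move=> mh; rewrite /tensor; elim: (index_enum _) => [|i s IHs].
  by under eq_fun do rewrite big_nil; exact: measurable_cst.
under eq_fun do rewrite big_cons.
apply: measurable_funM => //.
exact: (measurableT_comp (mh i) (@measurable_rVcoord R n i)).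
Qed.

(** Induction on the dimension: the measure is the image under [rVcons] of a product measure, where
    Fubini splits off the first coordinate. Integrability is part of the induction because Fubini
    needs it. *)
Lemma integral_tensor n (h : 'I_n -> R -> R) :
  (forall i, leb.-integrable setT (EFin \o h i)) ->
  (borel_lebesgue R n).-integrable setT (EFin \o tensor h) /\
  (\int[borel_lebesgue R n]_x (tensor h x)%:E =
   (\prod_(i < n) \int[leb]_s h i s)%:E)%E.
Proof.
elim: n h => [|n IHn] h ih.
  have t1 : EFin \o tensor h = cst 1%E.
    by apply/funext => x; rewrite /= /tensor big_ord0.
  have m0 : (borel_lebesgue R 0 setT = 1)%E by rewrite /= diracT.
  rewrite big_ord0 -[X in X = _]/(\int[borel_lebesgue R 0]_x (EFin \o tensor h) x)%E t1.
  have i1 : (\int[borel_lebesgue R 0]_x cst 1%E x = 1)%E.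
    transitivity (1 * borel_lebesgue R 0 setT)%E; last by rewrite m0 mul1e.
    exact: (integral_cst (borel_lebesgue R 0) measurableT).
  split=> //; apply/integrableP; split; first exact: measurable_cst.
  by under eq_integral do rewrite /= normr1; rewrite i1 ltry.
set H := @tensor n (h \o lift ord0).
have [iH IH] := IHn (h \o lift ord0) (fun i => ih _).
have tE (a : measurableTypeR R) (y : 'rV[R]_n) : tensor h (rVcons (a, y)) = h ord0 a * H y.
  rewrite /tensor big_ord_recl /rVcons mxE unlift_none/=; congr (_ * _).
  by apply: eq_bigr => i _; rewrite mxE liftK.
have mh i : measurable_fun setT (h i : measurableTypeR R -> R).
  by apply/measurable_EFinP; exact: measurable_int (ih i).
have mt := measurable_tensor mh.
have mc := @measurable_rVcons R n.
have mtc : measurable_fun setT ((EFin \o tensor h) \o @rVcons R n).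
  by apply: measurableT_comp => //; exact/measurable_EFinP.
have iP : (leb \x borel_lebesgue R n)%E.-integrable setT ((EFin \o tensor h) \o @rVcons R n).
  apply/(integrable12ltyP _ _ mtc).
  have c0 : (0 <= \int[borel_lebesgue R n]_y `|H y|%:E)%E.
    by apply: integral_ge0 => y _; rewrite lee_fin.
  have cfin : (\int[borel_lebesgue R n]_y `|H y|%:E)%E \is a fin_num.
    by rewrite ge0_fin_numE//; have /integrableP[_] := iH.
  have /integrableP[_ h0fin] := ih ord0.
  apply: (@le_lt_trans _ _ (\int[leb]_a (`|h ord0 a|%:E *
      \int[borel_lebesgue R n]_y `|H y|%:E))%E).
    have mabs : measurable_fun setT (abse \o ((EFin \o tensor h) \o @rVcons R n)).
      exact: measurableT_comp mtc.
    have mabsH : measurable_fun setT (fun y => `|H y|%:E).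
      apply/measurable_EFinP; apply: measurableT_comp => //.
      exact: (measurable_tensor (fun i => mh (lift ord0 i))).
    apply: ge0_le_integral => //.
    - by move=> a _; exact: integral_ge0.
    - have := measurable_fun_fubini_tonelli_F (m2 := borel_lebesgue R n) _ mabs (fun=> abse_ge0 _).
      exact.
    - apply: emeasurable_funM; last exact: measurable_cst.
      by apply/measurable_EFinP; exact: measurableT_comp.
    - move=> a _; rewrite -ge0_integralZl//.
      + apply: ge0_le_integral => //.
        * exact: (measurableT_comp mabs (pair1_measurable a)).
        * by apply: emeasurable_funM => //; exact: measurable_cst.
        * by move=> y _; rewrite /= tE normrM EFinM.
  have mh0 : measurable_fun setT (fun a => `|h ord0 a|%:E).
    by apply/measurable_EFinP; apply: (measurableT_comp _ (mh ord0)).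
  rewrite (ge0_integralZr leb measurableT mh0 _ c0); last by move=> a _; rewrite lee_fin.
  by rewrite muleC lte_mul_pinfty.
have mEt : measurable_fun setT (EFin \o tensor h) by exact/measurable_EFinP.
have iP' : (leb \x borel_lebesgue R n)%E.-integrable (@rVcons R n @^-1` setT) ((EFin \o tensor h) \o @rVcons R n).
  by rewrite preimage_setT.
split; first exact: (integrable_pushforward mc mEt iP' measurableT).
have -> : (\int[borel_lebesgue R n.+1]_x (tensor h x)%:E =
    \int[leb \x borel_lebesgue R n]_z (tensor h (rVcons z))%:E)%E.
  by rewrite (integral_pushforward mc mEt iP' measurableT).
rewrite -(integral12_prod_meas1 iP) /fubini_F /=.
have IHE : (\int[borel_lebesgue R n]_y (H y)%:E = (\prod_(i < n) \int[leb]_s h (lift ord0 i) s)%:E)%E by exact: IH.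
under eq_integral => a _.
  under eq_integral => y _ do rewrite tE EFinM.
  rewrite integralZl//.
  over.
rewrite /= IHE integralZr//; last exact: ih.
rewrite big_ord_recl EFinM; congr (_ * _)%E.
by rewrite fineK//; apply: integrable_fin_num => //; exact: ih.
Qed.

(** The identity from the completed measurable space to the Borel one is measurable, and it pushes
    the Lebesgue measure to [borel_lebesgue]. *)
Lemma integrable_borel_lebesgue n (g : 'rV[R]_n -> \bar R) :
  (borel_lebesgue R n).-integrable setT g ->
  (lebesgue R n).-integrable setT g /\
  (\int[lebesgue R n]_x g x = \int[borel_lebesgue R n]_x g x)%E.
Proof.
move=> ig; have mg := measurable_int _ ig.
pose phi : lebesgue_space R n -> 'rV[R]_n := idfun.
have mphi : measurable_fun setT phi.
  by move=> _ Y mY; rewrite setTI; exact: measurable_lebesgue_space.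
have E D (f : 'rV[R]_n -> \bar R) : (\int[pushforward (lebesgue R n) phi]_(x in D) f x =
    \int[borel_lebesgue R n]_(x in D) f x)%E.
  by apply: eq_measure_integral => A mA _; exact: lebesgue_borelE.
have mgT : measurable_fun [set: lebesgue_space R n] g.
  exact: (measurableT_comp mg mphi).
have igT : (lebesgue R n).-integrable setT g.
  apply/integrableP; split => //.
  have /integrableP[_] := ig; rewrite -E ge0_integral_pushforward//.
  exact: measurableT_comp.
split=> //; rewrite -E integral_pushforward//.
Qed.

End product_integral.

Lemma poly_bounded (R : realType) (p : {poly R}) (M : R) : exists2 C : R, 0 <= C &
  forall x, `|x| <= M -> `|p.[x]| <= C.
Proof.
exists (\sum_(i < size p) `|p`_i| * `|M| ^+ i); first by apply: sumr_ge0 => i _; rewrite mulr_ge0// exprn_ge0.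
move=> x xM; rewrite horner_coef; apply: (le_trans (ler_norm_sum _ _ _)).
apply: ler_sum => i _; rewrite normrM normrX; apply: ler_wpM2l => //.
by rewrite lerXn2r ?nnegrE// (le_trans xM)// ler_norm.
Qed.

Lemma bounded_by T (R : realType) (D : set T) (h : T -> R) (M : R) :
  (forall x, D x -> `|h x| <= M) -> [bounded h x | x in D].
Proof.
move=> hM; exists M; split; first exact: num_real.
by move=> y My x Dx; exact: le_trans (hM _ Dx) (ltW My).
Qed.

Section projection.
Context (R : realType) (n K : nat).
Local Notation V := 'rV[R]_n.
Local Notation T := (lebesgue_space R n).
Local Notation mu := (lebesgue R n).
Local Notation idx := {ffun 'I_n -> int}.
Local Notation dcube := (@dcube R n).
Local Notation dcorner := (@dcorner R n).
Local Notation cells := {ffun 'I_n -> 'I_K.+1}.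
Implicit Types (m : int) (z : idx) (x y c : V) (J : cells).
Variables (w : 'I_K.+1 -> {poly R}) (W : R).
Hypothesis wE : forall P : {poly R}, (size P <= K.+2)%N ->
  deriv P = \sum_(i < K.+1) (P.[i.+1%:R] - P.[i%:R])%:P * w i.
Hypothesis wW : forall i (x : R), 0 <= x <= K.+1%:R -> `|(w i).[x]| <= W.
Hypothesis W0 : 0 <= W.

Definition mesh m : R := 2 ^ (- m) / K.+1%:R.

Lemma mesh_gt0 m : 0 < mesh m. Proof. by rewrite divr_gt0// exprz2_gt0. Qed.

Definition subcell m z J : set V := [set x | forall i, x ord0 i \in
  `[dcorner m z ord0 i + mesh m * (J i)%:R, dcorner m z ord0 i + mesh m * (J i).+1%:R[%R].

(** Products of the one-dimensional weights; the division by [mesh m] accounts for the rescaling of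
    unit intervals to the edges of the subcells. *)
Definition weight m z J (y : V) : R :=
  \prod_(i < n) ((w (J i)).[(y ord0 i - dcorner m z ord0 i) / mesh m] / mesh m).

Definition coefficient (u : V -> R) m z J : R :=
  \int[mu]_(y in dcube m z) (u y * weight m z J y).

(* A step function on the [(K + 1) ^ n] subcells of [dcube m z]: as the weights
   reproduce a polynomial of degree at most [K] in each variable from its integrals over
   the subcells, [projection u m z] has the same moments as [u] on [dcube m z]. *)
Definition projection (u : V -> R) m z (x : V) : R :=
  \sum_J coefficient u m z J * \1_(subcell m z J) x.

Lemma subcell_sub m z J : subcell m z J `<=` dcube m z.
Proof.
move=> x xJ; rewrite dcubeE => i; have := xJ i; rewrite !in_itv/= mxE.
have h0 := mesh_gt0 m; have K0 : 0 < K.+1%:R :> R by [].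
have hE : mesh m * K.+1%:R = 2 ^ (- m) by rewrite /mesh divfK// gt_eqF.
move=> /andP[h1 h2]; apply/andP; split.
  by apply: le_trans h1; rewrite lerDl mulr_ge0// ltW.
apply: (lt_le_trans h2); rewrite mulrDr mulr1 lerD2l -hE ler_pM2l// ler_nat.
exact: ltn_ord.
Qed.

Lemma measurable_subcell m z J : measurable (subcell m z J : set T).
Proof. by apply: measurable_lebesgue_space; exact: measurable_itv_box. Qed.

Lemma measurable_projection u m z : measurable_fun [set: T] (projection u m z).
Proof.
rewrite /projection; elim: (index_enum _) => [|J s IHs].
  by under eq_fun do rewrite big_nil; exact: measurable_cst.
under eq_fun do rewrite big_cons.
apply: measurable_funD; last exact: IHs.
apply: measurable_funM; first exact: measurable_cst.
by apply: measurable_indic; exact: measurable_subcell.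
Qed.

Lemma measurable_weight m z J : measurable_fun [set: T] (weight m z J).
Proof.
have mid : measurable_fun setT (idfun : T -> V).
  by move=> _ Y mY; rewrite setTI; exact: measurable_lebesgue_space.
rewrite -[weight m z J]/(tensor (fun i s =>
  (w (J i)).[(s - dcorner m z ord0 i) / mesh m] / mesh m)).
apply: (measurableT_comp (measurable_tensor _) mid) => i.
apply: continuous_measurable_fun => s.
apply: cvgM; last exact: cvg_cst.
apply: (@continuous_comp _ _ _ (fun s => (s - dcorner m z ord0 i) / mesh m) (horner (w (J i)))).
  by apply: cvgM; [apply: cvgB; [exact: cvg_id|exact: cvg_cst]|exact: cvg_cst].
exact: continuous_horner.
Qed.

Lemma weight_bound m z J y : dcube m z y -> `|weight m z J y| <= (W / mesh m) ^+ n.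
Proof.
rewrite dcubeE => yz; rewrite /weight normr_prod.
apply: (@le_trans _ _ (\prod_(i < n) (W / mesh m))); last by rewrite prodr_const card_ord.
apply: ler_prod => i _; rewrite normr_ge0/= normrM; have h0 := mesh_gt0 m.
have -> : `|(mesh m)^-1| = (mesh m)^-1 by rewrite ger0_norm// invr_ge0 ltW.
apply: ler_wpM2r; first by rewrite invr_ge0 ltW.
apply: wW; have := yz i; rewrite in_itv/= mxE => /andP[h1 h2].
rewrite divr_ge0 ?subr_ge0 ?(ltW h0)//= ler_pdivrMr//.
rewrite [leRHS](_ : _ = 2 ^ (- m)); last by rewrite /mesh mulrC divfK// pnatr_eq0.
by rewrite lerBlDl; move: h2; rewrite mulrDr mulr1 => /ltW.
Qed.

Variables (u F : V -> R).
Hypotheses (mu_ : measurable_fun [set: T] u) (mF : measurable_fun [set: T] F).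
Hypothesis uF : forall x, `|u x| <= F x.

Lemma integrable_of_bound (D : set T) : measurable D ->
  (\int[mu]_(x in D) (F x)%:E < +oo)%E -> mu.-integrable D (EFin \o u).
Proof.
move=> mD FD; apply/integrableP; split.
  by apply: measurable_funTS; apply/measurable_EFinP.
apply: le_lt_trans FD; apply: (ge0_le_integral mu mD); first by move=> x _; exact: abse_ge0.
- by apply: measurable_funTS; apply/measurable_EFinP; exact: measurableT_comp.
- by apply: measurable_funTS; apply/measurable_EFinP.
- by move=> x _; rewrite lee_fin.
Qed.

Lemma integrable_weight m z J : (\int[mu]_(x in dcube m z) (F x)%:E < +oo)%E ->
  mu.-integrable (dcube m z) (EFin \o (fun y => u y * weight m z J y)).
Proof.
move=> FD; have mD := measurable_dcube_space m z : measurable (dcube m z : set T).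
apply: (integrableMl mD (integrable_of_bound mD FD) (h := weight m z J)).
  by apply: measurable_funTS; exact: measurable_weight.
by apply: bounded_by => y; exact: weight_bound.
Qed.

(** The bound does not depend on the size of the cube: its volume is the [n]-th power of
    [K.+1%:R * mesh m], which cancels the [mesh m] in the bound on the weights. *)
Lemma coefficient_bound m z J (t : R) :
  (\int[mu]_(x in dcube m z) (F x)%:E <= (t * cell_volume R n m)%:E)%E ->
  `|coefficient u m z J| <= (W * K.+1%:R) ^+ n * t.
Proof.
move=> Ft; have mD := measurable_dcube_space m z : measurable (dcube m z : set T).
have FD : (\int[mu]_(x in dcube m z) (F x)%:E < +oo)%E by rewrite (le_lt_trans Ft)// ltry.
have iw := integrable_weight J FD.
rewrite -lee_fin /coefficient EFin_normr_Rintegral//.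
apply: (le_trans (le_abse_integral _ mD _)); first exact: measurable_int iw.
have Wh0 : 0 <= (W / mesh m) ^+ n by rewrite exprn_ge0// divr_ge0// ltW// mesh_gt0.
apply: (@le_trans _ _ (\int[mu]_(x in dcube m z) (((W / mesh m) ^+ n)%:E * (F x)%:E))%E).
  apply: (ge0_le_integral mu mD); first by move=> x _; exact: abse_ge0.
  - exact: measurableT_comp (measurable_int _ iw).
  - by apply: emeasurable_funM; [exact: measurable_cst|apply: measurable_funTS; exact/measurable_EFinP].
  - move=> x Dx; rewrite /= -EFinM lee_fin normrM mulrC.
    by apply: ler_pM => //; exact: weight_bound.
have mFD : measurable_fun (dcube m z : set T) (EFin \o F).
  by apply: measurable_funTS; apply/measurable_EFinP.
have F0 x : dcube m z x -> (0 <= (EFin \o F) x)%E.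
  by move=> _; rewrite lee_fin (le_trans _ (uF x)).
rewrite (ge0_integralZl mu mD mFD F0); last by rewrite lee_fin.
apply: (@le_trans _ _ (((W / mesh m) ^+ n)%:E * (t * cell_volume R n m)%:E)%E).
  by rewrite lee_wpmul2l// lee_fin.
rewrite -EFinM lee_fin le_eqVlt; apply/orP; left; apply/eqP.
have h0 := mesh_gt0 m; have d0 := exprz2_gt0 R (- m).
rewrite mulrCA /cell_volume -exprMn mulrC; congr (_ ^+ n * _).
by rewrite /mesh invf_div mulrA divfK// gt_eqF.
Qed.

Lemma projection_bound m z x (t : R) : 0 <= t ->
  (\int[mu]_(x in dcube m z) (F x)%:E <= (t * cell_volume R n m)%:E)%E ->
  `|projection u m z x| <= (K.+1 ^ n)%:R * (W * K.+1%:R) ^+ n * t.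
Proof.
move=> t0 Ft; apply: (le_trans (ler_norm_sum _ _ _)).
apply: (@le_trans _ _ (\sum_(J : cells) (W * K.+1%:R) ^+ n * t)); last first.
  by rewrite sumr_const card_ffun !card_ord -[leLHS]mulr_natl mulrA.
apply: ler_sum => J _; rewrite normrM -[leRHS]mulr1; apply: ler_pM => //.
  exact: coefficient_bound.
by rewrite indicE; case: (_ \in _); rewrite ?normr0 ?normr1.
Qed.

Lemma monomial_subcell (al : {ffun 'I_n -> nat}) m z J x :
  monomial al x * \1_(subcell m z J) x =
  tensor (fun i s => monomial_cell (al i) (dcorner m z ord0 i) (mesh m) (J i) s) x.
Proof.
rewrite /tensor /monomial_cell big_split/=; congr (_ * _).
have [xJ|xJ] := pselect (subcell m z J x).
  rewrite indicE mem_set//= big1// => i _; rewrite indicE mem_set//=; exact: xJ.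
rewrite indicE memNset//=; have /existsNP[i xi] := xJ.
by rewrite (bigD1 i)//= indicE memNset ?mul0r//.
Qed.

Definition cell_moment (al : {ffun 'I_n -> nat}) m z J : R :=
  \prod_(i < n) (((dcorner m z ord0 i + mesh m * (J i).+1%:R) ^+ (al i).+1 -
    (dcorner m z ord0 i + mesh m * (J i)%:R) ^+ (al i).+1) / (al i).+1%:R).

Lemma integral_monomial_subcell (al : {ffun 'I_n -> nat}) m z J :
  mu.-integrable setT (EFin \o (fun x => monomial al x * \1_(subcell m z J) x)) /\
  (\int[mu]_x (monomial al x * \1_(subcell m z J) x)%:E)%E = (cell_moment al m z J)%:E.
Proof.
pose h i s := monomial_cell (al i) (dcorner m z ord0 i) (mesh m) (J i) s.
have [ib Eb] := integral_tensor (fun i => integrable_monomial_cell (al i) (dcorner m z ord0 i) (mesh m) (J i)).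
have [it Et] := integrable_borel_lebesgue ib.
have E : (fun x => monomial al x * \1_(subcell m z J) x) = tensor h.
  by apply/funext => x; exact: monomial_subcell.
split; first by rewrite E.
transitivity (\int[mu]_x (EFin \o tensor h) x)%E.
  by apply: eq_integral => x _; rewrite /= monomial_subcell.
rewrite Et Eb /cell_moment; congr (_%:E); apply: eq_bigr => i _.
by rewrite /Rintegral integral_monomial_cell// mesh_gt0.
Qed.

(** Each exponent is at most [K], so the one-dimensional identity holds in every coordinate;
    expanding the product of these sums gives the sum over all [J]. *)
Lemma monomial_reproduction (al : {ffun 'I_n -> nat}) m z y : (\sum_(i < n) al i <= K)%N ->
  \sum_J cell_moment al m z J * weight m z J y = monomial al y.
Proof.
move=> alK; have alKi i : (al i <= K)%N.
  by apply: leq_trans alK; rewrite (bigD1 i)//= leq_addr.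
rewrite /monomial; under [RHS]eq_bigr => i _ do
  rewrite -(quadrature_moments (dcorner m z ord0 i) (y ord0 i) (alKi i) (mesh_gt0 m) wE).
rewrite bigA_distr_bigA/=; apply: eq_bigr => J _.
by rewrite /cell_moment /weight -big_split/=; apply: eq_bigr => i _; rewrite mulrC.
Qed.

(** Both sides are the sum over [J] of [coefficient] times [cell_moment]: the left one because the
    projection is a step function, the right one by expanding the monomial in the weights. *)
Lemma projection_moments (al : {ffun 'I_n -> nat}) m z : (\sum_(i < n) al i <= K)%N ->
  (\int[mu]_(x in dcube m z) (F x)%:E < +oo)%E ->
  (\int[mu]_(x in dcube m z) (monomial al x * projection u m z x)%:E =
   \int[mu]_(x in dcube m z) (monomial al x * u x)%:E)%E.
Proof.
move=> alK FD; have mD := measurable_dcube_space m z : measurable (dcube m z : set T).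
transitivity (\sum_J (coefficient u m z J * cell_moment al m z J)%:E)%E.
  transitivity (\int[mu]_(x in dcube m z) \sum_J
      ((coefficient u m z J)%:E * (monomial al x * \1_(subcell m z J) x)%:E))%E.
    apply: eq_integral => x _; rewrite /projection mulr_sumr -sumEFin.
    by apply: eq_bigr => J _; rewrite -EFinM; congr EFin; ring.
  rewrite integral_sum//; last first.
    move=> J; apply: integrableZl => //.
    by apply: (integrableS measurableT mD) => //; have [] := integral_monomial_subcell al m z J.
  apply: eq_bigr => J _; have [im Em] := integral_monomial_subcell al m z J.
  rewrite integralZl//; last exact: (integrableS measurableT mD).
  rewrite EFinM -Em; congr (_ * _)%E; rewrite [LHS]integral_mkcond.
  apply: eq_integral => x _; rewrite /patch; case: ifPn => // xD.
  rewrite indicE memNset ?mulr0// => /subcell_sub xz; move: xD.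
  by rewrite mem_set.
transitivity (\int[mu]_(x in dcube m z) \sum_J
    ((cell_moment al m z J)%:E * (u x * weight m z J x)%:E))%E; last first.
  apply: eq_integral => x _; rewrite -(monomial_reproduction m z x alK) mulr_suml -sumEFin.
  by apply: eq_bigr => J _; rewrite -EFinM; congr EFin; ring.
rewrite integral_sum//; last by move=> J; apply: integrableZl => //; exact: integrable_weight.
apply: eq_bigr => J _; have iw := integrable_weight J FD.
rewrite integralZl// mulrC EFinM; congr (_ * _)%E.
by rewrite /coefficient /Rintegral fineK//; exact: integrable_fin_num.
Qed.

End projection.

(** * Good parts *)

Section good_parts.
Context (R : realType) (n K : nat) (n0 : (0 < n)%N).
Local Notation V := 'rV[R]_n.
Local Notation T := (lebesgue_space R n).
Local Notation mu := (lebesgue R n).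
Local Notation idx := {ffun 'I_n -> int}.
Local Notation dcube := (@dcube R n).
Local Notation dcorner := (@dcorner R n).
Local Notation dvol := (@cell_volume R n).
Implicit Types (m : int) (z : idx) (x y c : V) (k : int).
Variables (w : 'I_K.+1 -> {poly R}) (W : R).
Hypothesis wE : forall P : {poly R}, (size P <= K.+2)%N ->
  deriv P = \sum_(i < K.+1) (P.[i.+1%:R] - P.[i%:R])%:P * w i.
Hypothesis wW : forall i (x : R), 0 <= x <= K.+1%:R -> `|(w i).[x]| <= W.
Hypothesis W0 : 0 <= W.
Variables (p q : R) (q1 : 1 < q) (qp : q <= p).
Variables (F : V -> R).
Hypotheses (mF : measurable_fun [set: T] F) (F0 : forall x, 0 <= F x).
Variables (A : R) (A0 : 0 < A) (FA : weak_bound p q A (EFin \o F)).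
(** Differentiation of averages gives this almost everywhere; it is required at every point because
    the atoms are to be bounded at every point. *)
Hypothesis F_le : forall k x, ~ hot_set F (2 ^ k) x -> F x <= 2 ^ k.

Let lam0 k : 0 < 2 ^ k :> R := exprz2_gt0 R k.

Lemma dcube_integral_lty m z : (\int[mu]_(x in dcube m z) (F x)%:E < +oo)%E.
Proof.
have mEF : measurable_fun [set: T] (EFin \o F) by exact/measurable_EFinP.
have EF0 x : (0 <= (EFin \o F) x)%E by rewrite lee_fin.
by apply: (le_lt_trans (weak_average_dcube q1 m z A0 mEF EF0 FA)); rewrite ltry.
Qed.

Lemma hot_le lam lam' m z : lam <= lam' -> hot F lam' m z -> hot F lam m z.
Proof. by move=> ll; apply: le_lt_trans; apply: lee_wpmul2r; rewrite ?lee_fin. Qed.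

(** The parent cube, of generation [m - 1] and of [2 ^+ n] times the volume, is not hot. *)
Lemma selected_average lam m z : 0 < lam -> selected F lam m z ->
  (\int[mu]_(x in dcube m z) (F x)%:E <= (2 ^+ n * lam * dvol m)%:E)%E.
Proof.
move=> l0 [_ /(_ (m - 1))]; rewrite ltrBlDr ltrDl => /(_ isT).
set z' := dcell _ _; rewrite /hot -leNgt.
have sub : dcube m z `<=` dcube (m - 1) z'.
  move=> x xz; rewrite -[z']/(dcell (m - 1) (dcorner m z)).
  apply: (@dcell_nest _ _ m); first by rewrite lerBlDr lerDl.
  by rewrite dcell_corner.
move=> h; apply: le_trans (le_trans _ h) _.
  apply: (ge0_subset_integral mu (measurable_dcube_space m z) (measurable_dcube_space (m - 1) z') _ _ sub).
  - by apply: measurable_funTS; apply/measurable_EFinP.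
  - by move=> x _; rewrite lee_fin.
rewrite lebesgue_dcube -EFinM lee_fin le_eqVlt; apply/orP; left; apply/eqP.
by rewrite opprB expfzDr// expr1z exprMn /cell_volume; ring.
Qed.

(* [xget] returns the junk value [0] off the hot set. *)
Definition stop_level k x : int := xget 0 [set m | selected F (2 ^ k) m (dcell m x)].

(** The function [u] is distinct from [F] because the real and the imaginary part are both
    decomposed along the cubes selected by the modulus. *)
Definition good_part (u : V -> R) k x : R :=
  if `[< hot_set F (2 ^ k) x >]
  then projection w u (stop_level k x) (dcell (stop_level k x) x) x else u x.

Lemma stop_levelE k m x : selected F (2 ^ k) m (dcell m x) -> stop_level k x = m.
Proof.
move=> sx; apply: (@disjoint_selected _ _ F (2 ^ k) x _ _ _ sx).
by apply: (xgetPex _ (P := [set m | selected F (2 ^ k) m (dcell m x)])); exists m.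
Qed.

Lemma good_part_selected u k m z x : selected F (2 ^ k) m z -> dcube m z x ->
  good_part u k x = projection w u m z x.
Proof.
move=> sz xz; have sx : selected F (2 ^ k) m (dcell m x) by rewrite xz.
rewrite /good_part; case: asboolP => [_|]; first by rewrite (stop_levelE sx) xz.
by case; exists m; case: sx.
Qed.

Lemma good_part_cold u k x : ~ hot_set F (2 ^ k) x -> good_part u k x = u x.
Proof. by move=> hx; rewrite /good_part; case: asboolP. Qed.

(** The 1 serves the cold points; the other summand is [projection_bound] with the average allowed
    by [selected_average]. *)
Definition part_const : R := 1 + (K.+1 ^ n)%:R * (W * K.+1%:R) ^+ n * 2 ^+ n.

Lemma part_const_ge1 : 1 <= part_const.
Proof. by rewrite lerDl !mulr_ge0// exprn_ge0// mulr_ge0. Qed.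

Variables (u : V -> R).
Hypotheses (mu_ : measurable_fun [set: T] u) (uF : forall x, `|u x| <= F x).

Lemma measurable_good_part k : measurable_fun [set: T] (good_part u k).
Proof.
have mH := measurable_hot_set F (2 ^ k).
rewrite -(setUv (hot_set F (2 ^ k))).
apply/measurable_funU => //; first exact: measurableC.
split; last first.
  have e : {in ~` hot_set F (2 ^ k), (u : T -> R) =1 good_part u k}.
    by move=> x; rewrite inE => hx; rewrite good_part_cold.
  exact: (@eq_measurable_fun _ _ T _ _ u _ e (measurable_funTS mu_)).
rewrite (hot_setE n0 q1 qp mF F0 A0 FA (lam0 k)) dunion_bigcup.
apply/measurable_fun_bigcup => [i|j]; first exact: measurable_family_seq.
rewrite /family_seq; case: (idx_decode _ j) => [[m z]|]; last exact: measurable_fun_set0.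
case: asboolP => [sz|_]; last exact: measurable_fun_set0.
have e : {in dcube m z, (projection w u m z : T -> R) =1 good_part u k}.
  by move=> x; rewrite inE => xz; rewrite (good_part_selected _ sz).
exact: (@eq_measurable_fun _ _ T _ _ _ _ e (measurable_funTS (measurable_projection _ _ _ _))).
Qed.

Lemma projection_selected_bound k m z x : selected F (2 ^ k) m z ->
  `|projection w u m z x| <= part_const * 2 ^ k.
Proof.
move=> sz; have := selected_average (lam0 k) sz.
have t0 : 0 <= 2 ^+ n * 2 ^ k :> R by rewrite mulr_ge0 ?exprn_ge0// ltW.
move=> /(projection_bound wW W0 mu_ mF uF x t0) /le_trans; apply.
by rewrite /part_const mulrDl mul1r mulrA lerDr ltW.
Qed.

Lemma good_part_bound k x : `|good_part u k x| <= part_const * 2 ^ k.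
Proof.
have [hx|hx] := pselect (hot_set F (2 ^ k) x); last first.
  rewrite good_part_cold//; apply: (le_trans (uF x)); apply: (le_trans (F_le hx)).
  by rewrite ler_peMl ?part_const_ge1// ltW.
have [m sm] := hot_selected n0 q1 qp mF F0 A0 FA (lam0 k) hx.
by rewrite (good_part_selected u sm erefl); exact: projection_selected_bound.
Qed.

Definition piece k m z x : R :=
  (good_part u (k + 1) x - projection w u m z x) * \1_(dcube m z) x.

Lemma measurable_piece k m z : measurable_fun [set: T] (piece k m z).
Proof.
apply: measurable_funM.
  apply: measurable_funB; first exact: measurable_good_part.
  exact: measurable_projection.
by apply: measurable_indic; exact: measurable_dcube_space.
Qed.

(** The good part at height [2 ^ (k + 1)] contributes 2 to the factor 3, the projection at height
    [2 ^ k] contributes 1. *)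
Lemma piece_bound k m z x : selected F (2 ^ k) m z ->
  `|piece k m z x| <= 3 * part_const * 2 ^ k * \1_(dcube m z) x.
Proof.
move=> sz; rewrite /piece normrM [`|\1_ _ _|]ger0_norm//.
apply: ler_wpM2r => //; apply: (le_trans (ler_normB _ _)).
have h1 := good_part_bound (k + 1) x; have h2 := projection_selected_bound x sz.
rewrite expfzDr// expr1z in h1.
by apply: (le_trans (lerD h1 h2)); lra.
Qed.

Lemma piece_difference k m x : selected F (2 ^ k) m (dcell m x) ->
  piece k m (dcell m x) x = good_part u (k + 1) x - good_part u k x.
Proof.
move=> sx; rewrite /piece indicE mem_set//= mulr1.
by rewrite (good_part_selected u sx erefl).
Qed.

Lemma monomial_bounded (al : {ffun 'I_n -> nat}) m z : exists M : R,
  forall x, dcube m z x -> `|monomial al x| <= M.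
Proof.
exists (\prod_(i < n) (`|dcenter R m z ord0 i| + 2 ^ (- m) / 2) ^+ al i) => x xz.
rewrite /monomial normr_prod; apply: ler_prod => i _; rewrite normr_ge0/= normrX.
have r0 : 0 <= 2 ^ (- m) / 2 :> R by rewrite divr_ge0// ltW.
rewrite lerXn2r ?nnegrE ?addr_ge0//.
have := dcube_sub_ccube xz i => h; rewrite -lerBlDl.
by apply: le_trans h; apply: (le_trans _ (lerB_dist _ _)).
Qed.

Lemma measurable_monomial (al : {ffun 'I_n -> nat}) : measurable_fun [set: T] (@monomial R n al).
Proof.
have mid : measurable_fun setT (idfun : T -> V).
  by move=> _ Y mY; rewrite setTI; exact: measurable_lebesgue_space.
apply: (measurableT_comp (measurable_tensor (h := fun i s => s ^+ al i) _) mid) => i.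
exact: exprn_measurable.
Qed.

(** The bound [F x + c] covers [u], the bounded functions and the differences of the two. *)
Lemma integrable_dominated_monomial (al : {ffun 'I_n -> nat}) (v : V -> R) (c : R) m z :
  measurable_fun [set: T] v -> 0 <= c -> (forall x, `|v x| <= F x + c) ->
  mu.-integrable (dcube m z) (EFin \o (fun x => monomial al x * v x)).
Proof.
move=> mv c0 vF; have mD := measurable_dcube_space m z : measurable (dcube m z : set T).
have [M hM] := monomial_bounded al m z.
have iv : mu.-integrable (dcube m z) (EFin \o v).
  apply: (integrable_of_bound (F := fun x => F x + c) mv _ vF mD).
    by apply: measurable_funD.
  under eq_integral do rewrite EFinD.
  have mFD : measurable_fun (dcube m z : set T) (EFin \o F).
    by apply: measurable_funTS; apply/measurable_EFinP.
  have F0' x : dcube m z x -> (0 <= (EFin \o F) x)%E by rewrite lee_fin.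
  have c0' x : dcube m z x -> (0 <= (cst c%:E : T -> \bar R) x)%E by rewrite lee_fin.
  rewrite (ge0_integralD mu mD F0' mFD c0' (measurable_cst _)) (integral_cst mu mD).
  rewrite lte_add_pinfty ?dcube_integral_lty//.
  by rewrite lebesgue_dcube -EFinM ltry.
have := integrableMl mD iv (h := monomial al) _ (bounded_by hM).
move=> /(_ (measurable_funTS (measurable_monomial al))).
apply: eq_integrable => // x _; by rewrite /= -EFinM mulrC.
Qed.

(** A cube that is hot at [2 ^ (k + 1)] is also hot at [2 ^ k], so it cannot strictly contain a cube
    selected at [2 ^ k]. *)
Lemma hot_set_nested k m z : selected F (2 ^ k) m z ->
  hot_set F (2 ^ (k + 1)) `&` dcube m z =
  dunion (fun m' z' => selected F (2 ^ (k + 1)) m' z' /\ dcube m' z' `<=` dcube m z).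
Proof.
move=> [_ cz]; apply/seteqP; split=> [x [hx xz]|x [m' [[hx _] sx]]]; last first.
  by split; [exists m'|apply: sx].
have [m' sx] := hot_selected n0 q1 qp mF F0 A0 FA (lam0 _) hx.
exists m'; split=> //; have mm : m <= m'.
  rewrite leNgt; apply/negP => mm; have /negP := cz m' mm; apply.
  rewrite (_ : dcell m' _ = dcell m' x); last first.
    by apply: (dcell_nest (ltW mm)); rewrite dcell_corner.
  case: sx => + _; apply: hot_le; rewrite ler_eXz2l ?ltr1n// lerDl//.
by move=> y /(dcell_nest mm); rewrite xz.
Qed.

(** Off the hot set at [2 ^ (k + 1)] the good part equals [u]; on each cube selected at that height
    inside [dcube m z] it is a projection of [u], with the same moments. *)
Lemma good_part_moments (al : {ffun 'I_n -> nat}) k m z : (\sum_(i < n) al i <= K)%N ->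
  selected F (2 ^ k) m z ->
  (\int[mu]_(x in dcube m z) (monomial al x * (good_part u (k + 1) x - u x))%:E = 0)%E.
Proof.
move=> alK sz; have mD := measurable_dcube_space m z : measurable (dcube m z : set T).
set g := fun x => _.
have ig m' z' : mu.-integrable (dcube m' z') g.
  apply: (@integrable_dominated_monomial _ _ (part_const * 2 ^ (k + 1))).
  - by apply: (measurable_funB (measurable_good_part _) mu_).
  - by rewrite mulr_ge0 ?(ltW (lam0 _))// (le_trans _ part_const_ge1).
  - by move=> x; rewrite [leRHS]addrC (le_trans (ler_normB _ _))// lerD// good_part_bound.
pose P m' z' := selected F (2 ^ (k + 1)) m' z' /\ dcube m' z' `<=` dcube m z.
have SE := hot_set_nested sz; rewrite -/P in SE.
have SD : dunion P `<=` dcube m z by rewrite -SE => x [].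
transitivity (\int[mu]_(x in dunion P) g x)%E.
  rewrite [LHS]integral_mkcond [RHS]integral_mkcond; apply: eq_integral => x _.
  rewrite /patch; case: ifPn => [|xD]; rewrite ?inE; last first.
    by rewrite memNset// => /SD xz; move: xD; rewrite mem_set.
  move=> xz; case: ifPn => //; rewrite -SE notin_setE => hx.
  rewrite /g good_part_cold ?subrr ?mulr0// => hx'; exact: hx.
apply: integral_dunion_eq0.
- by move=> x a b [sa _] [sb _]; exact: (disjoint_selected sa sb).
- by apply: (integrableS mD _ SD) => //; exact: measurable_dunion.
move=> m' z' [sz' _]; have mD' := measurable_dcube_space m' z' : measurable (dcube m' z' : set T).
have FD := dcube_integral_lty m' z'.
transitivity (\int[mu]_(x in dcube m' z') ((monomial al x * projection w u m' z' x)%:E -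
    (monomial al x * u x)%:E))%E.
  apply: eq_integral => x; rewrite inE => xz.
  by rewrite /g (good_part_selected u sz' xz) mulrBr EFinB.
have i1 : mu.-integrable (dcube m' z') (EFin \o (fun x => monomial al x * projection w u m' z' x)).
  apply: (@integrable_dominated_monomial _ _ (part_const * 2 ^ (k + 1))).
  - exact: measurable_projection.
  - by rewrite mulr_ge0 ?(ltW (lam0 _))// (le_trans _ part_const_ge1).
  - by move=> x; rewrite (le_trans (projection_selected_bound _ sz'))// lerDr.
have i2 : mu.-integrable (dcube m' z') (EFin \o (fun x => monomial al x * u x)).
  apply: (@integrable_dominated_monomial _ _ 0 _ _ mu_ (lexx _)).
  by move=> x; rewrite addr0.
have := integralB mD' i1 i2; rewrite /= => ->.
rewrite (projection_moments wE wW mu_ mF uF alK FD) subee//.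
exact: integrable_fin_num i2.
Qed.

(** Insert [u] between the good part and the projection: each of the two differences has vanishing
    moments on the cube. *)
Lemma piece_moments (al : {ffun 'I_n -> nat}) k m z : (\sum_(i < n) al i <= K)%N ->
  selected F (2 ^ k) m z ->
  (\int[mu]_x (monomial al x * piece k m z x)%:E = 0)%E.
Proof.
move=> alK sz; have mD := measurable_dcube_space m z : measurable (dcube m z : set T).
have FD := dcube_integral_lty m z.
have c0 : 0 <= part_const * 2 ^ (k + 1).
  by rewrite mulr_ge0 ?(ltW (lam0 _))// (le_trans _ part_const_ge1).
have c0' : 0 <= part_const * 2 ^ k.
  by rewrite mulr_ge0 ?(ltW (lam0 _))// (le_trans _ part_const_ge1).
have i1 : mu.-integrable (dcube m z) (EFin \o (fun x => monomial al x * (good_part u (k + 1) x - u x))).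
  apply: (@integrable_dominated_monomial _ _ (part_const * 2 ^ (k + 1))).
  - by apply: (measurable_funB (measurable_good_part _) mu_).
  - exact: c0.
  - by move=> x; rewrite [leRHS]addrC (le_trans (ler_normB _ _))// lerD// good_part_bound.
have i2 : mu.-integrable (dcube m z) (EFin \o (fun x => monomial al x * projection w u m z x)).
  apply: (@integrable_dominated_monomial _ _ (part_const * 2 ^ k)).
  - exact: measurable_projection.
  - exact: c0'.
  - by move=> x; rewrite (le_trans (projection_selected_bound _ sz))// lerDr.
have i3 : mu.-integrable (dcube m z) (EFin \o (fun x => monomial al x * u x)).
  apply: (@integrable_dominated_monomial _ _ 0 _ _ mu_ (lexx _)).
  by move=> x; rewrite addr0.
have i32 := integrableB mD i3 i2.
transitivity (\int[mu]_(x in dcube m z) ((monomial al x * (good_part u (k + 1) x - u x))%:E +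
    ((monomial al x * u x)%:E - (monomial al x * projection w u m z x)%:E)))%E.
  rewrite [RHS]integral_mkcond; apply: eq_integral => x _.
  rewrite /patch /piece indicE; case: ifPn => _; rewrite ?mulr0//.
  by rewrite mulr1 -EFinB -EFinD; congr EFin; ring.
have := integralD mD i1 i32; rewrite /= => ->.
rewrite (good_part_moments alK sz) add0e.
have := integralB mD i3 i2; rewrite /= => ->.
rewrite (projection_moments wE wW mu_ mF uF alK FD) subee//.
exact: integrable_fin_num i3.
Qed.

End good_parts.

(** * Rearrangement of geometrically decaying series *)

Section reindexed_series.
Context (R : realType).

(** Each [s i] is charged to the one index [J i], so that summing the double family [t] over [j]
    gives at most [s i]. *)
Lemma nneseries_le_reindex (a s : (\bar R)^nat) (J : nat -> nat) :
  (forall j, 0 <= a j)%E -> (forall i, 0 <= s i)%E ->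
  (forall j, a j = 0%E \/ exists2 i, J i = j & (a j <= s i)%E) ->
  (\sum_(j <oo) a j <= \sum_(i <oo) s i)%E.
Proof.
move=> a0 s0 aJ; pose t j i : \bar R := if J i == j then s i else 0%E.
have t0 j i : (0 <= t j i)%E by rewrite /t; case: ifP.
apply: lime_le; first by apply: is_cvg_nneseries => *; exact: a0.
apply: nearW => N; rewrite big_mkord.
apply: (@le_trans _ _ (\sum_(j < N) \sum_(i <oo) t j i)%E).
  apply: lee_sum => j _; have [->|[i Ji ai]] := aJ j; first exact: nneseries_ge0.
  apply: (le_trans ai); apply: (le_trans _ (nneseries_lim_ge i.+1 _)) => //.
  rewrite big_mkord big_ord_recr/= {2}/t Ji eqxx leeDr//.
  by apply: sume_ge0.
rewrite -(big_mkord xpredT (fun j => \sum_(i <oo) t j i)%E) -nneseries_sum//.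
apply: lee_nneseries => [i _ _|i _]; first by apply: sume_ge0.
rewrite big_mkord /t.
have [JN|JN] := ltnP (J i) N.
  rewrite (bigD1 (Ordinal JN))//= eqxx big1 ?adde0// => j /eqP jJ.
  by case: eqP => // Jj; case: jJ; apply: val_inj.
rewrite big1 // => j _; case: eqP => // Jj; move: JN; rewrite Jj leqNgt.
by rewrite ltn_ord.
Qed.

(** The atoms are enumerated by an encoding that ignores heights. At a given point the nonzero terms
    are, in some order, among the terms of a series with geometric decay, and its absolute
    convergence makes the order irrelevant. *)
Lemma reindexed_series_cvg (b h : R^nat) (J : nat -> nat) (B L : R) : injective J ->
  0 <= B ->
  (forall i, b (J i) = h i) -> (forall j, b j = 0 \/ exists i, J i = j) ->
  (forall i, `|h i| <= B * 2^-1 ^+ i) ->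
  \sum_(i < M) h i @[M --> \oo] --> L ->
  \sum_(j < N) b j @[N --> \oo] --> L.
Proof.
move=> Jinj B0 bJ b0 hB hL; apply/cvgrPdist_le => e e0.
have e2 : 0 < e / 2 by rewrite divr_gt0.
have [M [hM BM]] : exists M, `|L - \sum_(i < M) h i| <= e / 2 /\ B * 2^-1 ^+ M * 2 <= e / 2.
  have /cvgrPdist_le/(_ _ e2) hL' := hL.
  have gL : B * 2^-1 ^+ M * 2 @[M --> \oo] --> (0 : R).
    rewrite [X in _ --> X](_ : _ = B * 0 * 2); last by rewrite mulr0 mul0r.
    apply: cvgM; last exact: cvg_cst.
    apply: cvgM; first exact: cvg_cst.
    have := @cvg_expr R 2^-1; apply; rewrite ger0_norm ?invr_ge0//.
    by rewrite invf_lt1// ltr1n.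
  have /cvgrPdist_le/(_ _ e2) gL' := gL.
  have [M _ /(_ M (leqnn M)) [h1 h2]] := filterI hL' gL'.
  exists M; split=> //; move: h2; rewrite /= sub0r normrN ger0_norm//.
  by rewrite !mulr_ge0// exprn_ge0// invr_ge0.
pose N0 := (\max_(i < M) J i).+1.
exists N0 => // N /= N0N.
have JN i : (i < M)%N -> (J i < N)%N.
  move=> iM; apply: leq_trans N0N; rewrite ltnS.
  exact: (leq_bigmax (Ordinal iM)).
(* What is left of [b] once the first [M] terms of [h] are removed. Each nonzero value comes from
   some [i >= M], so the absolute values sum to at most a geometric tail. *)
pose r j := b j - \sum_(i < M) (if J i == j then h i else 0).
have rE : \sum_(j < N) r j = \sum_(j < N) b j - \sum_(i < M) h i.
  rewrite sumrB; congr (_ - _); rewrite exchange_big/=; apply: eq_bigr => i _.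
  rewrite (bigD1 (Ordinal (JN i (ltn_ord i))))//= eqxx big1 ?addr0// => j /eqP jJ.
  by case: eqP => // Jj; case: jJ; apply: val_inj.
have rB : \sum_(j < N) `|r j| <= B * 2^-1 ^+ M * 2.
  rewrite -lee_fin -sumEFin.
  pose s i : \bar R := (if (i < M)%N then 0 else B * 2^-1 ^+ i)%:E.
  have s0 i : (0 <= s i)%E.
    by rewrite /s; case: ifP => _; rewrite lee_fin// mulr_ge0// exprn_ge0// invr_ge0.
  apply: (@le_trans _ _ (\sum_(j <oo) `|r j|%:E)%E).
    apply: (le_trans _ (nneseries_lim_ge N _)); first by rewrite big_mkord.
    by move=> j _; rewrite lee_fin.
  apply: (@le_trans _ _ (\sum_(i <oo) s i)%E).
    apply: (nneseries_le_reindex (J := J)) => // j.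
    have [bj|[i Ji]] := b0 j.
      left; rewrite /r bj big1 ?subr0 ?normr0// => i _.
      by case: eqP => // Ji; rewrite -bJ Ji.
    have [iM|iM] := ltnP i M.
      left; rewrite /r (bigD1 (Ordinal iM))//= Ji eqxx -Ji bJ big1 ?addr0 ?subrr ?normr0//.
      move=> i' /eqP ii'; case: eqP => // /Jinj Ji'; case: ii'; exact: val_inj.
    right; exists i => //; rewrite /s ltnNge iM/= lee_fin /r big1 ?subr0.
      by rewrite -Ji bJ.
    move=> i' _; case: eqP => // Ji'; have ii' : val i' = i by apply: Jinj; rewrite Ji' Ji.
    by have := ltn_ord i'; rewrite -[X in (X < _)%N]/(val i') ii' ltnNge iM.
  rewrite (nneseries_split 0%N M)//=.
  rewrite add0n big_mkord big1 ?add0e; last by move=> i _; rewrite /s ltn_ord.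
  rewrite -nneseries_addn//.
  apply: (@le_trans _ _ (\sum_(i <oo) (B * 2^-1 ^+ M * 2^-1 ^+ i)%:E)%E).
    apply: lee_nneseries => [i _ _|i _]; first exact: s0.
    by rewrite /s ltnNge leq_addl/= lee_fin addnC exprD mulrA.
  apply: (le_trans (geometric_nneseries_le _ _)).
  - by rewrite mulr_ge0// exprn_ge0// invr_ge0.
  - by apply/andP; split; [rewrite invr_ge0|rewrite invf_lt1// ltr1n].
  - by rewrite lee_fin [X in _ / X](_ : _ = 2^-1) ?invrK//; lra.
rewrite (_ : L - _ = (L - \sum_(i < M) h i) - \sum_(j < N) r j); last by rewrite rE; ring.
rewrite (splitr e); apply: (le_trans (ler_normB _ _)); apply: lerD => //.
by apply: (le_trans (ler_norm_sum _ _ _)); apply: le_trans BM.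
Qed.

End reindexed_series.

(** * Complex-valued functions and tempered distributions *)

Section complex_modulus.
Context (R : realType).
Implicit Types (a b : R) (z : R[i]).

Lemma cmod_ge0 z : 0 <= cmod z. Proof. by case: z => a b; exact: sqrtr_ge0. Qed.

Lemma cmodM z1 z2 : cmod (z1 * z2) = cmod z1 * cmod z2.
Proof. exact: ComplexField.Normc.normcM. Qed.

Lemma cmod_real a : cmod a%:C%C = `|a|.
Proof. by rewrite /cmod /= expr0n/= addr0 sqrtr_sqr. Qed.

Lemma Re_le_cmod z : `|complex.Re z| <= cmod z.
Proof.
case: z => a b /=; rewrite -sqrtr_sqr ler_sqrt ?addr_ge0 ?sqr_ge0//.
by rewrite lerDl sqr_ge0.
Qed.

Lemma Im_le_cmod z : `|complex.Im z| <= cmod z.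
Proof.
case: z => a b /=; rewrite -sqrtr_sqr ler_sqrt ?addr_ge0 ?sqr_ge0//.
by rewrite lerDr sqr_ge0.
Qed.

Lemma cmod_le z : cmod z <= `|complex.Re z| + `|complex.Im z|.
Proof.
case: z => a b /=; rewrite -[leRHS]ger0_norm ?addr_ge0// -sqrtr_sqr.
rewrite ler_sqrt ?sqr_ge0// sqrrD !real_normK ?num_real//.
by rewrite -addrA lerD2l lerDr mulrn_wge0// mulr_ge0.
Qed.

Lemma ReMc z1 z2 : complex.Re (z1 * z2) =
  complex.Re z1 * complex.Re z2 - complex.Im z1 * complex.Im z2.
Proof. by case: z1 => a b; case: z2. Qed.

Lemma ImMc z1 z2 : complex.Im (z1 * z2) =
  complex.Re z1 * complex.Im z2 + complex.Im z1 * complex.Re z2.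
Proof. by case: z1 => a b; case: z2. Qed.

Lemma ReDc z1 z2 : complex.Re (z1 + z2) = complex.Re z1 + complex.Re z2.
Proof. by case: z1 => a b; case: z2. Qed.

Lemma ImDc z1 z2 : complex.Im (z1 + z2) = complex.Im z1 + complex.Im z2.
Proof. by case: z1 => a b; case: z2. Qed.

Lemma ReNc z : complex.Re (- z) = - complex.Re z. Proof. by case: z. Qed.
Lemma ImNc z : complex.Im (- z) = - complex.Im z. Proof. by case: z. Qed.

End complex_modulus.

Section complex_integral.
Context (R : realType) (n : nat).
Local Notation V := 'rV[R]_n.
Local Notation T := (lebesgue_space R n).
Local Notation mu := (lebesgue R n).
Implicit Types f g : V -> R[i].

Lemma L0M f g : L0 f -> L0 g -> L0 (fun x => f x * g x).
Proof.
move=> [f1 f2] [g1 g2]; split.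
  under eq_fun do rewrite ReMc.
  by apply: measurable_funB; apply: measurable_funM.
under eq_fun do rewrite ImMc.
by apply: measurable_funD; apply: measurable_funM.
Qed.

Lemma L0B f g : L0 f -> L0 g -> L0 (fun x => f x - g x).
Proof.
move=> [f1 f2] [g1 g2]; split.
  under eq_fun do rewrite ReDc ReNc.
  by apply: measurable_funB.
under eq_fun do rewrite ImDc ImNc.
by apply: measurable_funB.
Qed.

Lemma measurable_cmod f : L0 f -> measurable_fun [set: T] (fun x => cmod (f x)).
Proof.
move=> [f1 f2].
rewrite (_ : (fun x => _) = fun x => Num.sqrt (complex.Re (f x) ^+ 2 + complex.Im (f x) ^+ 2)).
  apply: (measurableT_comp (continuous_measurable_fun (@sqrt_continuous R))).
  by apply: measurable_funD; apply: measurable_funX.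
by apply/funext => x; rewrite /cmod; case: (f x).
Qed.

Lemma L1_dominated f (H : T -> \bar R) : L0 f -> measurable_fun setT H ->
  (forall x, (cmod (f x))%:E <= H x)%E -> (\int[mu]_x H x < +oo)%E -> L1 f.
Proof.
move=> f0 mH fH iH.
have key (h : T -> R) : measurable_fun setT h -> (forall x, `|h x| <= cmod (f x)) ->
    mu.-integrable setT (EFin \o h).
  move=> mh hf; apply/integrableP; split; first exact/measurable_EFinP.
  apply: le_lt_trans iH; apply: (ge0_le_integral mu measurableT).
  - by move=> x _; exact: abse_ge0.
  - by apply/measurable_EFinP; exact: measurableT_comp.
  - exact: mH.
  - by move=> x _; apply: le_trans (fH x); rewrite lee_fin.
case: f0 => f1 f2; split; apply: key => // x; [exact: Re_le_cmod|exact: Im_le_cmod].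
Qed.

Lemma L1_cmod f : L0 f -> L1 f -> mu.-integrable setT (fun x => (cmod (f x))%:E).
Proof.
move=> f0 [i1 i2].
have iS := integrableD measurableT (integrable_abse i1) (integrable_abse i2).
apply: (le_integrable measurableT _ _ iS).
  by apply/measurable_EFinP; exact: measurable_cmod.
move=> x _ /=; rewrite ger0_norm ?cmod_ge0// lee_fin ger0_norm ?addr_ge0//.
exact: cmod_le.
Qed.

(** The real and the imaginary part are bounded separately, at the price of the factor 2. *)
Lemma cmod_cintegral_le f : L0 f -> L1 f ->
  ((cmod (cintegral f))%:E <= 2%:E * \int[mu]_x (cmod (f x))%:E)%E.
Proof.
move=> f0 f1; have ic := L1_cmod f0 f1; have [i1 i2] := f1.
have mc : measurable_fun [set: T] (fun x => (cmod (f x))%:E).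
  by apply/measurable_EFinP; exact: measurable_cmod.
have h0 (h : T -> R) : mu.-integrable setT (EFin \o h) -> (forall x, `|h x| <= cmod (f x)) ->
    (`|\int[mu]_x h x|%:E <= \int[mu]_x (cmod (f x))%:E)%E.
  move=> ih hf; rewrite EFin_normr_Rintegral//.
  apply: (le_trans (le_abse_integral _ measurableT (measurable_int _ ih))).
  apply: (ge0_le_integral mu measurableT).
  - by move=> x _; exact: abse_ge0.
  - exact: measurableT_comp (measurable_int _ ih).
  - exact: mc.
  - by move=> x _; rewrite lee_fin.
apply: (@le_trans _ _ (`|\int[mu]_x complex.Re (f x)| + `|\int[mu]_x complex.Im (f x)|)%:E).
  by rewrite lee_fin; exact: cmod_le.
rewrite EFinD (_ : 2%:E * _ = \int[mu]_x (cmod (f x))%:E + \int[mu]_x (cmod (f x))%:E)%E.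
  by apply: leeD; apply: h0 => // x; [exact: Re_le_cmod|exact: Im_le_cmod].
by rewrite -[2]/(1 + 1)%R EFinD ge0_muleDl// mul1e.
Qed.

Lemma L1D f g : L1 f -> L1 g -> L1 (fun x => f x + g x).
Proof.
move=> [f1 f2] [g1 g2]; split.
  have := integrableD measurableT f1 g1; apply: eq_integrable => // x _.
  by rewrite ReDc EFinD.
have := integrableD measurableT f2 g2; apply: eq_integrable => // x _.
by rewrite ImDc EFinD.
Qed.

Lemma cintegralD f g : L1 f -> L1 g ->
  cintegral (fun x => f x + g x) = cintegral f + cintegral g.
Proof.
move=> [f1 f2] [g1 g2]; rewrite /cintegral; congr Complex.
  by under eq_Rintegral do rewrite ReDc; rewrite RintegralD.
by under eq_Rintegral do rewrite ImDc; rewrite RintegralD.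
Qed.

Lemma L1Z (c : R[i]) f : L1 f -> L1 (fun x => c * f x).
Proof.
move=> [f1 f2]; split.
  have := integrableB measurableT (integrableZl measurableT (complex.Re c) f1)
    (integrableZl measurableT (complex.Im c) f2); apply: eq_integrable => // x _.
  by rewrite ReMc EFinB !EFinM.
have := integrableD measurableT (integrableZl measurableT (complex.Re c) f2)
  (integrableZl measurableT (complex.Im c) f1); apply: eq_integrable => // x _.
by rewrite ImMc EFinD !EFinM.
Qed.

Lemma cintegralZ (c : R[i]) f : L1 f -> cintegral (fun x => c * f x) = c * cintegral f.
Proof.
move=> [f1 f2]; have Z (a : R) (h : T -> R) : mu.-integrable setT (EFin \o h) ->
    mu.-integrable setT (EFin \o (fun x => a * h x)).
  by move=> /(integrableZl measurableT a); apply: eq_integrable => // x _; rewrite /= EFinM.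
rewrite /cintegral; apply/eqP; rewrite eq_complex ReMc ImMc/=; apply/andP; split; apply/eqP.
  under eq_Rintegral do rewrite ReMc.
  rewrite RintegralB//; [|exact: Z|exact: Z].
  by rewrite !RintegralZl.
under eq_Rintegral do rewrite ImMc.
rewrite RintegralD//; [|exact: Z|exact: Z].
by rewrite !RintegralZl.
Qed.

Lemma cintegralB f g : L1 f -> L1 g ->
  cintegral (fun x => f x - g x) = cintegral f - cintegral g.
Proof.
move=> f1 g1; rewrite -mulN1r -cintegralZ// -cintegralD//; last exact: L1Z.
by congr cintegral; apply/funext => x; rewrite mulN1r.
Qed.

Lemma L1_0 : L1 (fun _ : V => 0).
Proof. by split; exact: integrable0. Qed.

Lemma cintegral0 : cintegral (fun _ : V => 0 : R[i]) = 0.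
Proof. by rewrite /cintegral !Rintegral_cst//= !mul0r. Qed.

Lemma L1_sum (g : nat -> V -> R[i]) N : (forall j, L1 (g j)) ->
  L1 (fun x => \sum_(j < N) g j x).
Proof.
move=> g1; elim: N => [|N IHN]; first by under eq_fun do rewrite big_ord0; exact: L1_0.
by under eq_fun do rewrite big_ord_recr/=; exact: L1D.
Qed.

Lemma cintegral_sum (g : nat -> V -> R[i]) N : (forall j, L1 (g j)) ->
  cintegral (fun x => \sum_(j < N) g j x) = \sum_(j < N) cintegral (g j).
Proof.
move=> g1; elim: N => [|N IHN].
  by rewrite big_ord0; under eq_fun do rewrite big_ord0; exact: cintegral0.
rewrite big_ord_recr/= -IHN -cintegralD//; last exact: L1_sum.
by congr cintegral; apply/funext => x; rewrite big_ord_recr.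
Qed.

End complex_integral.

(** * Pairing with Schwartz functions *)

Section schwartz_pairing.
Context (R : realType) (n : nat).
Local Notation V := 'rV[R]_n.
Local Notation T := (lebesgue_space R n).
Local Notation mu := (lebesgue R n).
Local Notation ccube := (@ccube R n).
Implicit Types (f phi : V -> R[i]) (x : V).

Lemma jbracket_ge1 x : 1 <= jbracket x.
Proof.
rewrite /jbracket -[leLHS]sqrtr1 ler_sqrt ?addr_ge0 ?sumr_ge0//.
  by rewrite lerDl sumr_ge0// => i _; exact: sqr_ge0.
by move=> i _; exact: sqr_ge0.
Qed.

Lemma jbracket_coord x i : `|x ord0 i| <= jbracket x.
Proof.
rewrite /jbracket -sqrtr_sqr ler_sqrt; last first.
  by rewrite addr_ge0// sumr_ge0// => j _; exact: sqr_ge0.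
rewrite (bigD1 i)//= addrCA lerDl addr_ge0// sumr_ge0// => j _; exact: sqr_ge0.
Qed.

Lemma measurable_jbracket : measurable_fun [set: T] (@jbracket R n).
Proof.
have mid : measurable_fun setT (idfun : T -> V).
  by move=> _ Y mY; rewrite setTI; exact: measurable_lebesgue_space.
apply: (measurableT_comp (continuous_measurable_fun (@sqrt_continuous R))).
apply: measurable_funD; first exact: measurable_cst.
elim: (index_enum _) => [|i s IHs].
  by under eq_fun do rewrite big_nil; exact: measurable_cst.
under eq_fun do rewrite big_cons.
apply: measurable_funD; last exact: IHs.
apply: measurable_funX.
exact: (measurableT_comp (@measurable_rVcoord R n i) mid).
Qed.

(** The exponent exceeds by one the bound [n] for the growth exponent of integrals of weak Morrey
    functions over cubes centred at the origin. *)
Definition decay x : R := (jbracket x ^+ n.+1)^-1.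

Lemma decay_ge0 x : 0 <= decay x.
Proof. by rewrite invr_ge0 exprn_ge0// (le_trans _ (jbracket_ge1 x)). Qed.

Lemma measurable_decay : measurable_fun [set: T] decay.
Proof.
have E : decay = (@powR R ^~ (- n.+1%:R)) \o @jbracket R n.
  apply/funext => x; rewrite /= powR_invn//; exact: le_trans ler01 (jbracket_ge1 x).
rewrite E; exact: (measurableT_comp (measurable_powR _) measurable_jbracket).
Qed.

(** Take the least [k] for which the cube of half side [2 ^+ k] contains [x]. If [k] is positive,
    some coordinate exceeds half of [2 ^+ k], and so does the bracket; if [k] is 0, the bracket is
    at least 1. *)
Lemma decay_le_layer x : exists k,
  decay x <= 2 ^+ n.+1 * (2 ^- k) ^+ n.+1 * \1_(ccube 0 (2 ^+ k)) x.
Proof.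
have ex : exists k : nat, `[< ccube 0 (2 ^+ k) x >].
  exists (Num.trunc (jbracket x)).+1; apply/asboolP => i; rewrite mxE subr0.
  apply: (le_trans (jbracket_coord x i)); apply: (le_trans (ltW (truncnS_gt _))).
  by rewrite -natrX ler_nat; exact/ltnW/ltn_expl.
case: (ex_minnP ex) => k /asboolP xk kmin.
exists k.
rewrite indicE mem_set// mulr1 -exprMn /decay -[leLHS]exprVn.
have j1 := jbracket_ge1 x; have j0 : 0 < jbracket x by rewrite (lt_le_trans _ j1).
rewrite lerXn2r ?nnegrE ?invr_ge0 ?(ltW j0)//.
case: k xk kmin => [|k] xk kmin.
  by rewrite expr0 invr1 mulr1 (le_trans (_ : _ <= 1))// ?invf_le1// ler1n.
have : ~ ccube 0 (2 ^+ k) x by move=> xk'; have := kmin k; rewrite ltnn => h; have := h (asboolT xk').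
move=> /existsNP[i /negP]; rewrite mxE subr0 -ltNge => xi.
rewrite exprS invfM mulrA mulfV// mul1r lef_pV2 ?posrE ?exprn_gt0//.
exact: le_trans (ltW xi) (jbracket_coord x i).
Qed.

(** On the cube of half side [2 ^+ k] the layer weight is of order [2 ^ (- k (n + 1))] and the
    integral of [g] at most of order [2 ^ (k n)], which leaves a geometric series of ratio 1/2. *)
Lemma weak_integral_decay (p q A : R) (g : T -> \bar R) : 1 < q -> q <= p -> 0 < A ->
  measurable_fun setT g -> (forall x, 0 <= g x)%E -> weak_bound p q A g ->
  (\int[mu]_x (g x * (decay x)%:E) < +oo)%E.
Proof.
move=> q1 qp A0 mg g0 gA.
pose c k : R := 2 ^+ n.+1 * (2 ^- k) ^+ n.+1.
have c0 k : 0 <= c k by rewrite !mulr_ge0 ?exprn_ge0// invr_ge0 exprn_ge0.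
have mQ k := measurable_ccube_space (0 : V) (2 ^+ k).
pose h k x : \bar R := (g x * (c k * \1_(ccube 0 (2 ^+ k)) x)%:E)%E.
have h0 k x : (0 <= h k x)%E by rewrite mule_ge0// lee_fin mulr_ge0.
have mh k : measurable_fun [set: T] (h k).
  apply: (emeasurable_funM mg); apply/measurable_EFinP.
  by apply: measurable_funM; [exact: measurable_cst|apply: measurable_indic].
apply: (@le_lt_trans _ _ (\int[mu]_x \sum_(k <oo) h k x)%E).
  apply: (ge0_le_integral mu measurableT).
  - by move=> x _; rewrite mule_ge0// lee_fin decay_ge0.
  - by apply: (emeasurable_funM mg); apply/measurable_EFinP; exact: measurable_decay.
  - by apply: ge0_emeasurable_sum => // k x _ _; exact: h0.
  - move=> x _; have [k dk] := decay_le_layer x.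
    apply: (@le_trans _ _ (h k x)); first by rewrite /h lee_wpmul2l// lee_fin.
    apply: (le_trans _ (nneseries_lim_ge k.+1 _)) => //.
    by rewrite big_mkord big_ord_recr/= leeDr// sume_ge0.
rewrite integral_nneseries//.
pose B := avg_const q * A * 2 ^+ n * 2 ^+ n.+1.
have B0 : 0 <= B by rewrite !mulr_ge0 ?exprn_ge0// ?(ltW A0)// ltW// avg_const_gt0.
apply: (@le_lt_trans _ _ (\sum_(k <oo) (B * 2^-1 ^+ k)%:E)%E); last first.
  apply: (le_lt_trans (geometric_nneseries_le B0 _)); last by rewrite ltry.
  by apply/andP; split; [rewrite invr_ge0|rewrite invf_lt1// ltr1n].
apply: lee_nneseries => [k _ _|k _]; first by apply: integral_ge0 => x _; exact: h0.
apply: (@le_trans _ _ ((c k)%:E * \int[mu]_(x in ccube 0 (2 ^+ k)) g x)%E).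
  have mgQ : measurable_fun [set: T] (g \_ (ccube 0 (2 ^+ k))).
    by apply/(measurable_restrictT _ (mQ k)); exact: measurable_funTS.
  have gQ0 x : [set: T] x -> (0 <= (g \_ (ccube 0 (2 ^+ k))) x)%E.
    by move=> _; apply: erestrict_ge0.
  have ck0 : (0 <= (c k)%:E)%E by rewrite lee_fin.
  rewrite [X in (_ <= _ * X)%E]integral_mkcond -(ge0_integralZl mu measurableT mgQ gQ0 ck0).
  apply: (ge0_le_integral mu measurableT).
  - by move=> x _; exact: h0.
  - exact: mh.
  - by apply: emeasurable_funM; [exact: measurable_cst|exact: mgQ].
  - move=> x _; rewrite /h /patch indicE; case: (x \in _).
      by rewrite mulr1 muleC.
    by rewrite mulr0 !mule0.
have r0 : 0 < 2 ^+ k :> R by rewrite exprn_gt0.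
apply: (@le_trans _ _ ((c k)%:E * (avg_const q * A * ((2 * 2 ^+ k) ^+ n) `^ (1 - p^-1))%:E)%E).
  by rewrite lee_wpmul2l ?lee_fin//; exact: weak_average_ccube.
rewrite -EFinM lee_fin.
have p0 : 0 < p by rewrite (lt_le_trans _ qp)// (lt_trans _ q1).
apply: (@le_trans _ _ (c k * (avg_const q * A * (2 * 2 ^+ k) ^+ n))).
  apply: ler_wpM2l => //; apply: ler_wpM2l.
    by rewrite mulr_ge0 ?(ltW A0)// ltW// avg_const_gt0.
  apply: ler1_powR; last by rewrite gerBl invr_ge0 ltW.
  by rewrite exprn_ege1// -exprS exprn_ege1// ler1n.
rewrite le_eqVlt; apply/orP; left; apply/eqP.
have e1 : 2 ^- k * 2 ^+ k = 1 :> R by rewrite mulVf// expf_neq0.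
have e2 : (2 ^- k) ^+ n * (2 ^+ k) ^+ n = 1 :> R by rewrite -exprMn e1 expr1n.
have e0 : 2^-1 ^+ k = 2 ^- k :> R by rewrite exprVn.
rewrite /c /B e0 exprMn [(2 ^- k) ^+ n.+1]exprS.
move: e2; set s := (2 ^- k) ^+ n; set r := (2 ^+ k) ^+ n => sr.
transitivity (avg_const q * A * 2 ^+ n * 2 ^+ n.+1 * 2 ^- k * (s * r)); first by ring.
by rewrite sr mulr1.
Qed.

Lemma schwartz_L0 phi : schwartz phi -> L0 phi.
Proof.
have mid : measurable_fun setT (idfun : T -> V).
  by move=> _ Y mY; rewrite setTI; exact: measurable_lebesgue_space.
case=> [s1 s2 _]; split.
  exact: (measurableT_comp (continuous_measurable_rV (s1 [::]).1) mid).
exact: (measurableT_comp (continuous_measurable_rV (s2 [::]).1) mid).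
Qed.

Lemma schwartz_decay phi x : schwartz phi ->
  cmod (phi x) <= fine (schwartz_seminorm n.+1 phi) * decay x.
Proof.
case=> [_ _ /(_ n.+1) sfin].
have sx : ((jbracket x ^+ n.+1 * cmod (phi x))%:E <= schwartz_seminorm n.+1 phi)%E.
  apply: ereal_sup_ubound; exists x, [::] => //=.
  by rewrite /cpartials /=; case: (phi x).
have j0 : 0 < jbracket x ^+ n.+1 by rewrite exprn_gt0// (lt_le_trans _ (jbracket_ge1 x)).
rewrite /decay ler_pdivlMr// mulrC -lee_fin fineK//.
rewrite ge0_fin_numE//; apply: le_trans sx.
by rewrite lee_fin mulr_ge0 ?cmod_ge0// ltW.
Qed.

(** The majorant [H] is extended-valued because it will contain the sum of the [lambda_j chi_(Q_j)],
    which may be infinite at some points. *)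
Variables (f : V -> R[i]) (H : T -> \bar R).
Hypotheses (f0 : L0 f) (mH : measurable_fun [set: T] H) (fH : forall x, ((cmod (f x))%:E <= H x)%E).
Hypothesis iH : (\int[mu]_x (H x * (decay x)%:E) < +oo)%E.

Let H0 x : (0 <= H x)%E.
Proof. by apply: le_trans (fH x); rewrite lee_fin cmod_ge0. Qed.

Let mHd : measurable_fun [set: T] (fun x => H x * (decay x)%:E)%E.
Proof. by apply: (emeasurable_funM mH); apply/measurable_EFinP; exact: measurable_decay. Qed.

Lemma pairing_dominated phi x : schwartz phi ->
  ((cmod (f x * phi x))%:E <=
   (fine (schwartz_seminorm n.+1 phi))%:E * (H x * (decay x)%:E))%E.
Proof.
move=> sphi; rewrite cmodM EFinM muleCA.
apply: lee_pmul; [by rewrite lee_fin cmod_ge0|by rewrite lee_fin cmod_ge0|exact: fH|].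
by rewrite -EFinM lee_fin; exact: schwartz_decay.
Qed.

Let seminorm_ge0 phi : (0 <= fine (schwartz_seminorm n.+1 phi)).
Proof.
apply: fine_ge0; apply: le_trans (ereal_sup_ubound _); last first.
  by exists 0, [::].
by rewrite lee_fin mulr_ge0 ?cmod_ge0// exprn_ge0// (le_trans _ (jbracket_ge1 0)).
Qed.

Lemma integral_dominated phi : (\int[mu]_x ((fine (schwartz_seminorm n.+1 phi))%:E *
    (H x * (decay x)%:E)) = (fine (schwartz_seminorm n.+1 phi))%:E *
  \int[mu]_x (H x * (decay x)%:E))%E.
Proof.
rewrite ge0_integralZl//; last by rewrite lee_fin.
by move=> x _; rewrite mule_ge0// lee_fin decay_ge0.
Qed.

Lemma pairing_L1 phi : schwartz phi -> L1 (fun x => f x * phi x).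
Proof.
move=> sphi; apply: (L1_dominated (H := fun x =>
  ((fine (schwartz_seminorm n.+1 phi))%:E * (H x * (decay x)%:E))%E)).
- exact: L0M f0 (schwartz_L0 sphi).
- by apply: emeasurable_funM; [exact: measurable_cst|exact: mHd].
- by move=> x; exact: pairing_dominated.
rewrite integral_dominated; apply: lte_mul_pinfty => //.
by rewrite lee_fin.
Qed.

(** A single seminorm suffices for continuity: the one of order [n + 1] bounds [phi] by a multiple
    of [decay]. *)
Lemma tempered_fun_dominated : tempered_fun f.
Proof.
split; first exact: pairing_L1.
split.
  move=> c phi psi sphi spsi; have i1 := pairing_L1 sphi; have i2 := pairing_L1 spsi.
  rewrite /pairing -cintegralZ// -cintegralD//; last exact: L1Z.
  by congr cintegral; apply/funext => x; rewrite mulrDr mulrCA.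
have I0 : (0 <= \int[mu]_x (H x * (decay x)%:E))%E.
  by apply: integral_ge0 => x _; rewrite mule_ge0// lee_fin decay_ge0.
exists n.+1, (2 * fine (\int[mu]_x (H x * (decay x)%:E))) => phi sphi.
have [_ _ sfin] := sphi.
have sn : schwartz_seminorm n.+1 phi \is a fin_num.
  rewrite ge0_fin_numE//; apply: le_trans (ereal_sup_ubound _); last by exists 0, [::].
  by rewrite lee_fin mulr_ge0 ?cmod_ge0// exprn_ge0// (le_trans _ (jbracket_ge1 0)).
have m1 := L0M f0 (schwartz_L0 sphi).
apply: (le_trans (cmod_cintegral_le m1 (pairing_L1 sphi))).
rewrite EFinM -muleA; apply: lee_wpmul2l; first by rewrite lee_fin.
rewrite fineK; last by rewrite ge0_fin_numE.
rewrite muleC -(fineK sn) -integral_dominated.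
apply: (ge0_le_integral mu measurableT).
- by move=> x _; rewrite lee_fin cmod_ge0.
- by apply/measurable_EFinP; exact: measurable_cmod.
- by apply: emeasurable_funM; [exact: measurable_cst|exact: mHd].
- by move=> x _; exact: pairing_dominated.
Qed.

End schwartz_pairing.

(** * The atoms *)

Section atoms.
Context (R : realType) (n K : nat) (n0 : (0 < n)%N).
Local Notation V := 'rV[R]_n.
Local Notation T := (lebesgue_space R n).
Local Notation mu := (lebesgue R n).
Local Notation idx := {ffun 'I_n -> int}.
Local Notation dcube := (@dcube R n).
Local Notation ccube := (@ccube R n).
Local Notation dcenter := (@dcenter R n).
Implicit Types (m : int) (z : idx) (x y c : V) (k : int).
Variables (w : 'I_K.+1 -> {poly R}) (W : R).
Hypothesis wE : forall P : {poly R}, (size P <= K.+2)%N ->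
  deriv P = \sum_(i < K.+1) (P.[i.+1%:R] - P.[i%:R])%:P * w i.
Hypothesis wW : forall i (x : R), 0 <= x <= K.+1%:R -> `|(w i).[x]| <= W.
Hypothesis W0 : 0 <= W.
Variables (p q : R) (q1 : 1 < q) (qp : q <= p).
Variables (g : V -> R[i]) (g0 : L0 g).
Let F x : R := cmod (g x).
Variables (A : R) (A0 : 0 < A) (FA : weak_bound p q A (EFin \o F)).
Hypothesis F_le : forall k x, ~ hot_set F (2 ^ k) x -> F x <= 2 ^ k.

Let mF : measurable_fun [set: T] F. Proof. exact: measurable_cmod. Qed.
Let F0 x : 0 <= F x. Proof. exact: cmod_ge0. Qed.
Let lam0 k : 0 < 2 ^ k :> R := exprz2_gt0 R k.
Let uR (x : V) : R := complex.Re (g x).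
Let uI (x : V) : R := complex.Im (g x).
Let uRF x : `|uR x| <= F x. Proof. exact: Re_le_cmod. Qed.
Let uIF x : `|uI x| <= F x. Proof. exact: Im_le_cmod. Qed.
Let muR : measurable_fun [set: T] uR. Proof. by case: g0. Qed.
Let muI : measurable_fun [set: T] uI. Proof. by case: g0. Qed.

(** Heights, generations and cells are enumerated together. An index that encodes no selected cube
    yields the zero atom with coefficient 0 and an arbitrary cube. *)
Definition item (j : nat) : option (int * int * idx) :=
  if idx_decode (int * int * idx)%type j is Some (k, m, z) then
    (if `[< selected F (2 ^ k) m z >] then Some (k, m, z) else None)
  else None.

Lemma itemP j k m z : item j = Some (k, m, z) <->
  selected F (2 ^ k) m z /\ j = idx_code (k, m, z).
Proof.
rewrite /item; split=> [|[sz ->]]; last by rewrite idx_codeK; case: asboolP.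
case E : (idx_decode _ j) => [[[k' m'] z']|//]; case: asboolP => // sz [<- <- <-].
by split=> //; exact: idx_decodeK E.
Qed.

(* A piece is at most [3 * part_const * 2 ^ k], and there are a real and an imaginary
   part. *)
Definition atom_const : R := 6 * part_const n K W.

Lemma atom_const_gt0 : 0 < atom_const.
Proof. by rewrite mulr_gt0// (lt_le_trans _ (part_const_ge1 n K W0)). Qed.

Definition atom_coef j : R := if item j is Some (k, m, z) then atom_const * 2 ^ k else 0.

Definition atom_cube j : set V :=
  if item j is Some (k, m, z) then ccube (dcenter m z) (2 ^ (- m) / 2) else ccube 0 1.

Definition cpiece k m z x : R[i] := Complex (piece w F uR k m z x) (piece w F uI k m z x).

Definition atom j x : R[i] :=
  if item j is Some (k, m, z) then ((atom_const * 2 ^ k)^-1)%:C%C * cpiece k m z x else 0.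

Lemma atom_coef_ge0 j : 0 <= atom_coef j.
Proof.
rewrite /atom_coef; case: (item j) => [[[k m] z]|//].
by rewrite mulr_ge0// ltW// atom_const_gt0.
Qed.

Lemma cube_atom_cube j : cube (atom_cube j).
Proof.
rewrite /atom_cube; case: (item j) => [[[k m] z]|].
  by exists (dcenter m z), (2 ^ (- m) / 2) => //; rewrite divr_gt0.
by exists 0, 1.
Qed.

Lemma L0_cpiece k m z : L0 (cpiece k m z).
Proof.
split.
  exact: (measurable_piece n0 w q1 qp mF F0 A0 FA muR).
exact: (measurable_piece n0 w q1 qp mF F0 A0 FA muI).
Qed.

Lemma L0_cst (a : R[i]) : L0 (fun _ : V => a).
Proof. by split; exact: measurable_cst. Qed.

Lemma L0_atom j : L0 (atom j).
Proof.
rewrite /atom; case: (item j) => [[[k m] z]|]; last exact: L0_cst.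
exact: L0M (L0_cst _) (L0_cpiece _ _ _).
Qed.

Lemma cpiece_bound k m z x : selected F (2 ^ k) m z ->
  cmod (cpiece k m z x) <= atom_const * 2 ^ k * \1_(dcube m z) x.
Proof.
move=> sz; apply: (le_trans (cmod_le _)) => /=.
have h1 := piece_bound n0 wW W0 q1 qp mF F0 A0 FA F_le muR uRF x sz.
have h2 := piece_bound n0 wW W0 q1 qp mF F0 A0 FA F_le muI uIF x sz.
apply: (le_trans (lerD h1 h2)); rewrite -!mulrDl /atom_const.
by rewrite (_ : 6 = 3 + 3 :> R)//; ring.
Qed.

Lemma atom_coefM j x : (atom_coef j)%:C%C * atom j x =
  if item j is Some (k, m, z) then cpiece k m z x else 0.
Proof.
rewrite /atom_coef /atom; case: (item j) => [[[k m] z]|]; last by rewrite mulr0.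
rewrite mulrA -rmorphM/= mulfV ?rmorph1 ?mul1r//.
by rewrite gt_eqF// mulr_gt0// atom_const_gt0.
Qed.

Lemma atom_bound_dcube j k m z x : item j = Some (k, m, z) ->
  cmod (atom j x) <= \1_(dcube m z) x.
Proof.
move=> ij; have /itemP[sz _] := ij.
have a0 : 0 < atom_const * 2 ^ k by rewrite mulr_gt0// atom_const_gt0.
rewrite /atom ij cmodM cmod_real ger0_norm ?invr_ge0 ?(ltW a0)//.
by rewrite ler_pdivrMl//; exact: cpiece_bound.
Qed.

Lemma atom_bound j x : cmod (atom j x) <= \1_(atom_cube j) x.
Proof.
case ij : (item j) => [[[k m] z]|].
  apply: (le_trans (atom_bound_dcube x ij)); rewrite /atom_cube ij !indicE ler_nat.
  have [xz|xz] := boolP (x \in dcube m z) => //.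
  by rewrite mem_set//; apply: dcube_sub_ccube; move: xz; rewrite inE.
rewrite /atom ij (_ : cmod 0 = 0)//.
by rewrite /cmod /= expr0n/= addr0 sqrtr0.
Qed.

Lemma Linfty_atom j : Linfty (atom j).
Proof.
split; first exact: L0_atom.
rewrite unlock; case: ifP => _ //=.
apply: (@le_lt_trans _ _ 1%E); last by rewrite ltry.
apply: (ess_sup_ler mu (f := fun x => `|cmod (atom j x)|)) => x.
rewrite lee_fin ger0_norm ?cmod_ge0//; apply: (le_trans (atom_bound j x)).
by rewrite indicE; case: (_ \in _).
Qed.

Lemma jbracket_bounded m z : exists2 M : R, 0 <= M & forall x, dcube m z x -> jbracket x <= M.
Proof.
exists (Num.sqrt (1 + \sum_(i < n) (`|dcenter m z ord0 i| + 2 ^ (- m) / 2) ^+ 2)).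
  exact: sqrtr_ge0.
move=> x xz; rewrite ler_sqrt; last first.
  by rewrite addr_ge0// sumr_ge0// => i _; rewrite sqr_ge0.
rewrite lerD2l; apply: ler_sum => i _; rewrite -real_normK ?num_real//.
have r0 : 0 <= 2 ^ (- m) / 2 :> R by rewrite divr_ge0// ltW.
rewrite lerXn2r ?nnegrE ?addr_ge0//.
have := dcube_sub_ccube xz i => h; rewrite -lerBlDl.
by apply: le_trans h; apply: (le_trans _ (lerB_dist _ _)).
Qed.

(** An atom is bounded and lives on one cube, which gives the weighted integrability. Monomials and
    normalising factors are real, so the moment conditions separate into those of the real and the
    imaginary piece. *)
Lemma Pperp_atom j : Pperp K (atom j).
Proof.
split; first exact: L0_atom.
  case ij : (item j) => [[[k m] z]|]; last first.
    rewrite /atom ij; under eq_fun do rewrite mulr0; exact: L1_0.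
  have [M M0 hM] := jbracket_bounded m z.
  have mD := measurable_dcube_space m z : measurable (dcube m z : set T).
  apply: (L1_dominated (H := fun x => ((M ^+ K)%:E * (\1_(dcube m z) x)%:E)%E)).
  - apply: L0M; last exact: L0_atom.
    split; last exact: measurable_cst.
    by apply: measurable_funX; exact: measurable_jbracket.
  - apply: emeasurable_funM; first exact: measurable_cst.
    by apply/measurable_EFinP; exact: measurable_indic.
  - move=> x; rewrite -EFinM lee_fin cmodM cmod_real.
    have h := atom_bound_dcube x ij; move: h; rewrite indicE.
    have [xz|xz] := boolP (x \in dcube m z); rewrite /= ?mulr1 ?mulr0 => h.
      have j0 : 0 <= jbracket x by rewrite (le_trans _ (jbracket_ge1 x)).
      rewrite -[leRHS]mulr1; apply: ler_pM => //; first exact: cmod_ge0.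
      rewrite ger0_norm ?exprn_ge0//; apply: lerXn2r; rewrite ?nnegrE//.
      by apply: hM; move: xz; rewrite inE.
    have -> : cmod (atom j x) = 0 by apply/eqP; rewrite eq_le h cmod_ge0.
    by rewrite mulr0.
  have m1 : measurable_fun [set: T] (EFin \o (\1_(dcube m z) : T -> R)).
    by apply/measurable_EFinP; exact: measurable_indic.
  have i0 x : [set: T] x -> (0 <= (EFin \o (\1_(dcube m z) : T -> R)) x)%E by rewrite lee_fin.
  rewrite (ge0_integralZl mu measurableT m1 i0); last by rewrite lee_fin exprn_ge0.
  by rewrite integral_indic// setIT lebesgue_dcube -EFinM ltry.
move=> al alK; case ij : (item j) => [[[k m] z]|]; last first.
  rewrite /atom ij; under eq_fun do rewrite mulr0; exact: cintegral0.
have /itemP[sz _] := ij.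
have Z (u : V -> R) (c : R) : (\int[mu]_x (monomial al x * piece w F u k m z x)%:E = 0)%E ->
    mu.-integrable setT (EFin \o (fun x => monomial al x * piece w F u k m z x)) ->
    \int[mu]_x (monomial al x * (c * piece w F u k m z x)) = 0.
  move=> E i; transitivity (\int[mu]_x (c * (monomial al x * piece w F u k m z x))).
    by apply: eq_Rintegral => x _; rewrite mulrCA.
  by rewrite RintegralZl// /Rintegral E mulr0.
have I (u : V -> R) : measurable_fun [set: T] u -> (forall x, `|u x| <= F x) ->
    mu.-integrable setT (EFin \o (fun x => monomial al x * piece w F u k m z x)).
  move=> mu_ uF.
  have mD := measurable_dcube_space m z : measurable (dcube m z : set T).
  have c0 : 0 <= 3 * part_const n K W * 2 ^ k.
    by rewrite mulr_ge0 ?(ltW (lam0 _))// mulr_ge0// (le_trans _ (part_const_ge1 n K W0)).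
  have b x : `|piece w F u k m z x| <= F x + 3 * part_const n K W * 2 ^ k.
    apply: (le_trans (piece_bound n0 wW W0 q1 qp mF F0 A0 FA F_le mu_ uF x sz)).
    rewrite indicE; case: (_ \in _); rewrite ?mulr1 ?mulr0 ?lerDr//.
    by rewrite addr_ge0.
  have := integrable_dominated_monomial q1 mF F0 A0 FA al m z
    (measurable_piece n0 w q1 qp mF F0 A0 FA mu_ k m z) c0 b.
  move/(iffLR (integrable_mkcond _ mD)); apply: eq_integrable => // x _.
  rewrite /= /patch; case: ifPn => //= xz.
  by rewrite /piece /= indicE (negbTE xz) !mulr0.
rewrite /cintegral; apply/eqP; rewrite eq_complex/=; apply/andP; split; apply/eqP.
  rewrite -[RHS](Z uR ((atom_const * 2 ^ k)^-1)).
  - apply: eq_Rintegral => x _; rewrite /atom ij.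
    by rewrite !ReMc !ImMc/= !mul0r !subr0.
  - exact: (piece_moments n0 wE wW W0 q1 qp mF F0 A0 FA F_le muR uRF alK sz).
  - exact: I.
rewrite -[RHS](Z uI ((atom_const * 2 ^ k)^-1)).
- apply: eq_Rintegral => x _; rewrite /atom ij.
  by rewrite !ImMc/= !mul0r !addr0.
- exact: (piece_moments n0 wE wW W0 q1 qp mF F0 A0 FA F_le muI uIF alK sz).
- exact: I.
Qed.

End atoms.

(** * Size of the atomic sum and pointwise convergence *)

Section atomic_sum.
Context (R : realType) (n K : nat) (n0 : (0 < n)%N).
Local Notation V := 'rV[R]_n.
Local Notation T := (lebesgue_space R n).
Local Notation mu := (lebesgue R n).
Local Notation idx := {ffun 'I_n -> int}.
Local Notation dcube := (@dcube R n).
Local Notation ccube := (@ccube R n).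
Implicit Types (m : int) (z : idx) (x y c : V) (k : int).
Variables (w : 'I_K.+1 -> {poly R}) (W : R).
Hypothesis wE : forall P : {poly R}, (size P <= K.+2)%N ->
  deriv P = \sum_(i < K.+1) (P.[i.+1%:R] - P.[i%:R])%:P * w i.
Hypothesis wW : forall i (x : R), 0 <= x <= K.+1%:R -> `|(w i).[x]| <= W.
Hypothesis W0 : 0 <= W.
Variables (p q : R) (q1 : 1 < q) (qp : q <= p).
Variables (g : V -> R[i]) (g0 : L0 g).
Let F x : R := cmod (g x).
Variables (A : R) (A0 : 0 < A) (FA : weak_bound p q A (EFin \o F)).
Hypothesis F_le : forall k x, ~ hot_set F (2 ^ k) x -> F x <= 2 ^ k.

Let mF : measurable_fun [set: T] F. Proof. exact: measurable_cmod. Qed.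
Let F0 x : 0 <= F x. Proof. exact: cmod_ge0. Qed.
Let lam0 k : 0 < 2 ^ k :> R := exprz2_gt0 R k.

Local Notation coef := (atom_coef K W g).
Local Notation ac := (atom_const n K W).
Let ac0 : 0 < ac. Proof. exact: atom_const_gt0. Qed.

(* At a point that is cold at height [2 ^ k0], the only indices that contribute are the
   [level_code k0 x i]. *)
Definition level_code (k0 : int) x (i : nat) : nat :=
  let k := k0 - 1 - i%:Z in
  idx_code (k, stop_level F k x, dcell (stop_level F k x) x).

Lemma level_code_inj k0 x : injective (level_code k0 x).
Proof.
move=> i i' /idx_code_inj [] /eqP; rewrite (inj_eq (addrI _)) eqr_opp => /eqP [] //.
Qed.

Lemma selected_level_code k0 k m x : ~ hot_set F (2 ^ k0) x ->
  selected F (2 ^ k) m (dcell m x) ->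
  exists2 i : nat, k = k0 - 1 - i%:Z & level_code k0 x i = idx_code (k, m, dcell m x).
Proof.
move=> hx sx; have kk0 : k < k0.
  rewrite ltNge; apply/negP => k0k; apply: hx; exists m.
  by case: sx => + _; apply: hot_le; rewrite ler_eXz2l ?ltr1n.
have e : k = k0 - 1 - `|(k0 - 1 - k)%R|%N%:Z.
  rewrite gez0_abs; last by rewrite subr_ge0 lerBrDr lezD1.
  by rewrite opprB addrC subrK.
exists `|(k0 - 1 - k)%R|%N => //; rewrite /level_code -e.
by rewrite (stop_levelE sx).
Qed.

(** The [v]-quasi-norm of the sequence 1/2, 1/4, 1/8, ... of the heights below [2 ^ k0], relative to
    [2 ^ k0]. *)
Definition sum_const (v : R) : R := (2 `^ (- v) / (1 - 2 `^ (- v))) `^ v^-1.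

Lemma powR2N_lt1 (v : R) : 0 < v -> 0 < (2 : R) `^ (- v) < 1.
Proof.
move=> v0; rewrite powR_gt0//= -[ltRHS](powRr0 (2 : R)) /powR pnatr_eq0/= ltr_expR.
by rewrite ltr_pM2r ?ln_gt0// ?ltr1n// oppr_lt0.
Qed.

Lemma sum_const_gt0 (v : R) : 0 < v -> 0 < sum_const v.
Proof.
by move=> v0; have /andP[h1 h2] := powR2N_lt1 v0; rewrite powR_gt0// divr_gt0// subr_gt0.
Qed.

Lemma powR_dyadic (a v : R) (i : nat) : 0 <= a ->
  (a * 2^-1 ^+ i.+1) `^ v = a `^ v * 2 `^ (- v) * (2 `^ (- v)) ^+ i.
Proof.
move=> a0; rewrite powRM ?exprn_ge0 ?invr_ge0// -mulrA -exprS; congr (_ * _).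
elim: i.+1 => [|k IHk]; first by rewrite !expr0 powR1.
rewrite !exprS -IHk powRM ?exprn_ge0 ?invr_ge0//; congr (_ * _).
by rewrite -powR_inv1// -powRrM mulN1r.
Qed.

Definition atomic_sum (v : R) x : \bar R :=
  (\sum_(0 <= j <oo) ((coef j * \1_(atom_cube g j) x) `^ v)%:E)%E.

(** Off the grid, a closed cube [atom_cube g j] with nonzero coefficient contains [x] only if its
    dyadic cube does, and at each height at most one selected cube contains [x]. *)
Lemma atomic_sum_le (v : R) k0 x : 0 < v -> ~ dyadic_grid x ->
  ~ hot_set F (2 ^ k0) x ->
  (atomic_sum v x <= ((ac * 2 ^ k0 * sum_const v) `^ v)%:E)%E.
Proof.
move=> v0 gx hx; have v1 : v != 0 by rewrite gt_eqF.
have /andP[t0 t1] := powR2N_lt1 v0.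
pose s i : \bar R := ((ac * 2 ^ (k0 - 1 - i%:Z)) `^ v)%:E.
apply: (@le_trans _ _ (\sum_(i <oo) s i)%E).
  apply: (nneseries_le_reindex (J := level_code k0 x)).
  - by move=> j; rewrite lee_fin powR_ge0.
  - by move=> i; rewrite lee_fin powR_ge0.
  move=> j; case ij : (item g j) => [[[k m] z]|]; last first.
    by left; rewrite /atom_coef ij mul0r powR0.
  rewrite /atom_coef /atom_cube ij indicE.
  have [xQ|xQ] := boolP (x \in _); last by left; rewrite mulr0 powR0.
  right; have /itemP[sz jE] := ij.
  have xz : dcube m z x.
    apply: ccube_dcube; first by move: xQ; rewrite inE.
    move=> i; apply/eqP => xi; apply: gx; exists (m, z i + 1, i) => //=.
    by rewrite xi intrD.
  have sx : selected F (2 ^ k) m (dcell m x) by rewrite xz.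
  have [i ki Ji] := selected_level_code hx sx.
  exists i; first by rewrite Ji jE xz.
  by rewrite /s -ki mulr1.
have b0 : 0 <= ac * 2 ^ k0 := mulr_ge0 (ltW ac0) (ltW (lam0 k0)).
have E i : s i = ((ac * 2 ^ k0) `^ v * 2 `^ (- v) * (2 `^ (- v)) ^+ i)%:E.
  rewrite /s; congr EFin; rewrite -powR_dyadic//; congr (_ `^ v).
  by rewrite -mulrA; congr (ac * _); rewrite -addrA -opprD expfzDr// -exprnN exprVn.
under eq_eseriesr do rewrite E.
have g1 : 0 <= (ac * 2 ^ k0) `^ v * 2 `^ (- v) := mulr_ge0 (powR_ge0 _ _) (powR_ge0 _ _).
have g2 : 0 <= 2 `^ (- v) < 1 by rewrite t1 powR_ge0.
apply: (le_trans (geometric_nneseries_le g1 g2)); rewrite lee_fin.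
have f0 : 0 <= 2 `^ (- v) / (1 - 2 `^ (- v)) by rewrite divr_ge0 ?powR_ge0// subr_ge0 ltW.
rewrite (powRM v b0 (ltW (sum_const_gt0 v0))) /sum_const -powRrM mulVf// (powRr1 f0).
by rewrite mulrA.
Qed.

(** The factor 2 pays for rounding the height to a power of two, [ac * sum_const v] for passing from
    the height to the size of the sum, and the last factor for the measure of the hot set. *)
Definition bound_const (v : R) : R :=
  2 * ac * sum_const v * (hot_ccube_const n q) `^ q^-1.

Lemma bound_const_gt0 (v : R) : 0 < v -> 0 < bound_const v.
Proof.
move=> v0; have h := powR_gt0 q^-1 (hot_ccube_const_gt0 n q1).
exact: (mulr_gt0 (mulr_gt0 (mulr_gt0 (ltr0Sn R 1) ac0) (sum_const_gt0 v0)) h).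
Qed.

Lemma measurable_atomic_sum (v : R) : measurable_fun [set: T] (atomic_sum v).
Proof.
apply: ge0_emeasurable_sum => [j x _ _|j _]; first by rewrite lee_fin powR_ge0.
apply/measurable_EFinP; apply: (measurableT_comp (measurable_powR _)).
apply: measurable_funM; first exact: measurable_cst.
apply: measurable_indic; rewrite /atom_cube.
by case: (item g j) => [[[k m] z]|]; exact: measurable_ccube_space.
Qed.

Lemma weak_bound_atomic_sum (v : R) : 0 < v ->
  weak_bound p q (bound_const v * A) (fun x => atomic_sum v x `^ v^-1)%E.
Proof.
move=> v0 c r l r0 l0; have q0 : 0 < q by rewrite (lt_trans _ q1).
have vi0 : 0 < v^-1 by rewrite invr_gt0.
set D := ac * sum_const v; have D0 : 0 < D by rewrite mulr_gt0 ?sum_const_gt0.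
have lD : 0 < l / D by rewrite divr_gt0.
(* The largest power of two not exceeding [l / D]: off the grid and off the hot set at this height
   the sum is at most [D * 2 ^ k0 <= l]. *)
have [k0 /andP[kl kl']] := dyadic_bracket lD.
have [B [mB B0 gB]] := negligible_dyadic_grid R n.
have mS : measurable_fun [set: T] (fun x => atomic_sum v x `^ v^-1)%E.
  exact: (measurableT_comp (measurable_poweR _) (measurable_atomic_sum v)).
have mQ : measurable (ccube c r : set T) := measurable_ccube_space c r.
have mH := measurable_hot_set F (2 ^ k0).
have mQH : measurable (ccube c r `&` hot_set F (2 ^ k0) : set T) by exact: measurableI.
apply: (@le_trans _ _ (mu ((ccube c r `&` hot_set F (2 ^ k0)) `|` B))).
  rewrite le_measure ?inE.
  - by [].
  - by apply: measurableI => //; exact: measurable_superlevel.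
  - exact: measurableU.
  move=> x [xQ lx]; have [gx|gx] := pselect (dyadic_grid x); [by right; exact: gB|left].
  split=> //; apply: contrapT => hx.
  have := atomic_sum_le v0 gx hx => h.
  have S0 : (0 <= atomic_sum v x)%E by apply: nneseries_ge0 => j _ _; rewrite lee_fin powR_ge0.
  move: lx; rewrite /= ltNge => /negP; apply.
  apply: (@le_trans _ _ ((((ac * 2 ^ k0 * sum_const v) `^ v)%:E) `^ v^-1)%E).
    by apply: gt0_ler_poweR => //; rewrite ?ltW// in_itv/= ?leey ?andbT// lee_fin powR_ge0.
  have X0 : 0 <= ac * 2 ^ k0 * sum_const v.
    exact: (mulr_ge0 (mulr_ge0 (ltW ac0) (ltW (lam0 k0))) (ltW (sum_const_gt0 v0))).
  rewrite poweR_EFin lee_fin -powRrM mulfV ?gt_eqF// powRr1//.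
  by rewrite mulrAC -/D mulrC -ler_pdivlMr.
apply: (le_trans (measureU2 _ _ _)) => //; rewrite [X in (_ + X)%E](_ : _ = 0%E)// adde0.
apply: (le_trans (hot_set_ccube n0 q1 qp mF F0 A0 FA c (lam0 k0) r0)).
rewrite lee_fin mulrA; apply: ler_wpM2r; first exact: powR_ge0.
have hc0 := hot_ccube_const_gt0 n q1.
have -> : hot_ccube_const n q = ((hot_ccube_const n q) `^ q^-1) `^ q.
  by rewrite -powRrM mulVf ?gt_eqF// powRr1// ltW.
rewrite -powRM ?powR_ge0//; last by rewrite divr_ge0 ?ltW.
rewrite ge0_ler_powR ?nnegrE ?(ltW q0)//.
- by rewrite mulr_ge0 ?powR_ge0// divr_ge0 ?ltW.
- by rewrite divr_ge0 ?(ltW l0)// mulr_ge0 ?(ltW A0)// ltW// bound_const_gt0.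
rewrite /bound_const.
have -> : 2 * ac * sum_const v * hot_ccube_const n q `^ q^-1 * A / l =
  (hot_ccube_const n q) `^ q^-1 * (A * (2 * D / l)) by rewrite /D; ring.
apply: ler_wpM2l; first exact: powR_ge0.
apply: ler_wpM2l; first exact: ltW.
have D2 : 0 < 2 * D := mulr_gt0 (ltr0Sn R 1) D0.
rewrite -[(2 * D / l)]invrK lef_pV2 ?posrE ?invr_gt0 ?(divr_gt0 D2 l0)//.
rewrite invf_div ler_pdivrMr//; move: kl'; rewrite expfzDr// expr1z ltr_pdivrMr//.
by move/ltW; rewrite -mulrA.
Qed.

(** Starting from a cold height [2 ^ k0], where the good part is [u x], the differences telescope
    downwards. After [M] steps the remainder is the good part at height [2 ^ (k0 - M)], which tends
    to 0 with its bound. *)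
Lemma good_part_tendsto (u : V -> R) x : measurable_fun [set: T] u ->
  (forall x, `|u x| <= F x) -> ~ (\bigcap_(k : nat) hot_set F (2 ^+ k)) x ->
  \sum_(j < N) (if item g j is Some (k, m, z) then piece w F u k m z x else 0)
    @[N --> \oo] --> u x.
Proof.
move=> mu_ uF hx; have [k0 hx0] : exists k0 : int, ~ hot_set F (2 ^ k0) x.
  apply: contrapT => h; apply: hx => k _; apply: contrapT => hk; apply: h.
  by exists k%:Z.
pose kk (i : nat) : int := k0 - 1 - i%:Z.
pose h i := good_part w F u (kk i + 1) x - good_part w F u (kk i) x.
pose b j := if item g j is Some (k, m, z) then piece w F u k m z x else 0.
have gb k := good_part_bound n0 wW W0 q1 qp mF F0 A0 FA F_le mu_ uF k x.
have pc0 : 0 <= part_const n K W by rewrite (le_trans _ (part_const_ge1 n K W0)).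
have kS i : kk i + 1 = k0 - i%:Z by rewrite /kk addrAC subrK.
apply: (@reindexed_series_cvg _ b h (level_code k0 x) (3 * part_const n K W * 2 ^ (k0 - 1))).
- exact: level_code_inj.
- by rewrite mulr_ge0 ?(ltW (lam0 _))// mulr_ge0.
- move=> i; rewrite /b.
  have [hk|hk] := pselect (hot_set F (2 ^ (kk i)) x).
    have [m sx] := hot_selected n0 q1 qp mF F0 A0 FA (lam0 _) hk.
    have E : item g (level_code k0 x i) = Some (kk i, m, dcell m x).
      by apply/itemP; split=> //; rewrite /level_code -/(kk i) (stop_levelE sx).
    by rewrite E (piece_difference w u sx).
  have hk' : ~ hot_set F (2 ^ (kk i + 1)) x.
    move=> [m hm]; apply: hk; exists m; apply: hot_le hm.
    by rewrite ler_eXz2l ?ltr1n// lerDl.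
  rewrite /h !good_part_cold// subrr.
  (* At a cold height the code is formed with the junk stopping level, and it encodes no selected
     cube, since such a cube would make [x] hot. *)
  case E : (item g _) => [[[k m] z]|//]; have /itemP[sz] := E.
  move=> /idx_code_inj [ek em ez]; exfalso; apply: hk; exists m.
  by case: sz => + _; rewrite -ek -ez -em.
- move=> j; rewrite /b; case ij : (item g j) => [[[k m] z]|]; last by left.
  have [xz|xz] := pselect (dcube m z x); last first.
    by left; rewrite /piece indicE memNset// mulr0.
  right; have /itemP[sz jE] := ij.
  have sx : selected F (2 ^ k) m (dcell m x) by rewrite xz.
  have [i _ Ji] := selected_level_code hx0 sx.
  by exists i; rewrite Ji jE xz.
- move=> i; apply: (le_trans (ler_normB _ _)).
  apply: (le_trans (lerD (gb _) (gb _))).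
  have -> : 2 ^ (kk i + 1) = 2 * 2 ^ (kk i) :> R by rewrite expfzDr// expr1z mulrC.
  have -> : 2 ^ (kk i) = 2 ^ (k0 - 1) * 2^-1 ^+ i :> R.
    by rewrite /kk expfzDr// -exprnN exprVn.
  by rewrite le_eqVlt; apply/orP; left; apply/eqP; ring.
have kkS M : kk M = k0 - M.+1%:Z by rewrite /kk -addn1 PoszD opprD addrA addrAC.
have hE M : \sum_(i < M) h i = u x - good_part w F u (k0 - M%:Z) x.
  rewrite -(good_part_cold w u hx0).
  elim: M => [|M IHM]; first by rewrite big_ord0 subr0 subrr.
  by rewrite big_ord_recr/= IHM /h kS kkS subrKA.
rewrite (_ : (fun M => \sum_(i < M) h i) = fun M : nat => u x - good_part w F u (k0 - M%:Z) x); last first.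
  by apply/funext => M; exact: hE.
suff h0 : good_part w F u (k0 - M%:Z) x @[M --> \oo] --> 0.
  by have := cvgB (cvg_cst (u x)) h0; rewrite subr0; apply.
apply: (@norm_cvg0 _ R^o).
apply: (@squeeze_cvgr _ _ _ _ (fun=> 0) (fun M : nat => part_const n K W * 2 ^ k0 * 2^-1 ^+ M)).
- apply: nearW => M; rewrite normr_ge0/=.
  apply: (le_trans (gb _)); rewrite expfzDr// -exprnN exprVn.
  by rewrite mulrA.
- exact: cvg_cst.
rewrite [X in _ --> X](_ : _ = part_const n K W * 2 ^ k0 * 0); last by rewrite mulr0.
apply: cvgM; first exact: cvg_cst.
have := @cvg_expr R 2^-1; apply; rewrite ger0_norm ?invr_ge0//.
by rewrite invf_lt1// ltr1n.
Qed.

End atomic_sum.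

(** * Dominated convergence in the space of tempered distributions *)

Section tempered_sum_dominated.
Context (R : realType) (n : nat).
Local Notation V := 'rV[R]_n.
Local Notation T := (lebesgue_space R n).
Local Notation mu := (lebesgue R n).

Lemma L0_sum (u : nat -> V -> R[i]) N : (forall j, L0 (u j)) ->
  L0 (fun x => \sum_(j < N) u j x).
Proof.
move=> u0; elim: N => [|N IHN].
  by rewrite (_ : (fun _ => _) = fun=> 0); [exact: L0_cst|apply/funext => x; rewrite big_ord0].
rewrite (_ : (fun _ => _) = fun x => \sum_(j < N) u j x - (0 - u N x)).
  exact: (L0B IHN (L0B (@L0_cst R n 0) (u0 N))).
by apply/funext => x; rewrite big_ord_recr/= sub0r opprK.
Qed.

Variables (u : nat -> V -> R[i]) (f : V -> R[i]) (H : T -> \bar R).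
Hypotheses (f0 : L0 f) (u0 : forall j, L0 (u j)) (mH : measurable_fun [set: T] H).
Hypotheses (fH : forall x, ((cmod (f x))%:E <= H x)%E).
Hypotheses (uH : forall j x, ((cmod (u j x))%:E <= H x)%E).
Hypotheses (rH : forall N x, ((cmod (f x - \sum_(j < N) u j x))%:E <= H x)%E).
Hypothesis iH : (\int[mu]_x (H x * (decay x)%:E) < +oo)%E.
Variable B : set V.
Hypothesis B0 : mu.-negligible (B : set T).
Hypothesis cvB : forall x, ~ B x ->
  cmod (f x - \sum_(j < N) u j x) @[N --> \oo] --> (0 : R).

(** For fixed [phi], the remainders times [phi] are dominated by a multiple of [H x * decay x] and
    tend to 0 off [B]; hence the integrals of their moduli tend to 0, and these control the
    pairings. *)
Lemma tempered_sum_dominated : tempered_sum u f.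
Proof.
have Lr N := L0B f0 (L0_sum N u0).
split; [exact: tempered_fun_dominated f0 mH fH iH| |] => [j|phi sphi].
  exact: tempered_fun_dominated (u0 j) mH (uH j) iH.
have Lp := schwartz_L0 sphi.
pose h N x := (f x - \sum_(j < N) u j x) * phi x.
have Lh N : L0 (h N) := L0M (Lr N) Lp.
have h1 N : L1 (h N) := pairing_L1 (Lr N) mH (rH N) iH sphi.
have E N : pairing f phi - \sum_(j < N) pairing (u j) phi = cintegral (h N).
  have u1 j : L1 (fun x => u j x * phi x) := pairing_L1 (u0 j) mH (uH j) iH sphi.
  rewrite -(cintegral_sum (g := fun j x => u j x * phi x) N u1) -cintegralB; last 2 first.
  - exact: (pairing_L1 f0 mH fH iH sphi).
  - exact: (L1_sum (g := fun j x => u j x * phi x) N u1).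
  by congr cintegral; apply/funext => x; rewrite /h mulrBl mulr_suml.
pose I N := (\int[mu]_x (cmod (h N x))%:E)%E.
have mh N : measurable_fun [set: T] (fun x => (cmod (h N x))%:E).
  by apply/measurable_EFinP; exact: measurable_cmod.
pose D x := ((fine (schwartz_seminorm n.+1 phi))%:E * (H x * (decay x)%:E))%E.
have hD N x : ((cmod (h N x))%:E <= D x)%E := pairing_dominated (rH N) x sphi.
have D0 x : (0 <= D x)%E by apply: (le_trans _ (hD 0%N x)); rewrite lee_fin cmod_ge0.
have H0 x : (0 <= H x)%E by apply: (le_trans _ (fH x)); rewrite lee_fin cmod_ge0.
have mHd : measurable_fun [set: T] (fun x => H x * (decay x)%:E)%E.
  by apply: (emeasurable_funM mH); apply/measurable_EFinP; exact: measurable_decay.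
have mD : measurable_fun [set: T] D.
  by apply: emeasurable_funM; [exact: measurable_cst|exact: mHd].
have iD : mu.-integrable [set: T] D.
  apply/integrableP; split; first exact: mD.
  under eq_integral do rewrite (gee0_abs (D0 _)).
  rewrite (integral_dominated mH fH); apply: lte_mul_pinfty; [|by []|exact: iH].
  rewrite lee_fin; apply: fine_ge0; apply: le_trans (ereal_sup_ubound _); last first.
    by exists 0, [::].
  by rewrite lee_fin mulr_ge0 ?cmod_ge0// exprn_ge0// (le_trans _ (jbracket_ge1 0)).
have I0 : I N @[N --> \oo] --> 0%E.
  have aecv : \forall x \ae mu, [set: T] x -> (cmod (h N x))%:E @[N --> \oo] --> (cst 0%E : T -> \bar R) x.
    apply: negligibleS B0 => x /=; apply: contra_notP => nB _.
    apply: cvg_EFin; first exact: nearW.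
    have h0 : cmod (f x - \sum_(j < N) u j x) * cmod (phi x) @[N --> \oo] --> (0 : R).
      by rewrite -[X in _ --> X](mul0r (cmod (phi x))); apply: cvgM (cvg_cst _); exact: cvB.
    have -> : fine \o (fun N => (cmod (h N x))%:E) =
        fun N => cmod (f x - \sum_(j < N) u j x) * cmod (phi x).
      by apply/funext => N; exact: cmodM.
    exact: h0.
  have aeb : \forall x \ae mu, forall N : nat, [set: T] x -> (`|(cmod (h N x))%:E| <= D x)%E.
    by apply: aeW => x N _; rewrite gee0_abs ?hD// lee_fin cmod_ge0.
  have [_ _] := dominated_convergence measurableT mh (measurable_cst _) aecv iD aeb.
  by rewrite integral0.
have I20 : (2%:E * I N)%E @[N --> \oo] --> 0%E.
  by rewrite -(mule0 2%:E); apply: cvgeZl.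
under eq_fun do rewrite E.
have : (cmod (cintegral (h N)))%:E @[N --> \oo] --> 0%E.
  apply: squeeze_cvge (cvg_cst 0%E) I20; apply: nearW => N.
  by rewrite lee_fin cmod_ge0/= cmod_cintegral_le.
by move/fine_cvg; apply.
Qed.

End tempered_sum_dominated.

(** * Removal of a null set *)

Section exceptional_set.
Context (R : realType) (n : nat).
Local Notation V := 'rV[R]_n.
Local Notation T := (lebesgue_space R n).
Local Notation mu := (lebesgue R n).
Implicit Types (F G : V -> R) (B : set V).

Lemma hot_set_ae_eq F G B lam : mu.-negligible (B : set T) ->
  measurable_fun [set: T] F -> measurable_fun [set: T] G ->
  (forall x, ~ B x -> F x = G x) -> hot_set F lam = hot_set G lam.
Proof.
move=> B0 mF mG FG; have E m z : hot F lam m z = hot G lam m z.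
  rewrite /hot; congr (_ < _)%E; apply: ae_eq_integral.
  - exact: measurable_dcube_space.
  - by apply/measurable_EFinP; apply: measurable_funTS.
  - by apply/measurable_EFinP; apply: measurable_funTS.
  by apply: negligibleS B0 => x /=; apply: contra_notP => nB _; rewrite FG.
by apply/seteqP; split=> x [m hm]; exists m; move: hm; rewrite E.
Qed.

(** The heights [2 ^ k] are countably many, so the exceptional sets of [ae_le_of_dyadic_averages]
    fit into one measurable null set. *)
Lemma le_off_hot_set F : measurable_fun [set: T] F -> (forall x, 0 <= F x) ->
  exists B : set T, [/\ measurable B, mu B = 0%E &
    forall (k : int) x, ~ B x -> ~ hot_set F (2 ^ k) x -> F x <= 2 ^ k].
Proof.
move=> mF F0.
pose N (k : int) : set T := [set x | 2 ^ k < F x /\ ~ hot_set F (2 ^ k) x].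
have N0 k : mu.-negligible (N k).
  apply/negligibleP.
    apply: measurableD; last exact: measurable_hot_set.
    have mEF : measurable_fun [set: T] (EFin \o F) by exact/measurable_EFinP.
    have := measurable_superlevel (2 ^ k) mEF.
    by congr measurable; apply/seteqP; split=> x /=; rewrite lte_fin.
  rewrite -[RHS](ae_le_of_dyadic_averages (exprz2_gt0 R k) mF F0); congr (mu _).
  apply/seteqP; split=> x [Fx h]; split=> //.
    by move=> m; rewrite leNgt; apply/negP => hm; apply: h; exists m.
  by move=> [m hm]; have := h m; rewrite leNgt => /negP; apply.
have : mu.-negligible (\bigcup_j (if idx_decode int j is Some k then N k else set0)).
  apply: negligible_bigcup => j; case: (idx_decode _ j) => [k|]; first exact: N0.
  exact: negligible_set0.
move=> [B [mB B0 sB]]; exists B; split=> // k x nB nh; rewrite leNgt; apply/negP => Fx.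
by apply: nB; apply: sB; exists (idx_code k) => //; rewrite idx_codeK.
Qed.

Lemma weak_morrey_norm_ge0 (p q : R) (g : V -> \bar R) : (0 <= weak_morrey_norm p q g)%E.
Proof.
apply: le_trans (ereal_sup_ubound _); last by exists 1; [exact: ltr01|].
rewrite mul1e; apply: le_trans (ereal_sup_ubound _); last first.
  by exists (ccube 0 1) => //; exists 0, 1.
by rewrite mule_ge0 ?poweR_ge0// Lnorm_ge0.
Qed.

End exceptional_set.

Section decomposition.
Context (R : realType) (n K : nat) (n0 : (0 < n)%N).
Local Notation V := 'rV[R]_n.
Local Notation T := (lebesgue_space R n).
Local Notation mu := (lebesgue R n).
Variables (w : 'I_K.+1 -> {poly R}) (W : R).
Hypothesis wE : forall P : {poly R}, (size P <= K.+2)%N ->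
  deriv P = \sum_(i < K.+1) (P.[i.+1%:R] - P.[i%:R])%:P * w i.
Hypothesis wW : forall i (x : R), 0 <= x <= K.+1%:R -> `|(w i).[x]| <= W.
Hypothesis W0 : 0 <= W.
Variables (p q : R) (q1 : 1 < q) (qp : q <= p).

Lemma cmod_sum (u : nat -> R[i]) N : cmod (\sum_(j < N) u j) <= \sum_(j < N) cmod (u j).
Proof.
elim: N => [|N IHN]; first by rewrite !big_ord0 (cmod_real 0) normr0.
by rewrite !big_ord_recr/=; apply: (le_trans (le_normcD _ _)); rewrite lerD2r.
Qed.

Section decomposition_of.
Variables (g : V -> R[i]) (g0 : L0 g).
Let F x : R := cmod (g x).
Variables (A : R) (A0 : 0 < A) (FA : weak_bound p q A (EFin \o F)).
Hypothesis F_le : forall k x, ~ hot_set F (2 ^ k) x -> F x <= 2 ^ k.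
Local Notation coef := (atom_coef K W g).
Local Notation u := (fun j x => (coef j)%:C%C * atom w W g j x).

Lemma atom_term_le j x : cmod (u j x) <= coef j * \1_(atom_cube g j) x.
Proof.
rewrite cmodM cmod_real ger0_norm ?atom_coef_ge0//.
by rewrite ler_wpM2l ?atom_coef_ge0// (atom_bound n0 wW W0 q1 qp g0 A0 FA F_le).
Qed.

Lemma partial_sum_le N x :
  ((\sum_(j < N) cmod (u j x))%:E <= atomic_sum K W g 1 x)%E.
Proof.
have cI j : 0 <= coef j * \1_(atom_cube g j) x by rewrite mulr_ge0 ?atom_coef_ge0.
apply: le_trans (nneseries_lim_ge N _); last by move=> j _ _; rewrite lee_fin powR_ge0.
rewrite big_mkord sumEFin lee_fin; apply: ler_sum => j _.
by rewrite powRr1// atom_term_le.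
Qed.

Lemma atomic_series_cvg x : ~ (\bigcap_(k : nat) hot_set F (2 ^+ k)) x ->
  cmod (g x - \sum_(j < N) u j x) @[N --> \oo] --> (0 : R).
Proof.
move=> hx.
have [mR mI] := g0.
have cR := good_part_tendsto n0 wW W0 q1 qp g0 A0 FA F_le mR (fun x => Re_le_cmod (g x)) hx.
have cI := good_part_tendsto n0 wW W0 q1 qp g0 A0 FA F_le mI (fun x => Im_le_cmod (g x)) hx.
have eR N : complex.Re (\sum_(j < N) u j x) = \sum_(j < N)
    (if item g j is Some (k, m, z) then piece w F (fun x => complex.Re (g x)) k m z x else 0).
  elim: N => [|N IHN]; first by rewrite !big_ord0.
  rewrite !big_ord_recr/= ReDc IHN atom_coefM//.
  by case: (item g N) => [[[k m] z]|].
have eI N : complex.Im (\sum_(j < N) u j x) = \sum_(j < N)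
    (if item g j is Some (k, m, z) then piece w F (fun x => complex.Im (g x)) k m z x else 0).
  elim: N => [|N IHN]; first by rewrite !big_ord0.
  rewrite !big_ord_recr/= ImDc IHN atom_coefM//.
  by case: (item g N) => [[[k m] z]|].
have key (s : nat -> R) l : s @ \oo --> l -> `|l - s N| @[N --> \oo] --> (0 : R).
  move=> sl; have : `|l - s N| @[N --> \oo] --> `|l - l|.
    by apply: cvg_norm; apply: cvgB sl; exact: cvg_cst.
  by rewrite subrr normr0.
have cR' : complex.Re (\sum_(j < N) u j x) @[N --> \oo] --> complex.Re (g x).
  by under eq_fun do rewrite eR; exact: cR.
have cI' : complex.Im (\sum_(j < N) u j x) @[N --> \oo] --> complex.Im (g x).
  by under eq_fun do rewrite eI; exact: cI.
have d0 : `|complex.Re (g x) - complex.Re (\sum_(j < N) u j x)| +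
    `|complex.Im (g x) - complex.Im (\sum_(j < N) u j x)| @[N --> \oo] --> (0 : R).
  by rewrite -[X in _ --> X]addr0; exact: (cvgD (key _ _ cR') (key _ _ cI')).
apply: squeeze_cvgr (cvg_cst 0) d0; apply: nearW => N; rewrite cmod_ge0/=.
by apply: (le_trans (cmod_le _)); rewrite ReDc ImDc ReNc ImNc.
Qed.

End decomposition_of.

Lemma atomic_decomposition (f : V -> R[i]) : weak_morrey p q f ->
  exists (lam : nat -> R) (Q : nat -> set V) (a : nat -> V -> R[i]),
    [/\ forall j, 0 <= lam j,
        forall j, cube (Q j),
        forall j, Linfty (a j) /\ Pperp K (a j),
        tempered_sum (fun j x => (lam j)%:C%C * a j x) f &
        (forall j x, cmod (a j x) <= \1_(Q j) x) /\
        forall v : R, 0 < v ->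
          (weak_morrey_norm p q
             (fun x => (\sum_(0 <= j <oo)
                ((lam j * \1_(Q j) x) `^ v)%:E) `^ v^-1)
           <= (bound_const n K W q v)%:E * weak_morrey_norm p q (cabs f))%E].
Proof.
move=> [f0 fA]; pose F x := cmod (f x).
have mF : measurable_fun [set: T] F := measurable_cmod f0.
have F0 x : 0 <= F x by exact: cmod_ge0.
have mcf : measurable_fun [set: T] (cabs f) by exact/measurable_EFinP.
pose a0 := fine (weak_morrey_norm p q (cabs f)).
have a0E : weak_morrey_norm p q (cabs f) = a0%:E.
  by rewrite /a0 fineK// ge0_fin_numE// weak_morrey_norm_ge0.
have a00 : 0 <= a0 by rewrite fine_ge0// weak_morrey_norm_ge0.
have FA A : a0 <= A -> weak_bound p q A (EFin \o F).
  move=> a0A; have := weak_bound_of_norm (p := p) q1 (le_trans a00 a0A) mcf.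
  rewrite a0E lee_fin => /(_ a0A); congr weak_bound.
  by apply/funext => x; rewrite gee0_abs// lee_fin; exact: F0.
have [B [mB B0 hB]] := le_off_hot_set mF F0.
have nB : mu.-negligible B by apply/negligibleP.
(* Vanishing on [B] leaves all averages, hence all hot sets, unchanged, and makes the bound at cold
   points hold everywhere. *)
pose g x : R[i] := (\1_(~` B) x : R)%:C%C * f x.
have gf x : ~ B x -> g x = f x by move=> nBx; rewrite /g indicE mem_set// mul1r.
have gB x : B x -> g x = 0.
  by move=> Bx; rewrite /g indicE memNset ?mul0r//; exact.
have i0 : L0 (fun x : V => (\1_(~` B) x : R)%:C%C).
  by split; [apply: measurable_indic; exact: measurableC|exact: measurable_cst].
have g0 : L0 g := L0M i0 f0.
pose G x := cmod (g x).
have mG : measurable_fun [set: T] G := measurable_cmod g0.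
have G0 x : 0 <= G x by exact: cmod_ge0.
have GB x : B x -> G x = 0 by move=> Bx; rewrite /G gB// (cmod_real 0) normr0.
have GF x : G x <= F x.
  by have [/GB ->|/gf] := pselect (B x); [exact: F0|rewrite /G => ->].
have G_le k x : ~ hot_set G (2 ^ k) x -> G x <= 2 ^ k.
  rewrite (hot_set_ae_eq (G := F) _ nB mG mF); last by move=> y /gf; rewrite /G => ->.
  have [/GB -> _|nBx hx] := pselect (B x); first by rewrite ltW ?exprz2_gt0.
  exact: le_trans (GF x) (hB _ _ nBx hx).
have GA A : a0 <= A -> weak_bound p q A (EFin \o G).
  move=> /FA h c r l r0 l0; apply: le_trans (h c r l r0 l0).
  have mQ : measurable (ccube c r : set T) := measurable_ccube_space c r.
  rewrite le_measure ?inE.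
  - by [].
  - by apply: measurableI => //; apply: measurable_superlevel; exact/measurable_EFinP.
  - by apply: measurableI => //; apply: measurable_superlevel; exact/measurable_EFinP.
  by move=> x [xQ /= lx]; split=> //=; rewrite lte_fin in lx *; exact: lt_le_trans (GF x).
(* The added 1 keeps the constant positive when the norm is 0. Its value is immaterial, as it serves
   only conclusions in which it does not appear. *)
have A0 : 0 < a0 + 1 by rewrite ltr_wpDl.
have FA1 : weak_bound p q (a0 + 1) (EFin \o F) by apply: FA; rewrite lerDl.
have GA1 : weak_bound p q (a0 + 1) (EFin \o G) by apply: GA; rewrite lerDl.
exists (atom_coef K W g), (atom_cube g), (atom w W g); split.
- by move=> j; exact: atom_coef_ge0.
- by move=> j; exact: cube_atom_cube.
- move=> j; split; first exact: (Linfty_atom n0 wW W0 q1 qp g0 A0 GA1 G_le).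
  exact: (Pperp_atom n0 wE wW W0 q1 qp g0 A0 GA1 G_le).
- pose S := atomic_sum K W g 1.
  have mS : measurable_fun [set: T] S := measurable_atomic_sum K W g 1.
  have S0 x : (0 <= S x)%E by apply: nneseries_ge0 => j _ _; rewrite lee_fin powR_ge0.
  have uS N x := partial_sum_le g0 A0 GA1 G_le N x.
  have mEF : measurable_fun [set: T] (EFin \o F) by exact/measurable_EFinP.
  (* The sum [S] with [v = 1] dominates all partial sums, and [F] dominates [f]. Both satisfy weak
     bounds and are thus integrable against [decay]. *)
  apply: (@tempered_sum_dominated _ _ _ _ (fun x => (F x)%:E + S x)%E _ _ _ _ _ _ _
      (B `|` \bigcap_(k : nat) hot_set G (2 ^+ k))).
  + exact: f0.
  + by move=> j; exact: (L0M (@L0_cst R n _) (L0_atom n0 w W q1 qp g0 A0 GA1 j)).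
  + exact: (emeasurable_funD mEF mS).
  + by move=> x; rewrite leeDl.
  + move=> j x; apply: (@le_trans _ _ (S x)); last by rewrite leeDr// lee_fin.
    apply: le_trans (uS j.+1 x); rewrite lee_fin big_ord_recr/= lerDr sumr_ge0// => i _.
    exact: cmod_ge0.
  + move=> N x; apply: (@le_trans _ _ ((F x)%:E + (\sum_(j < N) cmod
        ((atom_coef K W g j)%:C%C * atom w W g j x))%:E)%E); last by rewrite leeD2l.
    rewrite -EFinD lee_fin; apply: (le_trans (le_normcD _ _)); rewrite lerD2l.
    by rewrite -mulN1r [leLHS]cmodM -[X in cmod X](rmorphN1 (real_complex R)) cmod_real normrN1 mul1r
      (cmod_sum (fun j => (atom_coef K W g j)%:C%C * atom w W g j x)).
  + have mdec : measurable_fun [set: T] (fun x => (decay x)%:E : \bar R).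
      by apply/measurable_EFinP; exact: measurable_decay.
    under eq_integral do rewrite ge0_muleDl ?lee_fin//.
    rewrite (ge0_integralD mu measurableT).
    * apply: lte_add_pinfty; first exact: (weak_integral_decay q1 qp A0 mEF _ FA1).
      have l1 : (0 : R) < 1 := ltr01.
      have b0 : 0 < bound_const n K W q 1 * (a0 + 1).
        by apply: mulr_gt0 => //; exact: bound_const_gt0.
      have wS : weak_bound p q (bound_const n K W q 1 * (a0 + 1)) S.
        have := weak_bound_atomic_sum K n0 W0 q1 qp g0 A0 GA1 l1; congr weak_bound.
        by apply/funext => x; rewrite invr1 poweRe1.
      exact: (weak_integral_decay q1 qp b0 mS S0 wS).
    * by move=> x _; rewrite mule_ge0// lee_fin ?decay_ge0.
    * exact: (emeasurable_funM mEF mdec).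
    * by move=> x _; rewrite mule_ge0// lee_fin ?decay_ge0.
    * exact: (emeasurable_funM mS mdec).
  + apply: negligibleU => //; exact: (negligible_hot_sets n0 q1 qp mG G0 A0 GA1).
  + move=> x /not_orP[nBx hx]; rewrite -(gf x nBx).
    exact: (atomic_series_cvg g0 A0 GA1 G_le hx).
split; first by move=> j x; exact: (atom_bound n0 wW W0 q1 qp g0 A0 GA1 G_le).
move=> v v0; have b0 := bound_const_gt0 n K W0 q1 v0.
have mS : measurable_fun [set: T] (fun x => atomic_sum K W g v x `^ v^-1)%E.
  exact: (measurableT_comp (measurable_poweR _) (measurable_atomic_sum K W g v)).
apply/lee_addgt0Pr => e e0; rewrite a0E.
set b := bound_const n K W q v in b0 *.
(* With the norm plus [e / b] as the constant, the bound exceeds [b] times the norm by exactly [e],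
   which is arbitrary; the atoms stay the same as [e] varies. *)
have eb : 0 < e / b by rewrite divr_gt0.
have A'0 : 0 < a0 + e / b by rewrite ltr_wpDl.
have -> : (b%:E * a0%:E + e%:E = (b * (a0 + e / b))%:E)%E.
  by rewrite -EFinM -EFinD mulrDr mulrCA mulfV ?gt_eqF// mulr1.
apply: (norm_of_weak_bound q1 _ mS); first by rewrite mulr_ge0 ?ltW.
have GA2 : weak_bound p q (a0 + e / b) (EFin \o G) by apply: GA; rewrite lerDl ltW.
have := weak_bound_atomic_sum K n0 W0 q1 qp g0 A'0 GA2 v0; congr weak_bound.
by apply/funext => x; rewrite gee0_abs// poweR_ge0.
Qed.

End decomposition.

Theorem corollary1p6 (R : realType) (n : nat) (hn : (0 < n)%N)
    (p q : R) (hq : 1 < q) (hqp : q <= p) (K : nat) :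
  exists2 C : R -> R, (forall v : R, 0 < v -> 0 < C v) &
    forall f : 'rV[R]_n -> R[i], weak_morrey p q f ->
      exists (lam : nat -> R) (Q : nat -> set 'rV[R]_n)
             (a : nat -> 'rV[R]_n -> R[i]),
        [/\ forall j, 0 <= lam j,
            forall j, cube (Q j),
            forall j, Linfty (a j) /\ Pperp K (a j),
            tempered_sum (fun j x => (lam j)%:C%C * a j x) f &
            (forall j x, cmod (a j x) <= \1_(Q j) x) /\
            forall v : R, 0 < v ->
              (weak_morrey_norm p q
                 (fun x => (\sum_(0 <= j <oo)
                    ((lam j * \1_(Q j) x) `^ v)%:E) `^ v^-1)
               <= (C v)%:E * weak_morrey_norm p q (cabs f))%E].
Proof.
have [w wE] := quadrature_weights R K.
have bw i := poly_bounded (w i) K.+1%:R.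
pose c i := projT1 (cid2 (bw i)).
have c0 i : 0 <= c i by rewrite /c; case: cid2.
have cw i x : `|x| <= K.+1%:R -> `|(w i).[x]| <= c i.
  by rewrite /c; case: cid2 => M /= _; exact.
(* A common bound for all weights on the interval from 0 to [K.+1%:R], the range of the rescaled
   coordinates on a cube. *)
pose W := \sum_i c i.
have W0 : 0 <= W by apply: sumr_ge0.
have wW i (x : R) : 0 <= x <= K.+1%:R -> `|(w i).[x]| <= W.
  move=> /andP[x0 xK]; apply: (@le_trans _ _ (c i)); first by apply: cw; rewrite ger0_norm.
  by rewrite /W (bigD1 i)//= lerDl sumr_ge0.
exists (bound_const n K W q) => [v v0|f fW]; first exact: bound_const_gt0.
exact: (atomic_decomposition hn wE wW W0 hq hqp fW).
Qed.
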